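(* Let $\mathcal{A}$ be a van Hove sequence on $G$ and let $\varLambda\subseteq G$ be a weak model set of maximal density with respect to $\mathcal{A}$. Then its Dirac comb $\delta_\varLambda=\sum_{x\in\varLambda}\delta_x$ is translation bounded and Besicovitch almost periodic with respect to $\mathcal{A}$.
   Context: $G$ is a locally compact (Hausdorff), $\sigma$-compact abelian group with Haar measure $\theta_G$; $|A|=\theta_G(A)$, and $\mathrm{d}t$ denotes integration against $\theta_G$. A measure $\mu$ is translation bounded if $\sup_{t\in G}|\mu|(t+V)<\infty$ for one (equivalently every) nonempty open relatively compact $V$; $(\mu*\varphi)(t)=\int_G\varphi(t-s)\,\mathrm{d}\mu(s)$ for $\varphi\in C_c(G)$. A van Hove sequence $\mathcal{A}=(A_n)$ is a sequence of relatively compact open sets (of positive measure) with $|\partial^K A_n|/|A_n|\to 0$ for every compact $K\subseteq G$, where $\partial^K A=\big(\overline{A+K}\cap\overline{A^c}\big)\cup\big(\overline{A^c-K}\cap\overline{A}\big)$. A cut and project scheme $(G,H,\mathcal{L})$ consists of locally compact abelian groups $G,H$ and a lattice (discrete cocompact subgroup) $\mathcal{L}\subseteq G\times H$ such that the projection $\pi^G:G\times H\to G$ is injective on $\mathcal{L}$ and $\pi^H(\mathcal{L})$ is dense in $H$. With $L=\pi^G(\mathcal{L})$, the star map $L\to H$, $x\mapsto x^\star$, is determined by $(x,x^\star)\in\mathcal{L}$. For $W\subseteq H$ let $\curlywedge(W)=\{x\in L:x^\star\in W\}$. $\theta_H$ is a Haar measure on $H$ and $\operatorname{dens}(\mathcal{L})$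 is the density of $\mathcal{L}$ in $G\times H$ (reciprocal of the $\theta_G\times\theta_H$-volume of a fundamental domain). $\varLambda$ is a weak model set of maximal density with respect to $\mathcal{A}$ if $\varLambda=\curlywedge(W)$ for some cut and project scheme $(G,H,\mathcal{L})$ and some compact $W\subseteq H$ such that $\lim_{m\to\infty}\frac{1}{|A_m|}\operatorname{card}(\curlywedge(W)\cap A_m)=\operatorname{dens}(\mathcal{L})\,\theta_H(W)$. For $f\in\mathcal{L}^1_{loc}(G)$ put $\|f\|_{\mathsf{B},1,\mathcal{A}}=\limsup_n\frac{1}{|A_n|}\int_{A_n}|f(t)|\,\mathrm{d}t$. A function $f\in\mathcal{L}^1_{loc}(G)$ is Besicovitch almost periodic with respect to $\mathcal{A}$ if for each $\varepsilon>0$ there is a trigonometric polynomial $P$ (finite linear combination of continuous characters of $G$) with $\|f-P\|_{\mathsf{B},1,\mathcal{A}}<\varepsilon$; a measure $\mu$ is Besicovitch almost periodic with respect to $\mathcal{A}$ if all $\mu*\varphi$, $\varphi\in C_c(G)$, are. *)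

(* Defs.v *)
From HB Require Import structures.
From mathcomp Require Import all_boot all_order all_algebra.
From mathcomp Require Import complex.
From mathcomp Require Import all_classical all_reals all_analysis.

Set Implicit Arguments.
Unset Strict Implicit.
Unset Printing Implicit Defensive.

Import Order.TTheory GRing.Theory Num.Theory.
Import numFieldNormedType.Exports.

Local Open Scope classical_set_scope.
Local Open Scope ring_scope.

(* The library makes [G * H] a topological group only for topological vector
   spaces [G] and [H], and [prod] cannot receive a second such instance; hence
   this alias of [G * H], with the product topology and componentwise addition. *)
Definition prod_group (G H : topologicalZmodType) : Type := (G * H)%type.

Section prod_topologicalZmodule.
Variables G H : topologicalZmodType.

HB.instance Definition _ := Topological.copy (prod_group G H) (G * H)%type.
HB.instance Definition _ := GRing.Zmodule.copy (prod_group G H) (G * H)%type.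

Lemma prod_group_sub_continuous :
  continuous (fun x : prod_group G H * prod_group G H => x.1 - x.2).
Proof.
move=> [[a b] [c d]] U /= [/= [V W] [/= nV nW] VWU].
have [/= [A B] [/= nA nB] AB] := @sub_continuous G (a, c) V nV.
have [/= [C D] [/= nC nD] CD] := @sub_continuous H (b, d) W nW.
exists (A `*` C, B `*` D) => /=.
  by split; [exists (A, C)|exists (B, D)].
move=> [[a' b'] [c' d']] /= [[Aa Cb] [Bc Dd]]; apply: VWU; split => /=.
  exact: (AB (a', c')).
exact: (CD (b', d')).
Qed.

HB.instance Definition _ :=
  PreTopologicalNmodule_isTopologicalZmodule.Build (prod_group G H)
    prod_group_sub_continuous.

End prod_topologicalZmodule.

(* [borel G] is the measurable space of the Borel sets of [G], whose carrier is
   convertible to [G]; measurable types of the library are pointed, hence the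
   alias [pointed_group], with base point 0. *)
Definition pointed_group (G : topologicalZmodType) : Type := G.

HB.instance Definition _ (G : topologicalZmodType) :=
  Choice.on (pointed_group G).
HB.instance Definition _ (G : topologicalZmodType) :=
  isPointed.Build (pointed_group G) (0 : G).

Definition borel (G : topologicalZmodType) :=
  g_sigma_algebraType ([set U | open (U : set G)] : set (set (pointed_group G))).

Definition translate (G : zmodType) (t : G) (B : set G) : set G :=
  [set t + s | s in B].

Definition lca_group (G : topologicalZmodType) : Prop :=
  hausdorff_space G /\ locally_compact [set: G].

Definition sigma_compact (G : topologicalType) : Prop :=
  exists2 K : nat -> set G, (forall n, compact (K n)) & \bigcup_n K n = setT.

Section haar.
Context {R : realType}.
Local Open Scope ereal_scope.

(* A Haar measure is a nonzero, translation invariant Radon measure. *)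
Definition haar_measure (G : topologicalZmodType)
    (mu : {measure set (borel G) -> \bar R}) : Prop :=
  [/\ mu setT != 0,
      forall (t : G) (B : set (borel G)),
        measurable B -> mu (translate t B) = mu B,
      forall K : set G, compact K -> mu K < +oo,
      forall B : set (borel G), measurable B ->
        mu B = ereal_inf [set mu U | U in [set U : set G | open U /\ B `<=` U]]
    & forall U : set G, open U ->
        mu U = ereal_sup [set mu K | K in [set K : set G | compact K /\ K `<=` U]]].

(* The Haar measure theta_G x theta_H of the product group.  The product measure
   of the library lives on the product of the Borel sigma-algebras and needs a
   sigma-finite factor; [H] need not be sigma-compact nor second countable, so
   the Radon product is singled out by its values on compact rectangles. *)
Definition product_haar_measure (G H : topologicalZmodType)
    (mu : {measure set (borel G) -> \bar R})
    (nu : {measure set (borel H) -> \bar R})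
    (munu : {measure set (borel (prod_group G H)) -> \bar R}) : Prop :=
  haar_measure munu /\
  forall (A : set G) (B : set H), compact A -> compact B ->
    munu (A `*` B) = mu A * nu B.

End haar.

Section van_hove.
Context {R : realType} {G : topologicalZmodType}.

Definition van_hove_boundary (K A : set G) : set G :=
  (closure [set a + k | a in A & k in K] `&` closure (~` A)) `|`
  (closure [set a - k | a in ~` A & k in K] `&` closure A).

Local Open Scope ereal_scope.

Definition van_hove_sequence (theta : {measure set (borel G) -> \bar R})
    (A : nat -> set G) : Prop :=
  (forall n, [/\ open (A n), precompact (A n) & 0 < theta (A n)]) /\
  (forall K : set G, compact K ->
    (fun n => theta (van_hove_boundary K (A n)) / theta (A n)) @ \oo --> 0).

End van_hove.

Section lattice.
Local Open Scope quotient_scope.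
Variables (T : topologicalZmodType) (L : set T).

Definition subgroup : Prop := L 0 /\ forall x y, L x -> L y -> L (x - y).

Definition coset_rel : rel T := fun x y => `[< L (x - y) >].

Lemma coset_rel_refl : subgroup -> reflexive coset_rel.
Proof. by move=> [L0 _] x; apply/asboolP; rewrite subrr. Qed.

Lemma coset_rel_sym : subgroup -> symmetric coset_rel.
Proof.
move=> [L0 LB] x y; apply/asboolP/asboolP => /(LB _ _ L0);
  by rewrite sub0r opprB.
Qed.

Lemma coset_rel_trans : subgroup -> transitive coset_rel.
Proof.
move=> [L0 LB] y x z /asboolP Lxy /asboolP Lyz; apply/asboolP.
have := LB _ _ Lxy (LB _ _ L0 Lyz).
by rewrite sub0r opprK addrA subrK.
Qed.

Definition coset_equiv (sL : subgroup) : equiv_rel T :=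
  EquivRel coset_rel (coset_rel_refl sL) (coset_rel_sym sL)
    (coset_rel_trans sL).

Definition cocompact (sL : subgroup) : Prop :=
  compact [set: quotient_topology {eq_quot (coset_equiv sL)}].

Definition lattice : Prop :=
  exists sL : subgroup, L `<=` isolated L /\ cocompact sL.

(* Relative compactness is part of the definition: when [L] is uncountable,
   other Borel systems of representatives can have a different volume. *)
Definition fundamental_domain (F : set T) : Prop :=
  [/\ (measurable : set (set (borel T))) F, precompact F
    & forall x, exists! l, L l /\ F (x - l)].

End lattice.

Section cut_and_project.
Variables (G H : topologicalZmodType) (L : set (prod_group G H)).

Definition cut_and_project_scheme : Prop :=
  [/\ lca_group G, lca_group H, lattice L,
      {in L &, injective (fst : prod_group G H -> G)}
    & dense [set p.2 | p in L]].

Definition star_map (x : G) : H := xget 0 [set h | L (x, h)].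

Definition model_set (W : set H) : set G :=
  [set x | [set p.1 | p in L] x /\ W (star_map x)].

End cut_and_project.

Section weak_model_set.
Context {R : realType}.
Local Open Scope ereal_scope.

(* [d] is the density of the lattice [L] of [T] with Haar measure [mu]. *)
Definition lattice_density (T : topologicalZmodType)
    (mu : {measure set (borel T) -> \bar R}) (L : set T) (d : \bar R) : Prop :=
  exists2 F, fundamental_domain L F & d = (mu F)^-1.

Definition weak_model_set_of_maximal_density (G : topologicalZmodType)
    (thetaG : {measure set (borel G) -> \bar R}) (A : nat -> set G)
    (Lambda : set G) : Prop :=
  exists (H : topologicalZmodType) (L : set (prod_group G H)) (W : set H)
      (thetaH : {measure set (borel H) -> \bar R})
      (thetaGH : {measure set (borel (prod_group G H)) -> \bar R}) (d : \bar R),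
    [/\ cut_and_project_scheme L, compact W & Lambda = model_set L W] /\
    [/\ haar_measure thetaH, product_haar_measure thetaG thetaH thetaGH,
        lattice_density thetaGH L d
      & (fun m => counting (model_set L W `&` A m) / thetaG (A m)) @ \oo
          --> d * thetaH W].

End weak_model_set.

Section dirac_comb.
Local Open Scope ereal_scope.
Variables (R : realType) (G : topologicalZmodType) (Lambda : set G).

Definition dirac_comb (B : set (borel G)) : \bar R :=
  \esum_(x in Lambda) dirac (x : borel G) B.

Let dirac_combE B : dirac_comb B = \esum_(x in Lambda `&` B) 1.
Proof.
rewrite esum_mkcondr; apply: eq_esum => x _.
by rewrite /dirac indicE; case: ifPn.
Qed.

Let dirac_comb0 : dirac_comb set0 = 0.
Proof. by rewrite dirac_combE setI0 esum_set0. Qed.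

Let dirac_comb_ge0 B : 0 <= dirac_comb B.
Proof. exact: esum_ge0. Qed.

Let dirac_comb_sigma_additive : semi_sigma_additive dirac_comb.
Proof.
move=> F mF tF mUF; rewrite dirac_combE setI_bigcupr esum_bigcupT//; last first.
  exact: trivIset_setIl.
under eq_esum do rewrite -dirac_combE.
rewrite -nneseries_esumT; last by move=> n; exact: dirac_comb_ge0.
by apply: is_cvg_nneseries => n _ _; exact: dirac_comb_ge0.
Qed.

HB.instance Definition _ := isMeasure.Build _ (borel G) R dirac_comb
  dirac_comb0 dirac_comb_ge0 dirac_comb_sigma_additive.

End dirac_comb.
Arguments dirac_comb : clear implicits.

Section besicovitch.
Context {R : realType} {G : topologicalZmodType}.

(* For a positive measure [mu], |mu| = mu. *)
Definition translation_bounded (mu : {measure set (borel G) -> \bar R}) : Prop :=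
  forall V : set G, V !=set0 -> open V -> precompact V ->
    (ereal_sup [set mu (translate t V) | t in [set: G]] < +oo)%E.

(* The type ascription selects the norm topology of [R[i]]. *)
Definition ccontinuous (f : G -> R[i]) : Prop :=
  continuous (f : G -> (R[i] : numClosedFieldType)).

Definition Cc (phi : G -> R[i]) : Prop :=
  ccontinuous phi /\ compact (closure [set x | phi x != 0]).

Definition conv_measure (mu : {measure set (borel G) -> \bar R})
    (phi : G -> R[i]) (t : G) : R[i] :=
  Complex (Rintegral mu setT (fun s : borel G => complex.Re (phi (t - s))))
          (Rintegral mu setT (fun s : borel G => complex.Im (phi (t - s)))).

Definition continuous_character (chi : G -> R[i]) : Prop :=
  [/\ ccontinuous chi, forall x, `|chi x| = 1
    & forall x y, chi (x + y) = chi x * chi y].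

Definition trigonometric_polynomial (P : G -> R[i]) : Prop :=
  exists (n : nat) (c : 'I_n -> R[i]) (chi : 'I_n -> G -> R[i]),
    (forall i, continuous_character (chi i)) /\
    P = (fun t => \sum_(i < n) c i * chi i t).

Variable theta : {measure set (borel G) -> \bar R}.

Definition L1loc (f : G -> R[i]) : Prop :=
  forall K : set G, compact K ->
    theta.-integrable K (fun t : borel G => (complex.Re (f t))%:E) /\
    theta.-integrable K (fun t : borel G => (complex.Im (f t))%:E).

Variable A : nat -> set G.

Definition besicovitch_norm (f : G -> R[i]) : \bar R :=
  limn_esup (fun n =>
    (\int[theta]_(t in (A n : set (borel G))) (Normc.normc (f t))%:E / theta (A n))%E).

Definition besicovitch_ap (f : G -> R[i]) : Prop :=
  L1loc f /\ forall eps : R, 0 < eps ->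
    exists2 P, trigonometric_polynomial P &
      (besicovitch_norm (fun t => (f t - P t)%R) < eps%:E)%E.

Definition besicovitch_ap_measure (mu : {measure set (borel G) -> \bar R}) :
    Prop :=
  forall phi, Cc phi -> besicovitch_ap (conv_measure mu phi).

End besicovitch.

(* Main.v *)
(** A function is Bohr almost periodic when its translates are totally bounded
    for the uniform distance.  Such a function has a mean; convolution by an
    even almost periodic function is an operator whose normalised even powers
    converge to an idempotent, and a minimal idempotent is a multiple of the real
    part of a character.  This gives the approximation of almost
    periodic functions by trigonometric polynomials without Pontryagin duality or
    the Bohr compactification.

    For [phi] and [u] continuous with compact support, the sum over the lattice
    points [(x, x')] of [phi (t - x) * u x'] is an almost periodic function of [t],
    because the lattice is cocompact.  The indicator of the window [W] is
    dominated by a continuous [om] whose integral exceeds [thetaH W] by little;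
    the mean of the sum for [om] is computed on the fundamental domain, and
    maximal density says that the difference between the sums for [om] and for
    the indicator of [W] has small upper mean along the van Hove sequence. *)
Require Import Defs.
From HB Require Import structures.
From mathcomp Require Import all_boot all_order all_algebra.
From mathcomp Require Import complex finmap.
From mathcomp Require Import all_classical all_reals all_analysis.
From mathcomp Require Import measurable_realfun ring lra zify.

Set Implicit Arguments.
Unset Strict Implicit.
Unset Printing Implicit Defensive.

Import Order.TTheory GRing.Theory Num.Theory.
Import numFieldNormedType.Exports.

Local Open Scope classical_set_scope.
Local Open Scope ring_scope.

(** * Bohr almost periodic functions and their means *)

(** The space of almost periodic functions need not be complete for the inner product
    [mean (f * g)]. A convolution, however, is bounded uniformly by the mean-square norms of its
    factors, so the sequences that have to converge are convolutions with a fixed function; their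
    limits are uniform and stay almost periodic. Even real kernels make the convolution operators
    self-adjoint. A nonzero idempotent [e] has [e 0 >= 1], which bounds how often it can be split; a
    minimal one yields a solution of d'Alembert's equation, from which the sine is reconstructed.

    The indicator of [W] is not continuous, so its own lattice sum need not be almost periodic. The
    comparison with [om] is one-sided: an upper bound for the mean of the sum for [om], a lower
    bound for the count in [W], and a nonnegative difference. Weighted counts and integrals over
    [A n] differ only through lattice points near the boundary of [A n]. Translates of a fixed
    neighbourhood to these points overlap a bounded number of times and lie in a van Hove boundary,
    so these points are negligible. *)

Section mean.
Context {R : realType} {X : zmodType}.
Implicit Types (f g h : X -> R) (s : seq X) (c e : R).

(* Total boundedness of the set of translates of [f]: the translates by elements
   of one colour are uniformly [e]-close. *)
Definition bohr f := forall e, 0 < e -> exists (T : finType) (col : X -> T),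
  forall x y, col x = col y -> forall z, `|f (x + z) - f (y + z)| <= e.

Definition avg s f : X -> R := fun x => (\sum_(t <- s) f (x + t)) / (size s)%:R.

(** The least uniform upper bound that finite averages of translates can reach. For a Bohr function
    the same averages are also bounded below, see [bohr_is_mean], so this plays the part of an
    invariant mean. *)
Definition mean f : R :=
  inf [set a | exists s, s != [::] /\ forall x, avg s f x <= a].

Lemma size_gt0R s : s != [::] -> 0 < (size s)%:R :> R.
Proof. by rewrite ltr0n lt0n size_eq0. Qed.

Lemma avg_cst s c : s != [::] -> avg s (fun=> c) = (fun=> c).
Proof.
move=> s0; apply/funext => x; rewrite /avg big_const_seq count_predT iter_addr_0.
by rewrite -(mulr_natr c) mulfK// gt_eqF// size_gt0R.
Qed.

Lemma avgD s f g : avg s (f + g) = avg s f + avg s g.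
Proof. by apply/funext => x; rewrite /avg big_split mulrDl. Qed.

Lemma avgZ s c f : avg s (c *: f) = c *: avg s f.
Proof.
by apply/funext => x; rewrite /avg fctE -mulr_sumr -mulrA.
Qed.

Lemma le_avg s f g x : (forall y, f y <= g y) -> avg s f x <= avg s g x.
Proof.
by move=> fg; rewrite /avg ler_wpM2r ?invr_ge0//; exact: ler_sum.
Qed.

Lemma avg_le s f c x : s != [::] -> (forall y, f y <= c) -> avg s f x <= c.
Proof.
move=> s0 fc; rewrite (_ : c = avg s (fun=> c) x); first exact: le_avg.
by rewrite avg_cst.
Qed.

Lemma avg_ge s f c x : s != [::] -> (forall y, c <= f y) -> c <= avg s f x.
Proof.
move=> s0 fc; rewrite (_ : c = avg s (fun=> c) x); first exact: le_avg.
by rewrite avg_cst.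
Qed.

Lemma avg_avg s s' f :
  avg s (avg s' f) = avg [seq x + y | x <- s, y <- s'] f.
Proof.
apply/funext => x; rewrite /avg big_allpairs_dep size_allpairs -mulr_suml natrM.
rewrite -mulrA -invfM [(_ * _%:R)%R in RHS]mulrC; congr (_ / _).
by apply: eq_bigr => t _; apply: eq_bigr => u _; rewrite addrA.
Qed.

Lemma avgC s s' f : avg s (avg s' f) = avg s' (avg s f).
Proof.
apply/funext => x; rewrite /avg -!mulr_suml -!mulrA [_^-1 / _]mulrC.
congr (_ * _); rewrite exchange_big; apply: eq_bigr => t _.
by apply: eq_bigr => u _; rewrite addrAC.
Qed.

Lemma allpairs_neq0 s s' : s != [::] -> s' != [::] ->
  [seq x + y | x <- s, y <- s'] != [::].
Proof. by rewrite -!size_eq0 size_allpairs muln_eq0 negb_or => -> ->. Qed.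

Definition is_mean f c := forall e, 0 < e ->
  exists s, s != [::] /\ forall x, `|avg s f x - c| <= e.

(** Averaging over [s] and over [t] commute, and the double average at 0 is close to both [c] and
    [d]. *)
Lemma is_mean_unique f c d : is_mean f c -> is_mean f d -> c = d.
Proof.
move=> fc fd; apply/eqP; rewrite -subr_eq0 -normr_le0; apply/ler_addgt0Pr => e e0.
have e20 : 0 < e / 2 by rewrite divr_gt0.
have [s [s0 sc]] := fc (e / 2) e20.
have [t [t0 td]] := fd (e / 2) e20.
have H1 : `|avg t (avg s f) 0 - c| <= e / 2.
  rewrite ler_norml; apply/andP; split.
    rewrite lerBrDl; apply: avg_ge => // y; have := sc y.
    by rewrite ler_norml; lra.
  rewrite lerBlDl; apply: avg_le => // y; have := sc y.
  by rewrite ler_norml; lra.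
have H2 : `|avg t (avg s f) 0 - d| <= e / 2.
  rewrite avgC ler_norml; apply/andP; split.
    rewrite lerBrDl; apply: avg_ge => // y; have := td y.
    by rewrite ler_norml; lra.
  rewrite lerBlDl; apply: avg_le => // y; have := td y.
  by rewrite ler_norml; lra.
move: H1 H2; rewrite add0r !ler_norml; lra.
Qed.

Lemma bohr_reps f e : bohr f -> 0 < e -> exists s, s != [::] /\
  forall x, exists2 t, t \in s & forall z, `|f (x + z) - f (t + z)| <= e.
Proof.
move=> bf e0; have [T [col colP]] := bf _ e0.
(* Colours that are not attained get the representative 0, which is harmless: only the colour of an
   actual point is looked up. *)
pose rep i := xget 0 [set x | col x = i].
exists [seq rep i | i <- enum T]; split.
  by rewrite -size_eq0 size_map -cardE; apply/eqP => /card0_eq /(_ (col 0)).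
move=> x; exists (rep (col x)); first by apply: map_f; rewrite mem_enum.
by apply: colP; rewrite (@xgetPex _ 0 [set y | col y = col x])//; exists x.
Qed.

Lemma bohr_bounded f : bohr f -> exists M, forall x, `|f x| <= M.
Proof.
move=> bf; have [s [s0 sP]] := bohr_reps bf ltr01.
exists (\sum_(t <- s) `|f t| + 1) => x; have [t ts /(_ 0)] := sP x.
rewrite !addr0 => ft; have : `|f t| <= \sum_(t <- s) `|f t|.
  by rewrite (big_rem t ts)/= lerDl sumr_ge0.
have := ler_normD (f x - f t) (f t); rewrite subrK; lra.
Qed.

(* Averaging over representatives of the colours moves a low value of [f] to
   within reach of every point. *)
Lemma bohr_avg_lt f e : bohr f -> 0 < e -> exists s d, [/\ s != [::], 0 < d &
  forall s' M, s' != [::] -> (forall x, avg s' f x <= M) ->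
    (exists y, avg s' f y <= M - e) -> forall x, avg s (avg s' f) x <= M - d].
Proof.
move=> bf e0; have e20 : 0 < e / 2 by rewrite divr_gt0.
have [s [s0 sP]] := bohr_reps bf e20.
have ss := size_gt0R s0.
exists s, (e / 2 / (size s)%:R); split => // [|s' M s'0 fM [y fy] x].
  by rewrite divr_gt0.
have [t ts ft] := sP (y - x).
have H : avg s' f (x + t) <= M - e / 2.
  suff: `|avg s' f y - avg s' f (x + t)| <= e / 2 by rewrite ler_norml; lra.
  rewrite /avg -mulrBl -sumrB normrM [X in _ * X]gtr0_norm ?invr_gt0 ?size_gt0R//.
  rewrite ler_pdivrMr ?size_gt0R//; apply: (le_trans (ler_norm_sum _ _ _)).
  rewrite mulr_natr -[e / 2 *+ _]iter_addr_0 -(count_predT s') -big_const_seq.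
  apply: ler_sum => u _; have := ft (x + u).
  by rewrite addrA subrK addrCA addrA.
rewrite {1}/avg ler_pdivrMr// mulrBl divfK ?gt_eqF//.
rewrite (big_rem t ts)/=; have : \sum_(u <- rem t s) avg s' f (x + u) <=
    \sum_(u <- rem t s) M by exact: ler_sum.
rewrite big_const_seq count_predT iter_addr_0 size_rem//.
have: (0 < size s)%N by rewrite lt0n size_eq0.
by case: (size s) => // n _; rewrite /= -natr1 mulrDr mulr1 mulr_natr; lra.
Qed.

(** Take an average whose upper bound [a] is almost the infimum. If it fell to [a - e / 2]
    somewhere, averaging once more by [bohr_avg_lt] would lower the bound to [a - d], below the
    infimum. *)
Lemma bohr_is_mean f : bohr f -> is_mean f (mean f).
Proof.
move=> bf e e0; have e20 : 0 < e / 2 by rewrite divr_gt0.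
have [s [d [s0 d0 sd]]] := bohr_avg_lt bf e20.
have [B fB] := bohr_bounded bf.
set A := [set a | exists s, s != [::] /\ forall x, avg s f x <= a].
have hA : has_inf A.
  split; first by exists B; exists [:: 0]; split => // x; apply: avg_le => // y;
    rewrite (le_trans _ (fB y))// ler_norm.
  exists (- B) => a [u [u0 /(_ 0)]]; apply: le_trans; apply: avg_ge => // y.
  by rewrite lerNl (le_trans _ (fB y))// -normrN ler_norm.
have md : 0 < Num.min d (e / 2) by rewrite lt_min d0.
have [a [u [u0 ua]] am] := inf_adherent md hA.
exists u; split => // x.
have {}am : a < mean f + Num.min d (e / 2) by [].
have [ad ae] : a < mean f + d /\ a < mean f + e / 2.
  by move: am; rewrite -!ltrBlDl lt_min => /andP.
have lb : forall y, a - e / 2 < avg u f y.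
  move=> y; rewrite ltNge; apply/negP => uy.
  have us := sd u a u0 ua (ex_intro _ y uy).
  suff : mean f <= a - d by lra.
  apply: ge_inf; first by case: hA.
  exists [seq x + y | x <- s, y <- u]; split; first exact: allpairs_neq0.
  by move=> z; rewrite -avg_avg; exact: us.
have ma : mean f <= a by apply: ge_inf; [case: hA|exists u].
by rewrite ler_norml; have := lb x; have := ua x; lra.
Qed.

Lemma is_meanE f c : bohr f -> is_mean f c -> mean f = c.
Proof. by move=> /bohr_is_mean fm /(is_mean_unique fm). Qed.

Lemma bohr_mul_ap f g : bohr f -> bohr g -> bohr (f * g).
Proof.
move=> bf bg e e0; have [M fM] := bohr_bounded bf; have [N gN] := bohr_bounded bg.
have M0 : 0 <= M by rewrite (le_trans _ (fM 0)).
have N0 : 0 <= N by rewrite (le_trans _ (gN 0)).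
pose d := e / (M + N + 1).
have d0 : 0 < d by rewrite divr_gt0//; lra.
have dE : d * (M + N + 1) = e by rewrite divfK//; lra.
have [T [c cP]] := bf d d0; have [U [k kP]] := bg d d0.
exists (T * U)%type, (fun x => (c x, k x)) => x y [/cP fxy /kP gxy] z.
rewrite /= (_ : _ - _ = (f (x + z) - f (y + z)) * g (x + z) +
   f (y + z) * (g (x + z) - g (y + z))); last by rewrite !fctE; ring.
rewrite (le_trans (ler_normD _ _))// !normrM -dE.
have := ler_pM (normr_ge0 _) (normr_ge0 _) (fxy z) (gN (x + z)).
have := ler_pM (normr_ge0 _) (normr_ge0 _) (fM (y + z)) (gxy z).
nra.
Qed.

Lemma bohrD f g : bohr f -> bohr g -> bohr (f + g).
Proof.
move=> bf bg e e0; have e20 : 0 < e / 2 by rewrite divr_gt0.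
have [T [c cP]] := bf _ e20; have [U [k kP]] := bg _ e20.
exists (T * U)%type, (fun x => (c x, k x)) => x y [/cP fxy /kP gxy] z.
move: (fxy z) (gxy z); rewrite !fctE !ler_norml; lra.
Qed.

Lemma bohr_cst c : bohr (fun=> c).
Proof. by move=> e e0; exists unit, (fun=> tt) => x y _ z; rewrite subrr normr0 ltW. Qed.

Lemma bohrZ c f : bohr f -> bohr (c *: f).
Proof. by move=> bf; apply: bohr_mul_ap => //; exact: bohr_cst. Qed.

Lemma bohrN f : bohr f -> bohr (- f).
Proof. by move=> /(bohrZ (-1)); rewrite scaleN1r. Qed.

Lemma bohrB f g : bohr f -> bohr g -> bohr (f - g).
Proof. by move=> bf /bohrN; exact: bohrD. Qed.

Lemma bohr_norm f : bohr f -> bohr (fun x => `|f x|).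
Proof.
move=> bf e e0; have [T [c cP]] := bf _ e0; exists T, c => x y /cP fxy z.
by apply: le_trans (fxy z); apply: ler_dist_dist.
Qed.

Lemma bohr_unif f : (forall e, 0 < e -> exists2 g, bohr g &
  forall x, `|f x - g x| <= e) -> bohr f.
Proof.
move=> H e e0; have e30 : 0 < e / 3 by rewrite divr_gt0.
have [g bg fg] := H _ e30; have [T [c cP]] := bg _ e30.
exists T, c => x y /cP gxy z; move: (gxy z) (fg (x + z)) (fg (y + z)).
rewrite !ler_norml; lra.
Qed.

Lemma mean_cst c : mean (fun=> c) = c.
Proof.
apply: is_meanE (bohr_cst c) _ => e e0; exists [:: 0]; split => // x.
by rewrite avg_cst// subrr normr0 ltW.
Qed.

Lemma meanD f g : bohr f -> bohr g -> mean (f + g) = mean f + mean g.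
Proof.
move=> bf bg; apply: is_meanE; first exact: bohrD.
move=> e e0; have e20 : 0 < e / 2 by rewrite divr_gt0.
have [s [s0 sf]] := bohr_is_mean bf e20; have [t [t0 tg]] := bohr_is_mean bg e20.
exists [seq x + y | x <- s, y <- t]; split; first exact: allpairs_neq0.
move=> x; rewrite -avg_avg !avgD [avg s (avg t f)]avgC.
have : `|avg t (avg s f) x - mean f| <= e / 2.
  rewrite ler_norml; apply/andP; split; [rewrite lerBrDl|rewrite lerBlDl];
    [apply: avg_ge|apply: avg_le] => // y; have := sf y; rewrite ler_norml; lra.
have : `|avg s (avg t g) x - mean g| <= e / 2.
  rewrite ler_norml; apply/andP; split; [rewrite lerBrDl|rewrite lerBlDl];
    [apply: avg_ge|apply: avg_le] => // y; have := tg y; rewrite ler_norml; lra.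
rewrite !fctE !ler_norml; lra.
Qed.

Lemma meanZ c f : bohr f -> mean (c *: f) = c * mean f.
Proof.
move=> bf; have bcf := bohrZ c bf; apply: is_meanE => // e e0.
have d0 : 0 < e / (`|c| + 1) by rewrite divr_gt0// ltr_wpDl.
have [s [s0 sf]] := bohr_is_mean bf d0; exists s; split => // x.
rewrite avgZ fctE -mulrBr normrM; apply: (le_trans (ler_wpM2l _ (sf x))) => //.
by rewrite mulrCA ler_piMr ?ltW// ltr_pdivrMr ?ltr_wpDl// mul1r ltrDl.
Qed.

Lemma meanN f : bohr f -> mean (- f) = - mean f.
Proof. by move=> bf; rewrite -scaleN1r meanZ// mulN1r. Qed.

Lemma meanB f g : bohr f -> bohr g -> mean (f - g) = mean f - mean g.
Proof. by move=> bf bg; rewrite meanD ?meanN//; exact: bohrN. Qed.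

Lemma mean_le_cst f c : bohr f -> (forall x, f x <= c) -> mean f <= c.
Proof.
move=> bf fc; apply/ler_addgt0Pr => e e0; have [s [s0 sf]] := bohr_is_mean bf e0.
by move: (sf 0) (avg_le 0 s0 fc); rewrite ler_norml; lra.
Qed.

Lemma mean_ge_cst f c : bohr f -> (forall x, c <= f x) -> c <= mean f.
Proof.
move=> bf fc; rewrite -lerN2 -meanN//; apply: mean_le_cst; first exact: bohrN.
by move=> x; rewrite lerN2.
Qed.

Lemma normr_mean f c : bohr f -> (forall x, `|f x| <= c) -> `|mean f| <= c.
Proof.
move=> bf fc; rewrite ler_norml mean_le_cst ?mean_ge_cst// => x;
  by have := fc x; rewrite ler_norml => /andP[].
Qed.

Lemma bohr_shift f a : bohr f -> bohr (fun x => f (x + a)).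
Proof.
move=> bf e /bf[T [c cP]]; exists T, c => x y /cP xy z; by rewrite -!addrA.
Qed.

Lemma bohr_opp f : bohr f -> bohr (fun x => f (- x)).
Proof.
move=> bf e /bf[T [c cP]]; exists T, (fun x => c (- x)) => x y /cP xy z.
by rewrite !opprD.
Qed.

Lemma mean_shift f a : bohr f -> mean (fun x => f (x + a)) = mean f.
Proof.
move=> bf; have := bohr_shift a bf => bfa; apply: is_meanE => // e e0.
have [s [s0 sf]] := bohr_is_mean bf e0; exists s; split => // x.
rewrite (_ : avg _ _ _ = avg s f (x + a))//.
by rewrite /avg; congr (_ / _); apply: eq_bigr => t _; rewrite addrAC.
Qed.

Lemma mean_opp f : bohr f -> mean (fun x => f (- x)) = mean f.
Proof.
move=> bf; have := bohr_opp bf => bfa; apply: is_meanE => // e e0.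
have [s [s0 sf]] := bohr_is_mean bf e0; exists [seq - x | x <- s]; split => //.
  by rewrite -size_eq0 size_map size_eq0.
move=> x; rewrite (_ : avg _ _ _ = avg s f (- x))//.
rewrite /avg size_map big_map; congr (_ / _); apply: eq_bigr => t _.
by rewrite opprD opprK.
Qed.

Lemma mean_avg s f : s != [::] -> bohr f -> bohr (avg s f) /\ mean (avg s f) = mean f.
Proof.
move=> s0 bf.
have H : forall u, bohr (fun x => \sum_(t <- u) f (x + t)) /\
    mean (fun x => \sum_(t <- u) f (x + t)) = (size u)%:R * mean f.
  elim => [|a u [bu mu]].
    rewrite (_ : (fun x => _) = fun=> 0); last by apply/funext => x; rewrite big_nil.
    by rewrite mean_cst mul0r; split => //; exact: bohr_cst.
  rewrite (_ : (fun x => _) = (fun x => f (x + a)) + (fun x => \sum_(t <- u) f (x + t))).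
    have ba := bohr_shift a bf.
    by split; [exact: bohrD|rewrite meanD// mu mean_shift//= -natr1; ring].
  by apply/funext => x; rewrite big_cons fctE.
have [bu mu] := H s.
have -> : avg s f = (size s)%:R^-1 *: (fun x => \sum_(t <- s) f (x + t)).
  by apply/funext => x; rewrite /avg mulrC.
by split; [exact: bohrZ|rewrite meanZ// mu mulKf// gt_eqF// size_gt0R].
Qed.

(** A positive value recurs, up to half its size, near every point along the finitely many
    representatives, so some average of [f] has a positive lower bound. This makes [ip] below
    positive definite. *)
Lemma mean_eq0 f : bohr f -> (forall x, 0 <= f x) -> mean f = 0 -> f = (fun=> 0).
Proof.
move=> bf f0 mf; apply/funext => y; apply/eqP; rewrite eq_le f0 andbT leNgt.
apply/negP => fy; have y20 : 0 < f y / 2 by rewrite divr_gt0.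
have [s [s0 sP]] := bohr_reps bf y20.
have [ba ma] := mean_avg s0 bf.
have ss := size_gt0R s0.
suff : f y / 2 / (size s)%:R <= mean (avg s f).
  by apply/negP; rewrite -ltNge ma mf divr_gt0.
apply: mean_ge_cst => // x; rewrite /avg ler_pM2r ?invr_gt0//.
have [t ts /(_ x)] := sP (y - x); rewrite subrK [t + x]addrC => ft.
rewrite (big_rem t ts)/=; have : 0 <= \sum_(u <- rem t s) f (x + u) by apply: sumr_ge0.
by move: ft; rewrite ler_norml; lra.
Qed.

End mean.

Lemma pair_add (U V : zmodType) (a c : U) (b d : V) :
  (a + c, b + d) = (a, b) + (c, d) :> U * V.
Proof. by []. Qed.

Lemma bohr_comp {R : realType} {X Y : zmodType} (p : Y -> X) (f : X -> R) :
  (forall x y, p (x + y) = p x + p y) -> bohr f -> bohr (f \o p).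
Proof.
move=> pD bf e /bf[T [c cP]]; exists T, (c \o p) => x y /cP xy z /=.
by rewrite !pD.
Qed.

Section fctE_at.
Context {T : Type} {R : realType}.
Implicit Types (f g : T -> R) (c : R).

Lemma addf_at f g x : (f + g) x = f x + g x. Proof. by []. Qed.
Lemma oppf_at f x : (- f) x = - f x. Proof. by []. Qed.
Lemma mulf_at f g x : (f * g) x = f x * g x. Proof. by []. Qed.
Lemma scalef_at c f x : (c *: f) x = c * f x. Proof. by []. Qed.

Definition f_at := (addf_at, oppf_at, mulf_at, scalef_at).

End fctE_at.

(** * Convolution and inner product with respect to the mean *)

Section convolution.
Context {R : realType} {X : zmodType}.
Implicit Types (f g h k : X -> R) (c e : R).

(** Fubini for means. Take a nearly constant finite average of [F] on [X * X]; in the inner mean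
    over [t] the second coordinates of its translations disappear by invariance, and the first
    coordinates give the average for the outer mean. *)
Lemma bohr_mean2 (F : X * X -> R) : bohr F ->
  bohr (fun s => mean (fun t => F (s, t))) /\
  mean (fun s => mean (fun t => F (s, t))) = mean F.
Proof.
move=> bF.
have bs s : bohr (fun t => F (s, t)).
  move=> e /bF[T [c cP]]; exists T, (fun t => c (0, t)) => x y /cP xy z.
  by have := xy (s, z); rewrite -!pair_add !add0r.
have bm : bohr (fun s => mean (fun t => F (s, t))).
  move=> e /bF[T [c cP]]; exists T, (fun t => c (t, 0)) => x y /cP xy z.
  rewrite -meanB//; apply: normr_mean; first exact: bohrB.
  by move=> t; have := xy (z, t); rewrite -!pair_add !add0r.
split => //; apply: is_meanE => // e e0.
have [s [s0 sF]] := bohr_is_mean bF e0.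
exists [seq p.1 | p <- s]; split; first by rewrite -size_eq0 size_map size_eq0.
move=> x.
have H : forall u, bohr (fun t => \sum_(p <- u) F (x + p.1, t + p.2)) /\
   mean (fun t => \sum_(p <- u) F (x + p.1, t + p.2)) =
   \sum_(p <- u) mean (fun t => F (x + p.1, t)).
  elim => [|a u [bu mu]].
    rewrite (_ : (fun x => _) = fun=> 0); last by apply/funext => ?; rewrite big_nil.
    by rewrite mean_cst big_nil; split => //; exact: bohr_cst.
  rewrite (_ : (fun x => _) = (fun t => F (x + a.1, t + a.2)) +
     (fun t => \sum_(p <- u) F (x + p.1, t + p.2))).
    have ba := bohr_shift a.2 (bs (x + a.1)).
    by split; [exact: bohrD|rewrite meanD// mu (mean_shift a.2 (bs (x + a.1))) big_cons].
  by apply/funext => ?; rewrite big_cons fctE.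
have [bu mu] := H s.
have -> : avg [seq p.1 | p <- s] (fun s => mean (fun t => F (s, t))) x =
    mean (fun t => avg s F (x, t)).
  rewrite /avg size_map big_map -mu mulrC -meanZ//; congr mean.
  by apply/funext => t; rewrite f_at mulrC.
have ba : bohr (fun t => avg s F (x, t)).
  rewrite (_ : (fun t => _) = (size s)%:R^-1 *: (fun t => \sum_(p <- s) F (x + p.1, t + p.2))).
    exact: bohrZ.
  by apply/funext => t; rewrite f_at /avg mulrC.
rewrite ler_norml; apply/andP; split; [rewrite lerBrDl|rewrite lerBlDl];
  [apply: mean_ge_cst|apply: mean_le_cst] => // t; have := sF (x, t);
  rewrite ler_norml; lra.
Qed.

Lemma mean_swap (F : X -> X -> R) : bohr (fun p => F p.1 p.2) ->
  mean (fun s => mean (fun t => F s t)) = mean (fun t => mean (fun s => F s t)).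
Proof.
move=> bF; have [_ /= ->] := bohr_mean2 bF.
have bF' : bohr (fun p => F p.2 p.1).
  move=> e /bF[T [c cP]]; exists T, (fun t => c (t.2, t.1)) => x y /cP xy z.
  by have /= := xy (z.2, z.1).
have [_ /= ->] := bohr_mean2 bF'; apply/esym/is_meanE => // e e0.
have [s [s0 sF]] := bohr_is_mean bF e0.
exists [seq (p.2, p.1) | p <- s]; split; first by rewrite -size_eq0 size_map size_eq0.
by move=> x; have := sF (x.2, x.1); rewrite /avg size_map big_map.
Qed.

(** Convolution on the Bohr compactification, with [mean] in the place of its Haar measure. *)
Definition conv f g : X -> R := fun x => mean (fun s => f (x - s) * g s).

Definition refl f : X -> R := fun x => f (- x).

Definition ip f g : R := mean (f * g).

Lemma bohr_refl f : bohr f -> bohr (refl f). Proof. exact: bohr_opp. Qed.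

Lemma bohr_flip f x : bohr f -> bohr (fun s => f (x - s)).
Proof.
move=> bf; have /bohr_opp := bohr_shift x bf.
by congr bohr; apply/funext => s; rewrite addrC.
Qed.

Lemma mean_flip f x : bohr f -> mean (fun s => f (x - s)) = mean f.
Proof.
move=> bf; rewrite -(mean_shift x bf) -(mean_opp (bohr_shift x bf)).
by congr mean; apply/funext => s; rewrite addrC.
Qed.

Lemma bohr_slice f g x : bohr f -> bohr g -> bohr (fun s => f (x - s) * g s).
Proof. by move=> bf bg; apply: bohr_mul_ap => //; exact: bohr_flip. Qed.

Lemma bohr_conv f g : bohr f -> bohr g -> bohr (conv f g).
Proof.
move=> bf bg e e0; have [M gM] := bohr_bounded bg.
have M0 : 0 <= M by rewrite (le_trans _ (gM 0)).
have M1 : 0 < M + 1 by lra.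
have d0 : 0 < e / (M + 1) by rewrite divr_gt0.
have [T [c cP]] := bf _ d0; exists T, c => x y /cP xy z.
rewrite [conv f g]/conv -meanB; [|exact: bohr_slice..]; apply: normr_mean.
  by apply: bohrB; exact: bohr_slice.
move=> s; rewrite !f_at -mulrBl normrM -!addrA.
have dE : e / (M + 1) * (M + 1) = e by rewrite divfK ?gt_eqF.
have := ler_pM (normr_ge0 _) (normr_ge0 _) (xy (z - s)) (gM s).
have : 0 <= e / (M + 1) by exact: ltW.
nra.
Qed.

Lemma convC f g : bohr f -> bohr g -> conv f g = conv g f.
Proof.
move=> bf bg; apply/funext => x; rewrite /conv.
rewrite -(mean_flip x (bohr_slice x bf bg)); congr mean.
by apply/funext => s; rewrite subKr mulrC.
Qed.

Lemma convDl f g h : bohr f -> bohr g -> bohr h ->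
  conv (f + g) h = conv f h + conv g h.
Proof.
move=> bf bg bh; apply/funext => x.
rewrite f_at /conv -meanD; [|exact: bohr_slice..]; congr mean.
by apply/funext => s; rewrite !f_at mulrDl.
Qed.

Lemma convZl c f g : bohr f -> bohr g -> conv (c *: f) g = c *: conv f g.
Proof.
move=> bf bg; apply/funext => x; rewrite f_at /conv -meanZ; last exact: bohr_slice.
by congr mean; apply/funext => s; rewrite !f_at mulrA.
Qed.

Lemma convNl f g : bohr f -> bohr g -> conv (- f) g = - conv f g.
Proof. by move=> bf bg; rewrite -[- f]scaleN1r convZl// scaleN1r. Qed.

Lemma convBl f g h : bohr f -> bohr g -> bohr h ->
  conv (f - g) h = conv f h - conv g h.
Proof. by move=> bf bg bh; rewrite convDl ?convNl//; exact: bohrN. Qed.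

Lemma convDr f g h : bohr f -> bohr g -> bohr h ->
  conv f (g + h) = conv f g + conv f h.
Proof. by move=> bf bg bh; rewrite (convC bf (bohrD bg bh)) convDl// !(convC bf). Qed.

Lemma convZr c f g : bohr f -> bohr g -> conv f (c *: g) = c *: conv f g.
Proof. by move=> bf bg; rewrite (convC bf (bohrZ c bg)) convZl// (convC bf). Qed.

Lemma convBr f g h : bohr f -> bohr g -> bohr h ->
  conv f (g - h) = conv f g - conv f h.
Proof. by move=> bf bg bh; rewrite (convC bf (bohrB bg bh)) convBl// !(convC bf). Qed.

Lemma convA f g h : bohr f -> bohr g -> bohr h ->
  conv f (conv g h) = conv (conv f g) h.
Proof.
move=> bf bg bh; apply/funext => x; rewrite /conv.
have H1 : (fun s => f (x - s) * mean (fun t => g (s - t) * h t)) =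
    (fun s => mean (fun t => f (x - s) * (g (s - t) * h t))).
  by apply/funext => s; rewrite -meanZ//; exact: bohr_slice.
rewrite H1 mean_swap; last first.
  apply: (@bohr_mul_ap _ _ (fun p : X * X => f (x - p.1)) (fun p => g (p.1 - p.2) * h p.2)).
    have := bohr_flip x bf; apply: (@bohr_comp _ _ _ fst) => //.
  apply: (@bohr_mul_ap _ _ (fun p : X * X => g (p.1 - p.2)) (fun p => h p.2)).
    apply: (@bohr_comp _ _ _ (fun p : X * X => p.1 - p.2)) => // p q.
    by rewrite opprD addrACA.
  exact: (@bohr_comp _ _ _ snd).
congr mean; apply/funext => t.
have b1 := bohr_slice (x - t) bf bg.
rewrite mulrC -meanZ//.
have b2 : bohr (fun s => f (x - s) * (g (s - t) * h t)).
  apply: (@bohr_mul_ap _ _ (fun s => f (x - s)) (fun s => g (s - t) * h t)).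
    exact: bohr_flip.
  apply: (@bohr_mul_ap _ _ (fun s => g (s - t)) (fun s => h t)).
    exact: bohr_shift.
  exact: bohr_cst.
rewrite -(mean_shift t b2); congr mean; apply/funext => s.
by rewrite !f_at addrK opprD addrA addrAC mulrA mulrC.
Qed.

Lemma refl_conv f g : bohr f -> bohr g -> refl (conv f g) = conv (refl f) (refl g).
Proof.
move=> bf bg; apply/funext => x; rewrite /refl /conv.
rewrite -(mean_opp (bohr_slice (- x) bf bg)); congr mean; apply/funext => s.
by rewrite opprB opprK addrC.
Qed.

Lemma reflK f : refl (refl f) = f.
Proof. by apply/funext => x; rewrite /refl opprK. Qed.

Lemma ip_conv f g : ip f g = conv (refl f) g 0.
Proof. by rewrite /ip /conv; congr mean; apply/funext => s; rewrite /refl sub0r opprK. Qed.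

Lemma ipC f g : ip f g = ip g f. Proof. by rewrite /ip mulrC. Qed.

Lemma ip_ge0 f : bohr f -> 0 <= ip f f.
Proof.
by move=> bf; apply: mean_ge_cst; [exact: bohr_mul_ap|move=> x; rewrite f_at sqr_ge0].
Qed.

Lemma ip_eq0 f : bohr f -> ip f f = 0 -> f = 0.
Proof.
move=> bf f0; have : f * f = fun=> 0.
  by apply: mean_eq0 => //; [exact: bohr_mul_ap|move=> x; rewrite f_at sqr_ge0].
move=> /funeqP ff; apply/funext => x; have /eqP := ff x.
by rewrite f_at mulf_eq0 orbb => /eqP.
Qed.

Lemma ipDl f g h : bohr f -> bohr g -> bohr h -> ip (f + g) h = ip f h + ip g h.
Proof. by move=> bf bg bh; rewrite /ip mulrDl meanD//; exact: bohr_mul_ap. Qed.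

Lemma ipZl c f g : bohr f -> bohr g -> ip (c *: f) g = c * ip f g.
Proof. move=> bf bg; rewrite /ip -meanZ; last exact: bohr_mul_ap.
by congr mean; apply/funext => x; rewrite !f_at mulrA. Qed.

Lemma ipBl f g h : bohr f -> bohr g -> bohr h -> ip (f - g) h = ip f h - ip g h.
Proof.
move=> bf bg bh; rewrite ipDl//; last exact: bohrN.
by rewrite -[in ip (- g)]scaleN1r ipZl// mulN1r.
Qed.

Lemma ipDr f g h : bohr f -> bohr g -> bohr h -> ip h (f + g) = ip h f + ip h g.
Proof. by move=> *; rewrite !(ipC h); exact: ipDl. Qed.

Lemma ipZr c f g : bohr f -> bohr g -> ip g (c *: f) = c * ip g f.
Proof. by move=> *; rewrite !(ipC g); exact: ipZl. Qed.

Lemma ipBr f g h : bohr f -> bohr g -> bohr h -> ip h (f - g) = ip h f - ip h g.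
Proof. by move=> *; rewrite !(ipC h); exact: ipBl. Qed.

Lemma cauchy_schwarz f g : bohr f -> bohr g -> ip f g ^+ 2 <= ip f f * ip g g.
Proof.
move=> bf bg; have [g0|g0] := eqVneq (ip g g) 0.
  rewrite (ip_eq0 bg g0) (_ : ip f 0 = 0) ?expr0n ?mulr_ge0 ?ip_ge0//.
    exact: bohr_cst.
  by rewrite /ip mulr0; exact: mean_cst.
have gp : 0 < ip g g by rewrite lt_neqAle eq_sym g0 ip_ge0.
pose t := ip f g / ip g g.
have bt := bohrZ t bg.
have := ip_ge0 (bohrB bf bt).
rewrite ipBl//; last exact: bohrB.
rewrite !ipBr// !ipZl// !ipZr// (ipC g f).
have tE : t * ip g g = ip f g by rewrite divfK.
nra.
Qed.

(** Cauchy-Schwarz at each point, with a right-hand side independent of [x]: convolving turns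
    mean-square Cauchy sequences into uniformly Cauchy ones. All limits below rest on this. *)
Lemma conv_bound f g x : bohr f -> bohr g -> conv f g x ^+ 2 <= ip f f * ip g g.
Proof.
move=> bf bg; apply: le_trans (cauchy_schwarz (bohr_flip x bf) bg) _.
rewrite (_ : ip (fun s => f (x - s)) _ = ip f f)//.
by rewrite -[RHS](mean_flip x (bohr_mul_ap bf bf)).
Qed.

Lemma ip_conv_le f g : bohr f -> bohr g ->
  ip (conv f g) (conv f g) <= ip f f * ip g g.
Proof.
move=> bf bg; apply: mean_le_cst; first by apply: bohr_mul_ap; exact: bohr_conv.
by move=> x; exact: conv_bound.
Qed.

Lemma ip_refl f g : bohr f -> bohr g -> ip (refl f) (refl g) = ip f g.
Proof. by move=> bf bg; rewrite /ip -[RHS](mean_opp (bohr_mul_ap bf bg)). Qed.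

Lemma ip_convl f g (e : X -> R) : bohr f -> bohr g -> bohr e -> refl e = e ->
  ip (conv f e) g = ip f (conv g e).
Proof.
move=> bf bg be ee; rewrite !ip_conv refl_conv// ee -convA//; last exact: bohr_refl.
by rewrite (convC bg be).
Qed.

Lemma mean_norm_le f : bohr f -> mean (fun x => `|f x|) ^+ 2 <= ip f f.
Proof.
move=> bf; have bn := bohr_norm bf; have := cauchy_schwarz bn (@bohr_cst _ X (1 : R)).
rewrite /ip (_ : _ * _ = fun x => `|f x|); last by apply/funext => x; rewrite !f_at mulr1.
rewrite (_ : (fun=> 1) * _ = fun=> (1 : R)); last by apply/funext => x; rewrite !f_at mulr1.
rewrite mean_cst mulr1 (_ : (fun x => `|f x|) * _ = f * f)//.
by apply/funext => x; rewrite !f_at -normrM ger0_norm// sqr_ge0.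
Qed.

End convolution.

Lemma norm_le_sqr (R : realType) (x y : R) : 0 <= y -> x ^+ 2 <= y ^+ 2 -> `|x| <= y.
Proof. by move=> y0; rewrite -[x ^+ 2]real_normK ?num_real// ler_sqr ?nnegrE. Qed.

Lemma shift_continuous (X : topologicalZmodType) (a : X) :
  continuous (fun x => x + a).
Proof.
move=> x; apply: (@continuous_comp _ _ _ (fun y => (y, a)) (fun p => p.1 + p.2)).
  by apply: (@cvg_pair _ _ _ _ (nbhs x) (nbhs a)); [exact: cvg_id|exact: cvg_cst].
exact: add_continuous.
Qed.

(** * Continuous almost periodic functions and uniform limits *)

Section almost_periodic.
Context {R : realType} {X : topologicalZmodType}.
Implicit Types (f g h k : X -> R) (c : R) (u : nat -> X -> R).

Definition ap f := continuous f /\ bohr f.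

Lemma ap_unif f : (forall e, 0 < e -> exists2 g, ap g &
  forall x, `|f x - g x| <= e) -> ap f.
Proof.
move=> H; split; last by apply: bohr_unif => e /H[g [_ bg] fg]; exists g.
move=> x; apply/cvgrPdist_le => /= e e0.
have e30 : 0 < e / 3 by rewrite divr_gt0.
have [g [cg _] fg] := H _ e30.
have /cvgrPdist_le/(_ _ e30) := cg x; apply: filterS => y.
by move: (fg x) (fg y); rewrite !ler_norml; lra.
Qed.

Lemma ap_cst c : ap (fun=> c).
Proof. by split; [exact: cst_continuous|exact: bohr_cst]. Qed.

Lemma apD f g : ap f -> ap g -> ap (f + g).
Proof.
move=> [cf bf] [cg bg]; split; last exact: bohrD.
by move=> x; apply: cvgD; [exact: cf|exact: cg].
Qed.

Lemma apM f g : ap f -> ap g -> ap (f * g).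
Proof.
move=> [cf bf] [cg bg]; split; last exact: bohr_mul_ap.
by move=> x; apply: cvgM; [exact: cf|exact: cg].
Qed.

Lemma apZ c f : ap f -> ap (c *: f).
Proof. by move=> af; apply: (apM (ap_cst c) af). Qed.

Lemma apN f : ap f -> ap (- f).
Proof. by move=> /(apZ (-1)); rewrite scaleN1r. Qed.

Lemma ap_norm f : ap f -> ap (fun x => `|f x|).
Proof.
move=> [cf bf]; split; last exact: bohr_norm.
by move=> x; apply: cvg_norm; exact: cf.
Qed.

Lemma ap_shift f a : ap f -> ap (fun x => f (x + a)).
Proof.
move=> [cf bf]; split; last exact: bohr_shift.
move=> x; apply: (@continuous_comp _ _ _ (fun x => x + a) f); last exact: cf.
exact: shift_continuous.
Qed.

Lemma ap_refl f : ap f -> ap (refl f).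
Proof.
move=> [cf bf]; split; last exact: bohr_opp.
move=> x; apply: (@continuous_comp _ _ _ -%R f); last exact: cf.
exact: opp_continuous.
Qed.

(** Continuity at the finitely many points [x + t], with [t] a representative, is enough: by
    commutativity an arbitrary [z] can be exchanged for its representative. *)
Lemma ap_uniform f e x : ap f -> 0 < e ->
  \forall y \near x, forall z, `|f (y + z) - f (x + z)| <= e.
Proof.
move=> [cf bf] e0; have e30 : 0 < e / 3 by rewrite divr_gt0.
have [s [s0 sP]] := bohr_reps bf e30.
have H : \forall y \near x, forall t, t \in s -> `|f (y + t) - f (x + t)| <= e / 3.
  elim: s {s0 sP} => [|a s IH]; first by apply: nearW.
  have [ca _] := ap_shift a (conj cf bf).
  have /cvgrPdist_le/(_ _ e30) := ca x; apply: filterS2 IH => y IH ya t.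
  by rewrite inE => /predU1P[->|/IH//]; rewrite distrC.
apply: filterS H => y H z; have [t ts tz] := sP z.
move: (H t ts) (tz y) (tz x).
by rewrite ![z + _]addrC ![t + _]addrC !ler_norml; lra.
Qed.

Lemma ap_conv f g : ap f -> bohr g -> ap (conv f g).
Proof.
move=> af bg; have [cf bf] := af; split; last exact: bohr_conv.
move=> x; apply/cvgrPdist_le => /= e e0.
have [M gM] := bohr_bounded bg.
have M0 : 0 <= M by rewrite (le_trans _ (gM 0)).
have M1 : 0 < M + 1 by lra.
have d0 : 0 < e / (M + 1) by rewrite divr_gt0.
have := ap_uniform x af d0; apply: filterS => y xy.
rewrite /conv -meanB; [|exact: bohr_slice..]; apply: normr_mean.
  by apply: bohrB; exact: bohr_slice.
move=> s; rewrite !f_at -mulrBl normrM distrC.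
have dE : e / (M + 1) * (M + 1) = e by rewrite divfK ?gt_eqF.
have := ler_pM (normr_ge0 _) (normr_ge0 _) (xy (- s)) (gM s).
by have : 0 <= e / (M + 1); [exact: ltW|nra].
Qed.

Definition ulim u g := forall e, 0 < e -> exists N, forall n, (N <= n)%N ->
  forall x, `|u n x - g x| <= e.

Lemma ulim_unique u f g : ulim u f -> ulim u g -> f = g.
Proof.
move=> uf ug; apply/funext => x; apply/eqP; rewrite -subr_eq0 -normr_le0.
apply/ler_addgt0Pr => e e0; have e20 : 0 < e / 2 by rewrite divr_gt0.
have [N Nf] := uf _ e20; have [M Mg] := ug _ e20.
move: (Nf _ (leq_maxl N M) x) (Mg _ (leq_maxr N M) x).
by rewrite add0r !ler_norml; lra.
Qed.

Lemma ulim_shift u f a : ulim u f -> ulim (fun n => u (n + a)%N) f.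
Proof.
move=> uf e /uf[N Nf]; exists N => n Nn; apply: Nf.
by rewrite (leq_trans Nn)// leq_addr.
Qed.

Lemma ulim_conv u f g : (forall n, bohr (u n)) -> bohr f -> bohr g ->
  ulim u f -> ulim (fun n => conv (u n) g) (conv f g).
Proof.
move=> bu bf bg uf e e0; have [M gM] := bohr_bounded bg.
have M0 : 0 <= M by rewrite (le_trans _ (gM 0)).
have M1 : 0 < M + 1 by lra.
have d0 : 0 < e / (M + 1) by rewrite divr_gt0.
have [N Nf] := uf _ d0; exists N => n /Nf un x.
rewrite /conv -meanB; [|exact: bohr_slice..]; apply: normr_mean.
  by apply: bohrB; exact: bohr_slice.
move=> s; rewrite !f_at -mulrBl normrM.
have dE : e / (M + 1) * (M + 1) = e by rewrite divfK ?gt_eqF.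
have := ler_pM (normr_ge0 _) (normr_ge0 _) (un (x - s)) (gM s).
by have : 0 <= e / (M + 1); [exact: ltW|nra].
Qed.

Lemma ap_complete u : (forall n, ap (u n)) ->
  (forall e, 0 < e -> exists N, forall n m, (N <= n)%N -> (N <= m)%N ->
    forall x, `|u n x - u m x| <= e) ->
  exists2 g, ap g & ulim u g.
Proof.
move=> au cu; pose g x : R := limn (u ^~ x).
have ug x : u n x @[n --> \oo] --> g x.
  apply: (@cauchy_cvg R^o); apply: cauchy_exP => e e0.
  have e20 : 0 < e / 2 by rewrite divr_gt0.
  have [N Nu] := cu _ e20; exists (u N x); exists N => // n /= Nn.
  by rewrite /ball/= (le_lt_trans (Nu _ _ (leqnn N) Nn x))//; lra.
have ulg : ulim u g.
  move=> e e0; have [N Nu] := cu _ e0; exists N => n Nn x.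
  have : `|u n x - u m x| @[m --> \oo] --> `|u n x - g x|.
    by apply: cvg_norm; apply: cvgB; [exact: cvg_cst|exact: ug].
  move/cvgr_to_le; apply; exists N => // m /= Nm; exact: Nu.
exists g => //; apply: ap_unif => e /ulg[N /(_ N (leqnn N)) uN].
by exists (u N) => // x; rewrite distrC.
Qed.

End almost_periodic.

Ltac solve_bohr := repeat first [assumption
  | match goal with H : ap ?f |- bohr ?f => exact (proj2 H) end
  | apply: bohr_conv | apply: bohrD | apply: bohrN | apply: bohrZ
  | apply: bohr_refl].

Ltac solve_ap := repeat first [assumption
  | (apply: ap_conv; [|solve_bohr])
  | apply: apD | apply: apN | apply: apZ | apply: ap_refl].

(** * Idempotents for convolution and the power method *)

Section idempotents.
Context {R : realType} {X : topologicalZmodType}.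
Implicit Types (f g h k : X -> R).

(** Convolution by such an [e] is an orthogonal projection for [ip]; evenness makes it
    self-adjoint. *)
Definition idem (e : X -> R) := [/\ ap e, refl e = e & conv e e = e].

(* The power method: even powers of the convolution operator by [k], normalised
   by its squared norm [rho], converge to the projection on its top eigenspace. *)
Lemma top_idempotent k : ap k -> refl k = k -> k <> 0 ->
  exists e rho, [/\ idem e, e <> 0, 0 < rho & conv (conv k k) e = rho *: e].
Proof.
move=> ak kk k0; have [_ bk] := ak.
(* [p n] is the convolution of [n.+1] copies of [k], whence the successors in [pD] and in all later
   indices. *)
pose p n := iter n (conv k) k.
have pS n : p n.+1 = conv k (p n) by [].
have ap_p n : ap (p n) by elim: n => [|n [_ IH]] //=; exact: ap_conv.
have bp n : bohr (p n) by have [] := ap_p n.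
have pD n m : conv (p n) (p m) = p (n + m).+1.
  by elim: n => [//|n IH]; rewrite pS -convA// IH addSn.
have rp n : refl (p n) = p n.
  by elim: n => [//|n IH]; rewrite pS refl_conv// kk IH.
have ipp n m : ip (p n) (p m) = p (n + m).+1 0 by rewrite ip_conv rp pD.
pose c n := ip (p n) (p n).
have ipc n m j : (n + m = j + j)%N -> ip (p n) (p m) = c j.
  by move=> nm; rewrite /c !ipp nm.
have c_ge0 n : 0 <= c n by exact: ip_ge0.
(* Cauchy-Schwarz for [p n] and [p n.+2]: the sequence [c] is log-convex, so its ratios [r]
   increase. *)
have lc n : c n.+1 ^+ 2 <= c n * c n.+2.
  rewrite -(@ipc n n.+2); last by lia.
  exact: cauchy_schwarz.
have c0 : 0 < c 0%N.
  by rewrite lt_neqAle c_ge0 andbT eq_sym; apply/eqP => /(ip_eq0 bk).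
have c1 : 0 < c 1%N.
  rewrite lt_neqAle c_ge0 andbT eq_sym; apply/eqP => /(ip_eq0 (bp 1%N)) p1.
  by move: c0; rewrite /c ipp addn0 p1 ltxx.
have cp n : 0 < c n.
  suff: 0 < c n /\ 0 < c n.+1 by case.
  elim: n => [//|n [H1 H2]]; split => //.
  rewrite lt_neqAle c_ge0 andbT; apply/eqP => H3.
  by have := lc n; rewrite -H3 mulr0 leNgt exprn_gt0.
have sm n m : c (n + m).+1 <= c n * c m by rewrite /c -pD; exact: ip_conv_le.
pose r n := c n.+1 / c n.
have r0 n : 0 < r n by rewrite divr_gt0.
have cS n : c n.+1 = r n * c n by rewrite divfK// gt_eqF.
have rS n : r n <= r n.+1.
  by rewrite ler_pdivrMr// mulrAC ler_pdivlMr// mulrC -expr2 [_ * c n]mulrC.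
have ndr : {homo r : n m / (n <= m)%N >-> n <= m} by exact/nondecreasing_seqP.
have cr n m : c n * r n ^+ m <= c (n + m)%N.
  elim: m => [|m IH]; first by rewrite expr0 mulr1 addn0.
  rewrite addnS cS exprS mulrCA; apply: ler_pM => //; first exact: ltW.
    by rewrite mulr_ge0// exprn_ge0// ltW.
  exact/ndr/leq_addr.
(* Compare [cr], at exponent [m.+1], with the submultiplicativity [sm]. For [m = 0] this bounds the
   ratios, and in the limit it gives [rho ^+ m.+1 <= c m], which keeps [d] above 1. *)
have rc n m : r n ^+ m.+1 <= c m.
  rewrite -(ler_pM2l (cp n)); apply: le_trans (sm n m).
  by rewrite -addnS.
have bdr : has_ubound (range r).
  by exists (c 0%N) => _ [n _ <-]; have := rc n 0%N.
have := nondecreasing_cvgn ndr bdr; set rho := sup _ => rrho.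
have r_rho n : r n <= rho by apply: ub_le_sup => //; exists n.
have rho0 : 0 < rho by rewrite (lt_le_trans (r0 0%N)).
have rhoc m : rho ^+ m.+1 <= c m.
  have : r n ^+ m.+1 @[n --> \oo] --> rho ^+ m.+1.
    exact: (cvg_comp _ _ rrho (@exprn_continuous R m.+1 rho)).
  by move/cvgr_to_le; apply; apply: nearW => n; exact: rc.
have rhox n : 0 < rho ^+ n by rewrite exprn_gt0.
pose d n := c n / rho ^+ n.+1.
have d1 n : 1 <= d n by rewrite ler_pdivlMr// mul1r.
have dS n : d n.+1 <= d n.
  rewrite /d cS exprS invfM mulrACA; apply: ler_piMl.
    by rewrite mulr_ge0// invr_ge0 ltW.
  by rewrite ler_pdivrMr// mul1r.
have nid : {homo d : n m / (n <= m)%N >-> m <= n} by exact/nonincreasing_seqP.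
have lbd : has_lbound (range d) by exists 1 => _ [n _ <-].
have dcvg := nonincreasing_cvgn nid lbd; set b := inf _ in dcvg.
(* [w n] is the convolution power of order [n.+1] of [conv k k] divided by [rho]. Squaring [k] first
   merges the possible eigenvalues of opposite sign. *)
pose w n := (rho ^+ n.+1)^-1 *: p (n + n).+1.
have ap_w n : ap (w n) by exact: apZ.
have bw n : bohr (w n) by have [] := ap_w n.
have wD n m : conv (w n) (w m) = w (n + m).+1.
  rewrite convZl// convZr// pD scalerA -invfM -exprD; congr (_^-1 *: p _); last by lia.
  by congr (_ ^+ _); lia.
have ipw n m : ip (w n) (w m) = d (n + m).+1.
  rewrite ipZl// ipZr// (@ipc _ _ (n + m).+1); last by lia.
  by rewrite mulrA -invfM -exprD mulrC /d; congr (_ / _ ^+ _); lia.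
(* The squared distance expands to [d (n + n).+1 - 2 * d (n + m).+1 + d (m + m).+1], and [d]
   converges. *)
have cauchy_w e : 0 < e -> exists N, forall n m, (N <= n)%N -> (N <= m)%N ->
    ip (w n - w m) (w n - w m) <= e.
  move=> e0; have e40 : 0 < e / 4 by rewrite divr_gt0.
  have /cvgrPdist_le/(_ _ e40)[N _ Nd] := dcvg; exists N => n m Nn Nm.
  rewrite ipBl//; last by solve_bohr.
  rewrite !ipBr// !ipw.
  have := Nd (n + n).+1; have := Nd (n + m).+1; have := Nd (m + m).+1.
  rewrite /= !(leqW (leq_trans _ (leq_addr _ _)))//.
  move=> /(_ isT) + /(_ isT) + /(_ isT); rewrite !ler_norml [(m + n)%N]addnC.
  lra.
have [e ae we] : exists2 e, ap e & ulim (fun n => w n.+1) e.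
  apply: ap_complete => // e e0.
  have A0 : 0 < ip (w 0%N) (w 0%N) by rewrite ipw (lt_le_trans _ (d1 _)).
  have [|N Nw] := cauchy_w (e ^+ 2 / ip (w 0%N) (w 0%N)).
    by rewrite divr_gt0// exprn_gt0.
  exists N => n m Nn Nm x.
  (* Splitting off the factor [w 0] lets [conv_bound] turn the mean-square estimate into a uniform
     one. *)
  have -> : w n.+1 x - w m.+1 x = conv (w 0%N) (w n - w m) x.
    by rewrite convBr// !wD.
  apply: norm_le_sqr; first exact: ltW.
  apply: (le_trans (conv_bound x (bw 0%N) (bohrB (bw n) (bw m)))).
  by rewrite mulrC -ler_pdivlMr//; exact: Nw.
have be : bohr e by have [] := ae.
have ew m : conv e (w m) = e.
  have H1 : ulim (fun n => conv (w n.+1) (w m)) (conv e (w m)) by exact: ulim_conv.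
  apply: (ulim_unique H1); have := ulim_shift m.+1 we.
  by congr ulim; apply/funext => n; rewrite wD addSn addnS.
exists e, rho; split => //.
- split => //.
    apply: (@ulim_unique _ _ (fun n => w n.+1)) => //.
    move=> d' d'0; have [N Nw] := we _ d'0; exists N => n Nn x.
    rewrite (_ : w n.+1 x = w n.+1 (- x)); first exact: Nw.
    by rewrite /w !f_at -[in RHS](rp (n.+1 + n.+1).+1) /refl opprK.
  apply: (@ulim_unique _ _ (fun n => e)).
    have := @ulim_conv _ _ (fun n => w n.+1) e e; move=> /(_ (fun n => bw n.+1) be be we).
    by congr ulim; apply/funext => n; rewrite convC.
  by move=> d' d'0; exists 0%N => n _ x; rewrite subrr normr0 ltW.
(* The limit cannot vanish at 0 because [w n 0 = d n >= 1] for every [n]. *)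
- move=> e0; have [N /(_ N (leqnn N) 0)] := we (1 / 2) ltac:(lra).
  rewrite e0 subr0 (_ : w N.+1 0 = d N.+1); last first.
    by rewrite /w f_at -(ipp N.+1 N.+1) mulrC.
  by move=> dN; have := d1 N.+1; have := le_trans (ler_norm _) dN; lra.
- have := ew 0%N; rewrite /w addn0 expr1 convZr// => {2}<-.
  by rewrite scalerA mulfV ?gt_eqF// scale1r convC//; solve_bohr.
Qed.

End idempotents.

(** * Approximation by trigonometric polynomials *)

Section spectral.
Context {R : realType} {X : topologicalZmodType}.
Implicit Types (f g h k e C S : X -> R) (x y : X).

Lemma idem_bohr (e : X -> R) : idem e -> bohr e. Proof. by case=> -[]. Qed.

Lemma conv0f f : bohr f -> conv 0 f = 0.
Proof.
move=> bf; apply/funext => x; rewrite /conv (_ : (fun s => _) = fun=> 0) ?mean_cst//.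
by apply/funext => s; rewrite mul0r.
Qed.

Lemma conv_unif_le f g x c : bohr f -> bohr g -> ip f f <= c ->
  conv f g x ^+ 2 <= c * ip g g.
Proof.
move=> bf bg fc; apply: (le_trans (conv_bound x bf bg)).
by rewrite ler_wpM2r// ip_ge0.
Qed.

(** The projection [P + Q - P Q] on the sum of the ranges of two commuting projections. *)
Lemma idem_join (e e' : X -> R) : idem e -> idem e' -> idem (e + e' - conv e e').
Proof.
move=> ie ie'; have [be be'] := (idem_bohr ie, idem_bohr ie').
have [[ae re ee] [ae' re' ee']] := (ie, ie').
have bd : bohr (conv e e') by solve_bohr.
have ed : conv e (conv e e') = conv e e' by rewrite convA// ee.
have de' : conv (conv e e') e' = conv e e' by rewrite -convA// ee'.
have de : conv (conv e e') e = conv e e' by rewrite convC// ed.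
have e'd : conv e' (conv e e') = conv e e' by rewrite convC// de'.
have dd : conv (conv e e') (conv e e') = conv e e' by rewrite -{1}convA// e'd ed.
have bj : bohr (e + e') by solve_bohr.
split.
- by solve_ap.
- have rD (f g : X -> R) : refl (f - g) = refl f - refl g by [].
  have rA (f g : X -> R) : refl (f + g) = refl f + refl g by [].
  by rewrite rD rA refl_conv// re re'.
- have bj' : bohr (e + e' - conv e e') by solve_bohr.
  rewrite convBl// convDl// !convBr// !convDr// ee ee' ed de e'd de' dd (convC be' be).
  by apply/funext => x; rewrite !f_at; ring.
Qed.

Lemma ip_subid f e : bohr f -> idem e ->
  ip f (f - conv f e) = ip (f - conv f e) (f - conv f e) /\
  ip (f - conv f e) (f - conv f e) = ip f f - ip (conv f e) (conv f e).
Proof.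
move=> bf ie; have be := idem_bohr ie; case: ie => ae re ee.
have bfe : bohr (conv f e) by solve_bohr.
have bg : bohr (f - conv f e) by solve_bohr.
have H : ip (conv f e) f = ip (conv f e) (conv f e).
  by rewrite -{1}ee convA// ip_convl.
have Hg : ip (conv f e) (f - conv f e) = 0 by rewrite ipBr// H subrr.
split; last by rewrite ipBl// Hg subr0 ipBr// (ipC f) H.
by rewrite [RHS]ipBl// Hg subr0.
Qed.

(** Pythagoras: what joining [e'] adds to the captured square norm is exactly the part of the
    residual [f - conv f e] that [e'] captures. *)
Lemma ip_join f (e e' : X -> R) : bohr f -> idem e -> idem e' ->
  ip (conv f (e + e' - conv e e')) (conv f (e + e' - conv e e')) =
  ip (conv f e) (conv f e) + ip (conv (f - conv f e) e') (conv (f - conv f e) e').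
Proof.
move=> bf ie ie'; have [be be'] := (idem_bohr ie, idem_bohr ie').
have [[ae re ee] [ae' re' ee']] := (ie, ie').
have bfe : bohr (conv f e) by solve_bohr.
have bg : bohr (f - conv f e) by solve_bohr.
have bge : bohr (conv (f - conv f e) e') by solve_bohr.
have bd : bohr (conv e e') by solve_bohr.
have bj : bohr (e + e') by solve_bohr.
have -> : conv f (e + e' - conv e e') = conv f e + conv (f - conv f e) e'.
  by rewrite convBr// convDr// convBl// convA// addrA.
have cross : ip (conv f e) (conv (f - conv f e) e') = 0.
  rewrite -ip_convl// -convA// (convC be be') convA//.
  rewrite ip_convl//; last by solve_bohr.
  rewrite convBl// -convA// ee subrr /ip mulr0; exact: mean_cst.
rewrite ipDl//; last by solve_bohr.
by rewrite !ipDr// cross (ipC _ (conv f e)) cross addr0 add0r.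
Qed.

Lemma ip_sub_le f g : bohr f -> bohr g ->
  ip (f - g) (f - g) <= 2 * ip f f + 2 * ip g g.
Proof.
move=> bf bg; have bD : bohr (f + g) by solve_bohr.
have bB : bohr (f - g) by solve_bohr.
have H : 0 <= ip f f + 2 * ip f g + ip g g.
  have -> : ip f f + 2 * ip f g + ip g g = ip (f + g) (f + g); last exact: ip_ge0.
  by rewrite ipDl// !ipDr// (ipC g f); ring.
by rewrite ipBl// !ipBr// (ipC g f); lra.
Qed.

(** Choose idempotents [e n] capturing almost the supremum of the square norm of [f]. The residuals
    [g n] need not converge to an almost periodic function, but their convolutions [q n] with
    [refl f] converge uniformly to an even [Q]. A nonzero [Q] would have a nonzero idempotent in its
    range, which would capture more of [f]; so [Q = 0], and [q n 0] is the square norm of [g n]. *)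
Lemma idem_approx f eps : ap f -> 0 < eps ->
  exists2 e, idem e & ip (f - conv f e) (f - conv f e) <= eps.
Proof.
move=> af eps0; have [_ bf] := af.
pose A := [set ip (conv f e) (conv f e) | e in idem (X := X)].
have hA : has_sup A.
  split.
    exists (ip (conv f 0) (conv f 0)); exists 0 => //; split.
    - exact: ap_cst.
    - by apply/funext => x.
    - by rewrite conv0f//; exact: bohr_cst.
  exists (ip f f) => _ [e ie <-]; have be := idem_bohr ie.
  rewrite -subr_ge0; have [_ <-] := ip_subid bf ie.
  by apply: ip_ge0; solve_bohr.
have Sub e : idem e -> ip (conv f e) (conv f e) <= sup A.
  by move=> ie; apply: ub_le_sup; [case: hA|exists e].
have ex n : exists e, idem e /\ sup A - n.+1%:R^-1 < ip (conv f e) (conv f e).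
  have n0 : 0 < n.+1%:R^-1 :> R by rewrite invr_gt0.
  by have [_ [e ie <-] H] := sup_adherent n0 hA; exists e.
have [e /all_and2[ie eS]] := choice ex.
have be n : bohr (e n) := idem_bohr (ie n).
have ae n : ap (e n) by case: (ie n).
pose g n := f - conv f (e n).
have ag n : ap (g n) by rewrite /g; solve_ap.
have bg n : bohr (g n) by case: (ag n).
(* By [ip_join], a larger gain would push the captured norm above the supremum [sup A]. *)
have gle n e' : idem e' -> ip (conv (g n) e') (conv (g n) e') <= n.+1%:R^-1.
  move=> ie'; have := Sub _ (idem_join (ie n) ie').
  rewrite ip_join// -/(g n) -lerBrDl => /le_trans; apply.
  by rewrite lerBlDl -lerBlDr ltW.
pose q n := conv (g n) (refl f).
have brf : bohr (refl f) by solve_bohr.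
have aq n : ap (q n) by rewrite /q; solve_ap.
have ipf : ip (refl f) (refl f) = ip f f by exact: ip_refl.
have F0 : 0 < ip f f + 1 by rewrite ltr_wpDl// ip_ge0.
have inv_small d : 0 < d -> exists N, forall n, (N <= n)%N -> n.+1%:R^-1 <= d :> R.
  move=> d0; have [N _ Nd] := near_infty_natSinv_lt (PosNum d0).
  by exists N => n /Nd /ltW.
(* The factor 4 comes from [ip_sub_le] applied to two pieces, each bounded by the same
   reciprocal. *)
have sq_small d : 0 < d -> exists N, forall n, (N <= n)%N ->
    4 * n.+1%:R^-1 * ip f f <= d ^+ 2.
  move=> d0; have d20 : 0 < d ^+ 2 / (4 * (ip f f + 1)).
    by rewrite divr_gt0 ?exprn_gt0// mulr_gt0.
  have [N Nd] := inv_small _ d20; exists N => n /Nd.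
  rewrite ler_pdivlMr ?mulr_gt0// => H; apply: le_trans H.
  rewrite mulrA [_ * 4]mulrC ler_wpM2l ?mulr_ge0 ?invr_ge0//; lra.
have [Q aQ qQ] : exists2 Q, ap Q & ulim q Q.
  apply: ap_complete => // d d0; have [N Nd] := sq_small _ d0.
  exists N => n m Nn Nm x.
  have bnm : bohr (conv (g n) (e m)) by solve_bohr.
  have bmn : bohr (conv (g m) (e n)) by solve_bohr.
  have [bn bm] := (be n, be m); have [bfn bfm] : bohr (conv f (e n)) /\ bohr (conv f (e m)).
    by split; solve_bohr.
  (* In [g n - g m] a product [conv f (conv (e n) (e m))] can be subtracted from both terms by
     commutativity; what remains are parts of the residuals captured by one further idempotent,
     which [gle] bounds. *)
  have -> : q n x - q m x = conv (conv (g n) (e m) - conv (g m) (e n)) (refl f) x.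
    rewrite -[LHS]/((q n - q m) x) /q -convBl//; congr (conv _ _ x).
    rewrite {3 4}/g !convBl//; try solve_bohr.
    rewrite -!convA// (convC (be m) (be n)) /g.
    by apply/funext => y; rewrite !f_at; ring.
  apply: norm_le_sqr; first exact: ltW.
  have nm : exists2 p, (N <= p)%N & n.+1%:R^-1 <= p.+1%:R^-1 :> R /\ m.+1%:R^-1 <= p.+1%:R^-1 :> R.
    exists (minn n m); first by rewrite leq_min Nn.
    by rewrite !lef_pV2 ?posrE// !ler_nat !ltnS geq_minl geq_minr.
  have [p Np [np mp]] := nm.
  apply: le_trans (Nd p Np); rewrite -ipf; apply: conv_unif_le => //.
    by solve_bohr.
  apply: (le_trans (ip_sub_le bnm bmn)).
  move: (gle n _ (ie m)) (gle m _ (ie n)) np mp.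
  by move: (p.+1%:R^-1) (n.+1%:R^-1) (m.+1%:R^-1) => a b c; lra.
have rq n : refl (q n) = q n.
  have ben := be n; have bfe : bohr (conv f (e n)) by solve_bohr.
  rewrite /q refl_conv// reflK /g (_ : refl (f - conv f (e n)) = refl f - conv (refl f) (e n)).
    rewrite !convBl//; try solve_bohr.
    congr (_ - _); first by rewrite convC.
    by rewrite -convA// (convC (be n) bf) convC.
  by case: (ie n) => _ re _; rewrite -[in RHS]re -refl_conv.
have bQ : bohr Q by case: aQ.
have bq n : bohr (q n) by case: (aq n).
have rQ : refl Q = Q.
  apply: (ulim_unique _ qQ) => d /qQ[N Nd]; exists N => n Nn x.
  by rewrite -rq; exact: Nd.
have Q0 : Q = 0.
  (* The idempotent [e'] of [Q] captures a vanishing part of [g n], so [conv Q e' = 0]; but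
     [conv (conv Q Q) e' = rho *: e'] with [rho > 0]. *)
  apply: contrapT => Qn0; have [e' [rho [ie' e'0 rho0 He']]] := top_idempotent aQ rQ Qn0.
  have be' := idem_bohr ie'.
  have QE : conv Q e' = 0.
    apply: (ulim_unique (ulim_conv bq bQ be' qQ)) => d d0.
    have [N Nd] := sq_small _ d0; exists N => n Nn x.
    rewrite subr0 /q -convA// (convC brf be') convA//.
    apply: norm_le_sqr; first exact: ltW.
    apply: le_trans (Nd n Nn); rewrite -ipf; apply: conv_unif_le => //.
      by solve_bohr.
    apply: (le_trans (gle n _ ie')).
    by rewrite ler_peMl ?invr_ge0// ler1n.
  apply: e'0; have : rho *: e' = 0 by rewrite -He' -convA// QE convC ?conv0f//; exact: bohr_cst.
  by move/eqP; rewrite scaler_eq0 gt_eqF//= => /eqP.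
have [N /(_ N (leqnn N) 0)] := qQ _ eps0.
rewrite Q0 subr0 => HN; exists (e N) => //.
have [<- _] := ip_subid bf (ie N).
rewrite ip_conv convC//; last exact: bg.
exact: le_trans (ler_norm _) HN.
Qed.

(** Bounded normalised solutions of d'Alembert's functional equation, which real parts of characters
    satisfy. *)
Definition cosine C := [/\ ap C, C 0 = 1, forall x, `|C x| <= 1
  & forall x y, C (x + y) + C (x - y) = 2 * C x * C y].

Lemma ip_idem e : idem e -> ip e e = e 0.
Proof. by move=> [_ re ee]; rewrite ip_conv re ee. Qed.

Lemma idem_le e x : idem e -> `|e x| <= e 0.
Proof.
move=> ie; have be := idem_bohr ie; rewrite -(ip_idem ie).
apply: norm_le_sqr; first exact: ip_ge0.
by case: ie => _ _ {1}<-; exact: conv_bound.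
Qed.

(** Here [e 0] is the trace of the projection. Since [|e| <= e 0], one has
    [e 0 = ip e e <= e 0 ^+ 2]. *)
Lemma idem_ge1 e : idem e -> e <> 0 -> 1 <= e 0.
Proof.
move=> ie e0; have be := idem_bohr ie; have := ip_idem ie => ipe.
have e00 : 0 < e 0.
  by rewrite -ipe lt_neqAle ip_ge0// andbT eq_sym; apply/eqP => /(ip_eq0 be).
have : ip e e <= e 0 ^+ 2.
  apply: mean_le_cst; first exact: bohr_mul_ap.
  move=> x; rewrite f_at -expr2 -real_normK ?num_real//.
  by rewrite ler_sqr ?nnegrE; [exact: idem_le|exact: normr_ge0|exact: ltW].
by rewrite ipe expr2 ler_pMr.
Qed.

(* By minimality, every even function [h] with [conv h e = h] is a multiple of
   [e]; this applies to [x |-> e (x + y) + e (x - y)]. *)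
Lemma minimal_idem_cosine e : idem e -> e <> 0 ->
  (forall e', idem e' -> e' <> 0 -> conv e e' = e' -> e' = e) ->
  exists2 C, cosine C & e = e 0 *: C.
Proof.
move=> ie e0 emin; have e01 := idem_ge1 ie e0; have be := idem_bohr ie.
have [ae re ee] := ie.
have mult h : ap h -> refl h = h -> conv h e = h -> exists l, h = l *: e.
  move=> ah rh he; have [h0|h0] := pselect (h = 0); first by exists 0; rewrite scale0r.
  have bh : bohr h by case: ah.
  have [e' [rho [ie' e'0 rho0 He']]] := top_idempotent ah rh h0.
  have be' := idem_bohr ie'.
  have sub u : bohr u -> conv u e = u -> conv e u = u by move=> bu; rewrite convC.
  have e'e : e' = e.
    apply: emin => //.
    have -> : e' = rho^-1 *: conv (conv h h) e' by rewrite He' scalerA mulVf ?gt_eqF// scale1r.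
    rewrite convZr//; last by solve_bohr.
    by rewrite convA//; [|solve_bohr]; rewrite convA// sub.
  have hh : conv h h = rho *: e by rewrite -e'e -He' e'e -convA// he.
  pose s := Num.sqrt rho.
  have s0 : 0 < s by rewrite sqrtr_gt0.
  have ss : s * s = rho by rewrite -expr2 sqr_sqrtr ?ltW.
  (* As [conv h h = s ^+ 2 *: e], the operator of [h] has only the eigenvalues [s] and [- s] on the
     range of [e], and [k] divided by [2 * s] projects on the first eigenspace. Minimality makes
     this projection 0 or [e], so [h] is [- s *: e] or [s *: e]. *)
  pose k := h + s *: e.
  have bk : bohr k by rewrite /k; solve_bohr.
  have ak : ap k by rewrite /k; solve_ap.
  have bse : bohr (s *: e) by solve_bohr.
  have kk : conv k k = (2 * s) *: k.
    rewrite /k convDl// !convDr// !convZl// !convZr//.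
    rewrite hh he (convC be bh) he ee -ss.
    by apply/funext => x; rewrite !f_at; ring.
  have [k0|k0] := pselect (k = 0).
    by exists (- s); apply/eqP; rewrite scaleNr -addr_eq0; apply/eqP.
  have s2 : 2 * s != 0 by rewrite gt_eqF// mulr_gt0.
  have ik : idem ((2 * s)^-1 *: k).
    split; first exact: apZ.
      rewrite -[in RHS](_ : refl k = k)//; apply/funext => z.
      by rewrite /refl /k !f_at -[e (- z)]/(refl e z) -[h (- z)]/(refl h z) re rh.
    have bk2 := bohrZ (2 * s)^-1 bk.
    by rewrite convZl// convZr// kk [_ *: ((2 * s) *: k)]scalerA mulVf// scale1r.
  have : (2 * s)^-1 *: k = e.
    apply: emin => //; first by move/eqP; rewrite scaler_eq0 invr_eq0 (negbTE s2) => /eqP.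
    rewrite convZr// /k convDr// convZr// ee sub//.
  move=> /(congr1 (fun u => (2 * s) *: u)); rewrite scalerA mulfV// scale1r => kE.
  exists s; rewrite -[LHS](addrK (s *: e)) -/k kE -scalerBl; congr (_ *: _); ring.
have e0n : e 0 != 0 by rewrite gt_eqF// (lt_le_trans _ e01).
have dal x y : e (x + y) + e (x - y) = 2 * (e y / e 0) * e x.
  pose h := (fun x => e (x + y)) + (fun x => e (x - y)).
  have a1 : ap (fun x => e (x + y)) by exact: ap_shift.
  have a2 : ap (fun x => e (x - y)) by exact: ap_shift.
  have [b1 b2] : bohr (fun x => e (x + y)) /\ bohr (fun x => e (x - y)) by case: a1; case: a2.
  have ree z : e (- z) = e z by rewrite -[in RHS]re.
  have [|||l hl] := mult h.
  - exact: apD.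
  - apply/funext => z; rewrite /refl /h !f_at -[e (- z + y)]ree -[e (- z - y)]ree.
    by rewrite !opprD !opprK addrC.
  - have cs c : conv (fun x => e (x + c)) e = fun x => e (x + c).
      apply/funext => z; rewrite -[in RHS]ee /conv; congr mean.
      by apply/funext => s; rewrite addrAC.
    by rewrite /h convDl// !cs.
  have hx z : e (z + y) + e (z - y) = l * e z by have := congr1 (fun u => u z) hl.
  have := hx 0; rewrite add0r sub0r ree => l0.
  rewrite hx; congr (_ * _); apply: (mulIf e0n).
  by rewrite -l0 mulrA divfK//; ring.
exists ((e 0)^-1 *: e); last by rewrite scalerA mulfV// scale1r.
have e0p : 0 < e 0 by rewrite (lt_le_trans _ e01).
split; first exact: apZ.
- by rewrite f_at mulVf.
- move=> x; rewrite f_at normrM gtr0_norm ?invr_gt0// mulrC ler_pdivrMr// mul1r.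
  exact: idem_le.
- by move=> x y; rewrite !f_at -mulrDr dal; field.
Qed.

Definition lincomb (s : seq (R * (X -> R))) : X -> R := \sum_(p <- s) p.1 *: p.2.

(** A nonminimal [e] splits as [e' + (e - e')]. Both summands are nonzero idempotents, so each has a
    value at 0 of at least 1, and the value at 0 drops by at least 1 in each. *)
Lemma idem_cosines e : idem e ->
  exists s, (forall p, p \in s -> cosine p.2) /\ e = lincomb s.
Proof.
move=> ie; have [n] : exists n : nat, e 0 <= n%:R.
  by exists (Num.bound `|e 0|); rewrite (le_trans (ler_norm _))// ltW// archi_boundP.
elim: n e ie => [|n IH] e ie en.
  exists [::]; split => //; rewrite /lincomb big_nil; apply: contrapT => e0.
  by have := idem_ge1 ie e0; move: en; lra.
have [e0|e0] := pselect (e = 0).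
  by exists [::]; split => //; rewrite /lincomb big_nil.
have be := idem_bohr ie.
have [H|] := pselect (forall e', idem e' -> e' <> 0 -> conv e e' = e' -> e' = e).
  have [C cC eC] := minimal_idem_cosine ie e0 H.
  exists [:: (e 0, C)]; split; first by move=> p; rewrite inE => /eqP ->.
  by rewrite /lincomb big_seq1.
move=> /existsNP[e' /not_implyP[ie' /not_implyP[e'0 /not_implyP[ee' ne]]]].
have be' := idem_bohr ie'.
have [[ae re iee] [ae' re' iee']] := (ie, ie').
have id : idem (e - e').
  split; first by solve_ap.
    by rewrite -[in RHS]re -[in RHS]re'.
  rewrite convBl//; last by solve_bohr.
  by rewrite !convBr// (convC be' be) ee' iee iee' subrr subr0.
have d0 : e - e' <> 0 by move/eqP; rewrite subr_eq0 => /eqP/esym.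
have := idem_ge1 ie' e'0; have := idem_ge1 id d0; rewrite !f_at => H1 H2.
rewrite -natr1 in en.
have [s [sc es]] := IH _ ie' ltac:(lra).
have [|t [tc et]] := IH _ id; first by rewrite !f_at; lra.
exists (s ++ t); split.
  by move=> p; rewrite mem_cat => /orP[/sc|/tc].
by rewrite /lincomb big_cat/= -!/(lincomb _) -es -et addrC subrK.
Qed.

(* [C + i S] is a character. *)
Definition character C S := [/\ ap C /\ ap S, forall x, C x ^+ 2 + S x ^+ 2 = 1,
  forall x y, C (x + y) = C x * C y - S x * S y
  & forall x y, S (x + y) = S x * C y + C x * S y].

(** At a point [a] where the sine does not vanish, the formula
    [cos (x + a) = cos x cos a - sin x sin a] can be solved for [sin x]; this defines [S]. The
    choice of the positive root [s] for the sine of [a] selects one of two conjugate characters. *)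
Lemma cosine_character C : cosine C -> exists S, character C S.
Proof.
move=> [aC C0 C1 dal].
have even x : C (- x) = C x by have := dal 0 x; rewrite add0r sub0r C0; lra.
(* [C (x + y)] and [C (x - y)] have sum [2 * C x * C y] and, by d'Alembert's equation at [x + y] and
   [x - y], product [C x ^+ 2 + C y ^+ 2 - 1]; this determines the discriminant. *)
have d2 x y : (C (x + y) - C x * C y) ^+ 2 = (1 - C x ^+ 2) * (1 - C y ^+ 2).
  have H1 := dal (x + y) (x - y); have H2 := dal x y.
  have Hx := dal x x; have Hy := dal y y; rewrite !subrr C0 in Hx Hy.
  rewrite (_ : x + y + (x - y) = x + x) in H1; last by rewrite addrACA subrr addr0.
  rewrite (_ : x + y - (x - y) = y + y) in H1; last first.
    by rewrite opprB addrC addrA subrK.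
  have E : C (x - y) = 2 * C x * C y - C (x + y) by rewrite -H2; ring.
  rewrite E in H1.
  have H3 : C (x + y) * (2 * C x * C y - C (x + y)) = C x ^+ 2 + C y ^+ 2 - 1.
    by move: H1 Hx Hy; lra.
  by rewrite sqrrB; move: H3; rewrite mulrBr => H3; lra.
(* If [C] only takes the values 1 and -1, it is itself a character, with sine 0. *)
have [H|/existsNP[a /eqP Ha]] := pselect (forall x, C x ^+ 2 = 1).
  exists 0; split; first by split => //; exact: ap_cst.
  - by move=> x; rewrite H expr0n addr0.
  - move=> x y; rewrite mulr0 subr0; apply/eqP; rewrite -subr_eq0 -sqrf_eq0 d2.
    by rewrite H subrr mul0r.
  - by move=> x y; rewrite mulr0 mul0r addr0.
have a0 : 0 < 1 - C a ^+ 2.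
  rewrite subr_gt0 lt_neqAle Ha -real_normK ?num_real//.
  by rewrite /= expr_le1.
pose s := Num.sqrt (1 - C a ^+ 2).
have ss : s ^+ 2 = 1 - C a ^+ 2 by rewrite sqr_sqrtr ?ltW.
have s0 : s != 0 by rewrite gt_eqF// sqrtr_gt0.
(* The symmetric expressions that arise when the addition formulas for [S] are expanded. They are
   linear consequences of d'Alembert's equation at six pairs of points. *)
have key x y : (C x * C (y + a) + C y * C (x + a) =
      C (x + y + a) + (2 * C x * C y - C (x + y)) * C a) *
    (C (x + a) * C (y + a) = C (x + y + a) * C a + C x * C y - C (x + y)).
  have D1 := dal (x + a) (y + a); have D2 := dal y (x + a); have D3 := dal x (y + a).
  have D4 := dal (x + y + a) a; have D5 := dal (x - y) a; have D6 := dal x y.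
  have E1 : x + a + (y + a) = x + y + a + a by rewrite addrACA addrA.
  have E2 : x + a - (y + a) = x - y by rewrite opprD addrACA subrr addr0.
  have E3 : y + (x + a) = x + y + a by rewrite addrA [y + x]addrC.
  have E4 : C (y - (x + a)) = C (x - y + a) by rewrite -even opprB addrAC.
  have E5 : x + (y + a) = x + y + a by rewrite addrA.
  have E6 : x - (y + a) = x - y - a by rewrite opprD addrA.
  rewrite E1 E2 in D1; rewrite E3 E4 in D2; rewrite E5 E6 in D3; rewrite addrK in D4.
  have Cxy : C (x - y) = 2 * C x * C y - C (x + y) by rewrite -D6; ring.
  by rewrite -Cxy; split; lra.
exists (s^-1 *: (C a *: C - (fun x => C (x + a)))).
split.
- by split => //; apply: apZ; apply: apD; [exact: apZ|apply: apN; exact: ap_shift].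
- move=> x; rewrite !f_at exprMn exprVn ss.
  have -> : (C a * C x - C (x + a)) ^+ 2 = (1 - C x ^+ 2) * (1 - C a ^+ 2).
    by rewrite -d2; ring.
  by field; rewrite gt_eqF.
- move=> x y; rewrite !f_at mulrACA -invfM -expr2.
  have -> : (C a * C x - C (x + a)) * (C a * C y - C (y + a)) =
      (C x * C y - C (x + y)) * s ^+ 2.
    rewrite ss (_ : _ * _ = C a ^+ 2 * C x * C y
      - C a * (C x * C (y + a) + C y * C (x + a)) + C (x + a) * C (y + a)); last by ring.
    by rewrite !key; ring.
  by field.
- move=> x y; rewrite !f_at; have [H _] := key x y.
  have -> : s^-1 * (C a * C x - C (x + a)) * C y + C x * (s^-1 * (C a * C y - C (y + a)))
    = s^-1 * (2 * C a * C x * C y - (C x * C (y + a) + C y * C (x + a))) by ring.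
  by rewrite H; congr (_ * _); ring.
Qed.

Lemma character_sub C S : character C S ->
  forall x y, C (x - y) = C x * C y + S x * S y.
Proof.
move=> [_ CS CD SD] x y.
have C00 := CS 0; have C0 := CD 0 0; have S0 := SD 0 0; rewrite addr0 in C0 S0.
have S00 : S 0 = 0 by nra.
have C01 : C 0 = 1 by nra.
have := CD (x - y) y; have := SD (x - y) y; rewrite subrK => -> ->.
transitivity (C (x - y) * (C y ^+ 2 + S y ^+ 2)); last by ring.
by rewrite CS mulr1.
Qed.

(** Real trigonometric polynomials: an entry [(a, b, C, S)] stands for [a C + b S], where [C + i S]
    is meant to be a character. *)
Definition trigsum (s : seq (R * R * (X -> R) * (X -> R))) : X -> R :=
  fun x => \sum_(p <- s) (p.1.1.1 * p.1.2 x + p.1.1.2 * p.2 x).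

Lemma trigsum_ap s : (forall p, p \in s -> character p.1.2 p.2) -> ap (trigsum s).
Proof.
elim: s => [_|p s IH ch].
  rewrite /trigsum (_ : (fun x => _) = fun=> 0); first exact: ap_cst.
  by apply/funext => x; rewrite big_nil.
rewrite /trigsum (_ : (fun x => _) = p.1.1.1 *: p.1.2 + p.1.1.2 *: p.2 + trigsum s).
  have [[aC aS] _ _ _] := ch p (mem_head _ _).
  apply: apD; first by apply: apD; exact: apZ.
  by apply: IH => q qs; apply: ch; rewrite inE qs orbT.
by apply/funext => x; rewrite big_cons.
Qed.

(** [conv f e] is close to [f] in mean square, hence in mean, and [e] is a finite combination of
    cosines. By the subtraction formula, [conv f C] is [ip f C *: C + ip f S *: S]. *)
Theorem ap_trigsum f eps : ap f -> 0 < eps ->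
  exists s, (forall p, p \in s -> character p.1.2 p.2) /\
    mean (fun x => `|f x - trigsum s x|) <= eps.
Proof.
move=> af eps0; have e20 : 0 < eps ^+ 2 by rewrite exprn_gt0.
have bf : bohr f by case: af.
have [e ie He] := idem_approx af e20.
have be := idem_bohr ie; have bfe : bohr (f - conv f e) by solve_bohr.
have [s [sc es]] := idem_cosines ie.
suff [t [tch te]] : exists t, (forall p, p \in t -> character p.1.2 p.2) /\
    conv f e = trigsum t.
  exists t; split => //; rewrite -te -[leLHS]ger0_norm; last first.
    apply: mean_ge_cst => //; exact: (bohr_norm bfe).
  apply: norm_le_sqr; first exact: ltW.
  exact: le_trans (mean_norm_le bfe) He.
rewrite es; elim: s sc {e ie He be bfe es} => [_|[a C] s IH sc].
  exists [::]; split => //; rewrite /lincomb big_nil convC ?conv0f//; last exact: bohr_cst.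
  by apply/funext => x; rewrite /trigsum big_nil.
have cC : cosine C := sc _ (mem_head _ _).
have [|t [tch te]] := IH; first by move=> p ps; apply: sc; rewrite inE ps orbT.
have [S ch] := cosine_character cC.
have [[aC aS] _ _ _] := ch; have [bC bS] : bohr C /\ bohr S by case: aC; case: aS.
have bl : bohr (lincomb s).
  rewrite /lincomb big_seq; apply: (big_ind bohr); [exact: bohr_cst|exact: bohrD|].
  move=> p ps; apply: bohrZ; have [|[]//] := sc p.
  by rewrite inE ps orbT.
exists ((a * ip f C, a * ip f S, C, S) :: t); split.
  by move=> p; rewrite inE => /predU1P[->//|/tch].
rewrite /lincomb big_cons -/(lincomb s) convDr//; last exact: bohrZ.
rewrite te convZr//; apply/funext => x; rewrite !f_at {2}/trigsum big_cons.
congr (_ + _); rewrite convC// /conv /=.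
have -> : (fun s => C (x - s) * f s) = C x *: (f * C) + S x *: (f * S).
  by apply/funext => z; rewrite !f_at (character_sub ch); ring.
have [b1 b2] : bohr (f * C) /\ bohr (f * S) by split; exact: bohr_mul_ap.
rewrite meanD ?meanZ//; try exact: bohrZ.
by rewrite /ip; ring.
Qed.

End spectral.

(** * Compact sets and Haar measure *)

(** A finite subcover whose members are indexed by their centres. Near-covering compactness is
    applied along the filter [F] of finite sequences in [K], directed by inclusion. *)
Lemma compact_seq_cover (T : topologicalType) (K : set T) (N : T -> set T) :
  compact K -> (forall x, K x -> nbhs x (N x)) ->
  exists s : seq T, (forall t, t \in s -> K t) /\
    forall x, K x -> exists2 t, t \in s & N t x.
Proof.
move=> /compact_near_coveringP cK nN.
pose S (s : seq T) := forall t, t \in s -> K t.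
pose F : set_system (seq T) := [set P : set (seq T) | exists s0 : seq T, S s0 /\
  forall s, S s -> (forall t, t \in s0 -> t \in s) -> P s].
have FF : Filter F.
  split.
  - by exists [::]; split.
  - move=> P Q [s [Ss sP]] [t [St tQ]]; exists (s ++ t); split.
      by move=> u; rewrite mem_cat => /orP[/Ss|/St].
    move=> u Su stu; split; [apply: sP|apply: tQ] => // v vs; apply: stu;
      by rewrite mem_cat vs ?orbT.
  - move=> P Q PQ [s [Ss sP]]; exists s; split => // t St st.
    exact/PQ/sP.
have := cK (seq T) F (fun s x => S s -> exists2 t, t \in s & N t x) FF.
case => [x Kx|s [Ss sP]]; last first.
  by exists s; split => // x Kx; exact: (sP s Ss).
exists (N x, [set s : seq T | x \in s]) => /=.
  split; first exact: nN.
  exists [:: x]; split; first by move=> t; rewrite inE => /eqP ->.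
  by move=> s _ /(_ x (mem_head _ _)).
by move=> [y s] [/= Nxy xs] _; exists x.
Qed.

Lemma continuous_nbhs (S T : topologicalType) (f : S -> T) x y U :
  continuous f -> f x = y -> nbhs y U -> nbhs x (f @^-1` U).
Proof. by move=> cf <- nU; exact: cf. Qed.

Section topological_group.
Context {X : topologicalZmodType}.
Implicit Types (x y v : X) (A B K U V : set X).

Lemma nbhs_shift x U : nbhs x U -> nbhs 0 [set v | U (x + v)].
Proof.
move=> /(continuous_nbhs (@shift_continuous X x) (add0r x)).
by apply: filterS => v /=; rewrite addrC.
Qed.

Lemma nbhs_shift0 x V : nbhs 0 V -> nbhs x [set y | V (y - x)].
Proof.
exact: continuous_nbhs (@shift_continuous X (- x)) (subrr x).
Qed.

Lemma nbhs0_sub U : nbhs 0 U ->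
  exists2 V, nbhs 0 V & forall a b, V a -> V b -> U (a - b).
Proof.
move=> /(@continuous_nbhs _ _ _ (0, 0) _ _ (@sub_continuous X) (subr0 0)).
case=> -[V W] /= [nV nW] VW; exists (V `&` W); first exact: filterI.
by move=> a b [Va _] [_ Wb]; exact: (VW (a, b)).
Qed.

Lemma nbhs0_opp U : nbhs 0 U -> nbhs 0 [set v | U (- v)].
Proof. exact: continuous_nbhs (@opp_continuous X) (oppr0 X). Qed.

Lemma compact_translates K V : compact K -> nbhs 0 V ->
  exists s : seq X, forall x, K x -> exists2 t, t \in s & V (x - t).
Proof.
move=> cK nV.
have [|s [_ sP]] := @compact_seq_cover _ K (fun t => [set x | V (x - t)]) cK.
  by move=> x _; exact: nbhs_shift0.
by exists s.
Qed.

Lemma compact_sub A B : compact A -> compact B -> compact [set a - b | a in A & b in B].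
Proof.
move=> cA cB; have -> : [set a - b | a in A & b in B] =
    (fun p : X * X => p.1 - p.2) @` (A `*` B).
  apply/seteqP; split => [_ [a Aa [b Bb <-]]|_ [[a b] [/= Aa Bb] <-]].
    by exists (a, b).
  by exists a => //; exists b.
apply: continuous_compact; last exact: compact_setX.
exact/continuous_subspaceT/sub_continuous.
Qed.

Lemma compact_opp A : compact A -> compact [set - a | a in A].
Proof.
move=> cA; apply: continuous_compact cA.
exact/continuous_subspaceT/opp_continuous.
Qed.

Lemma compact_translate x A : compact A -> compact (translate x A).
Proof.
move=> cA; apply: continuous_compact cA; apply/continuous_subspaceT.
have -> : +%R x = (fun y => y + x) by apply/funext => y; rewrite addrC.
exact: shift_continuous.
Qed.

Lemma open_translate x A : open A -> open (translate x A).
Proof.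
move=> oA; have -> : translate x A = (fun y => y + - x) @^-1` A.
  apply/seteqP; split => [_ [a Aa <-]|y Ay] /=; first by rewrite addrAC subrr add0r.
  by exists (y - x) => //; rewrite addrC subrK.
by apply: open_comp => // y _; exact: shift_continuous.
Qed.

Lemma compact_nbhs0 : locally_compact [set: X] ->
  exists V, [/\ nbhs 0 V, compact V & closed V].
Proof.
move=> /(_ 0 I)[V nV [cV clV]]; exists V; split => //.
by move: nV; rewrite /within/=; apply: filterS => y; exact.
Qed.

Context {R : realType}.

Lemma compact_support_uniform (phi : X -> R) C e : continuous phi -> compact C ->
  (forall x, phi x != 0 -> C x) -> 0 < e ->
  nbhs 0 [set v | forall x, `|phi (x + v) - phi x| <= e].
Proof.
move=> cphi /compact_near_coveringP cC supp e0.
have e20 : 0 < e / 2 by rewrite divr_gt0.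
have H : nbhs 0 [set v | C `<=` [set x | `|phi (x + v) - phi x| <= e]].
  apply: (cC X (nbhs 0) (fun v x => `|phi (x + v) - phi x| <= e)) => x Cx.
  have cx : nbhs x [set y | `|phi x - phi y| <= e / 2].
    by have /cvgrPdist_le/(_ _ e20) := cphi x.
  have [[V W] /= [nV nW] VW] :=
    @continuous_nbhs _ _ _ (x, 0) _ _ (@add_continuous X) (addr0 x) cx.
  exists (V `&` [set y | `|phi x - phi y| <= e / 2], W) => /=.
    by split => //; exact: filterI.
  move=> [y v] [/= [Vy xy] Wv]; have := VW (y, v) (conj Vy Wv); move: xy.
  by rewrite /= !ler_norml; lra.
(* If [x] is outside [C] but [x + v] is inside, the estimate is read at [x + v] with the translation
   [- v]; hence the second neighbourhood. *)
apply: filterS2 H (nbhs0_opp H) => v H1 H2 x.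
have [Cx|Cx] := pselect (C x); first exact: H1.
have [Cxv|Cxv] := pselect (C (x + v)).
  by have := H2 _ Cxv; rewrite /= addrK distrC.
have phi0 y : ~ C y -> phi y = 0 by move=> Cy; apply/eqP; apply: contra_notT Cy; exact: supp.
by rewrite !phi0// subrr normr0 ltW.
Qed.

Lemma bump_at x U : lca_group X -> open U -> U x -> exists h : X -> R,
  [/\ continuous h, forall y, 0 <= h y <= 1, nbhs x [set y | h y = 1]
  & exists C, [/\ compact C, C `<=` U & forall y, h y != 0 -> C y]].
Proof.
move=> [hX lX] oU Ux; have [V [nV cV clV]] := compact_nbhs0 lX.
pose O := U `&` (translate x V)°.
have oO : open O by apply: openI => //; exact: open_interior.
have Ox : O x.
  split => //; have := nbhs_shift0 x nV; apply: filterS => y /= Vy.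
  by exists (y - x) => //; rewrite addrC subrK.
have := @locally_compact_completely_regular X R lX hX x (~` O) (open_closedC oO).
case/(_ (fun f => f Ox))/(uniform_separatorP (R := R)) => f [cf f01 f0 f1].
have fx : f x = 0 by apply: f0; exists x.
pose g y := 1 - f y.
have cg : continuous g by move=> y; apply: cvgB; [exact: cvg_cst|exact: cf].
(* The truncation is 1 where [g >= 2 / 3], which holds near [x], and nonzero only where [g > 1 / 3];
   the closed set [1 / 3 <= g] lies in [O], hence in a compact translate of [V]. *)
pose h y := Num.min 1 (Num.max 0 (3 * g y - 1)).
have ch : continuous h.
  move=> y; apply: (@continuous_min R X (fun=> 1)); first exact: cvg_cst.
  apply: (@continuous_max R X (fun=> 0)); first exact: cvg_cst.
  by apply: cvgB; [apply: cvgM; [exact: cvg_cst|exact: cg]|exact: cvg_cst].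
have h01 y : 0 <= h y <= 1.
  by rewrite /h le_min ler01 le_max lexx ge_min lexx.
have hg y : h y != 0 -> 1 / 3 <= g y.
  rewrite /h; case: (lerP (3 * g y - 1) 0) => g1; last by lra.
  by rewrite (min_idPr _) ?eqxx.
have gO y : 1 / 3 <= g y -> O y.
  move=> gy; apply: contrapT => Oy; have : f y = 1 by apply: f1; exists y.
  by move=> fy; move: gy; rewrite /g fy; lra.
exists h; split => //.
- have : nbhs x [set y | `|f x - f y| <= 1 / 3].
    by have /cvgrPdist_le/(_ (1 / 3)) := cf x; apply; lra.
  apply: filterS => y /=; rewrite fx sub0r normrN ler_norml => fy.
  by rewrite /h (max_idPr _) ?(min_idPl _)// /g; lra.
- exists [set y | 1 / 3 <= g y]; split => //.
  + apply: (@subclosed_compact _ _ (translate x V)); [|exact: compact_translate|].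
      have -> : [set y | 1 / 3 <= g y] = g @^-1` [set z | 1 / 3 <= z] by [].
      by apply: closed_comp; [move=> y _; exact: cg|exact: closed_ge].
    by move=> y /gO[_ /interior_subset].
  + by move=> y /gO[].
Qed.

Lemma bump_function K U : lca_group X -> compact K -> open U -> K `<=` U ->
  exists h : X -> R, [/\ continuous h, forall y, 0 <= h y <= 1, forall y, K y -> h y = 1
  & exists C, [/\ compact C, C `<=` U & forall y, h y != 0 -> C y]].
Proof.
move=> lX cK oU KU.
have /choice[h hP] : forall x, exists h : X -> R, U x ->
  [/\ continuous h, forall y, 0 <= h y <= 1, nbhs x [set y | h y = 1]
  & exists C, [/\ compact C, C `<=` U & forall y, h y != 0 -> C y]].
  move=> x; have [Ux|Ux] := pselect (U x); last by exists (fun=> 0).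
  by have [h hP] := bump_at lX oU Ux; exists h.
have [|s [sK sP]] := @compact_seq_cover _ K (fun x => [set y | h x y = 1]) cK.
  by move=> x /KU /hP[].
suff [k [ck k01 k1 kC]] : exists k : X -> R, [/\ continuous k, forall y, 0 <= k y <= 1,
    forall t y, t \in s -> h t y = 1 -> k y = 1
    & exists C, [/\ compact C, C `<=` U & forall y, k y != 0 -> C y]].
  by exists k; split => // y /sP[t ts /k1]; exact.
elim: s sK {sP} => [_|t s IH sK].
  exists (fun=> 0); split => //; first exact: cst_continuous.
    by move=> y; rewrite lexx ler01.
  by exists set0; split => //; [exact: compact0|move=> y; rewrite eqxx].
have [|k [ck k01 k1 [C [cC CU kC]]]] := IH.
  by move=> u us; apply: sK; rewrite inE us orbT.
have [|ct t01 t1 [D [cD DU tD]]] := hP t; first by apply/KU/sK/mem_head.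
exists (fun y => Num.max (h t y) (k y)); split.
- by move=> y; apply: (@continuous_max R X); [exact: ct|exact: ck].
- by move=> y; have := t01 y; have := k01 y; rewrite le_max ge_max; lra.
- move=> u y; rewrite inE => /predU1P[->|us] hu; apply/eqP; rewrite eq_le le_max ge_max.
    by rewrite hu lexx andbT; have := k01 y; lra.
  by rewrite (k1 u)// lexx orbT andbT; have := t01 y; lra.
- exists (D `|` C); split; first exact: compactU.
    by move=> y [/DU|/CU].
  move=> y; have [h0|/tD] := eqVneq (h t y) 0; last by left.
  have [k0|/kC] := eqVneq (k y) 0; last by right.
  by rewrite h0 k0 maxxx eqxx.
Qed.

End topological_group.

Section borel_sets.
Context {R : realType} {X : topologicalZmodType}.

Lemma open_borel (U : set X) : open U -> measurable (U : set (borel X)).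
Proof. by move=> oU; apply: sub_sigma_algebra. Qed.

Lemma closed_borel (U : set X) : closed U -> measurable (U : set (borel X)).
Proof.
by move=> cU; rewrite -[U]setCK; apply: measurableC; apply: open_borel; exact: closed_openC.
Qed.

Lemma compact_borel (K : set X) : hausdorff_space X -> compact K ->
  measurable (K : set (borel X)).
Proof. by move=> hX cK; apply: closed_borel; exact: compact_closed. Qed.

Lemma continuous_borel (f : X -> R) : continuous f ->
  measurable_fun setT (f : borel X -> R).
Proof.
move=> /continuousP cf; apply: (measurability _ (RGenOpens.measurableE R)).
move=> _ [_ [a [b ->] <-]]; rewrite setTI.
by apply: open_borel; apply: cf; exact: interval_open.
Qed.

Lemma shift_borel (a : X) : measurable_fun setT ((fun x => x + a) : borel X -> borel X).
Proof.
apply: (@measurability _ _ (borel X) (borel X) setT _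
  [set U | open (U : set X)]) => //.
move=> _ [U oU <-]; rewrite setTI; apply: open_borel.
by apply: open_comp => // x _; exact: shift_continuous.
Qed.

Lemma translate_borel (t : X) (B : set X) : measurable (B : set (borel X)) ->
  measurable (translate t B : set (borel X)).
Proof.
move=> mB; have := shift_borel (- t) measurableT mB; rewrite setTI.
congr measurable; apply/seteqP; split => [x Bx|_ [b Bb <-]] /=.
  by exists (x - t) => //; rewrite addrC subrK.
by rewrite addrAC subrr add0r.
Qed.

End borel_sets.

Lemma measure_bigsetU_le d (T : measurableType d) (R : realType) (I : Type)
    (mu : {measure set T -> \bar R}) (f : I -> set T) (s : seq I) :
  (forall i, measurable (f i)) ->
  (mu (\big[setU/set0]_(i <- s) f i) <= \sum_(i <- s) mu (f i))%E.
Proof.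
move=> mf; elim: s => [|i s IH]; first by rewrite !big_nil measure0.
rewrite !big_cons; apply: (le_trans (measureU2 _ _ _)) => //.
  exact: bigsetU_measurable.
exact: leeD2l.
Qed.

Section haar.
Context {R : realType} {X : topologicalZmodType}.
Variable (mu : {measure set (borel X) -> \bar R}).
Hypotheses (hmu : haar_measure mu) (hX : hausdorff_space X).
Local Open Scope ereal_scope.

Lemma haar_shift_integral (a : X) (f : X -> \bar R) :
  measurable_fun setT (f : borel X -> \bar R) -> (forall x, 0 <= f x) ->
  \int[mu]_x f (x + a)%R = \int[mu]_x f x.
Proof.
move=> mf f0; have [_ inv _ _ _] := hmu.
have := @ge0_integral_pushforward _ _ _ _ R _ (shift_borel a) mu setT f measurableT mf.
rewrite preimage_setT => <-; last by move=> x _; exact: f0.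
apply: eq_measure_integral => [|? B mB _]; first exact: shift_borel.
rewrite /pushforward -(inv (- a)%R B mB).
congr (mu _); apply/seteqP; split => x /=.
  by move=> Bx; exists (x + a)%R => //; rewrite addrC addrK.
by move=> [b Bb <-]; rewrite addrAC addNr add0r.
Qed.

Lemma haar_compact (K : set X) : compact K -> mu K < +oo.
Proof. by case: hmu => _ _ H _ _; exact: H. Qed.

Lemma haar_translate (t : X) (B : set X) : measurable (B : set (borel X)) ->
  mu (translate t B) = mu B.
Proof. by case: hmu => _ H _ _ _; exact: H. Qed.

(** If [U] were null, every compact set, being covered by finitely many translates of [U], would be
    null, and inner regularity would make the whole measure zero. *)
Lemma haar_open (U : set X) : open U -> U !=set0 -> 0 < mu U.
Proof.
move=> oU [u Uu]; rewrite lt_neqAle measure_ge0 andbT eq_sym; apply/eqP => U0.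
have [nz _ _ _ inner] := hmu; move/eqP: nz; apply.
rewrite inner; last exact: openT.
apply/eqP; rewrite eq_le; apply/andP; split; last first.
  by apply: ereal_sup_ubound; exists set0; [split => //; exact: compact0|rewrite measure0].
apply: ge_ereal_sup => _ [K [cK _] <-].
have nU : nbhs 0%R [set v | U (u + v)%R] by apply: nbhs_shift; exact: open_nbhs_nbhs.
have [s sP] := compact_translates cK nU.
apply: (@le_trans _ _ (\sum_(t <- s) mu (translate (t - u)%R U))); last first.
  rewrite big1_seq// => t _; rewrite haar_translate//; exact: open_borel.
apply: (@le_trans _ _ (mu (\big[setU/set0]_(t <- s) translate (t - u)%R U))); last first.
  by apply: measure_bigsetU_le => t; apply: open_borel; exact: open_translate.
apply: le_measure; rewrite ?inE; first exact: compact_borel.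
  by apply: bigsetU_measurable => v _; apply: open_borel; exact: open_translate.
move=> x /sP[t ts Ut]; rewrite -bigcup_seq; exists t => //.
by exists (u + (x - t))%R => //; rewrite addrA subrK addrC subrK.
Qed.

End haar.

(** * Sums of a compactly supported function over a uniformly discrete set *)

Section lattice_sums.
Context {R : realType} {X : topologicalZmodType}.
Variable L : set X.
Implicit Types (Q : set X) (P : X -> R).

(** The bound [N] is uniform over all translates of [Q]; the uniform estimates on lattice sums and
    translation boundedness both rest on this. *)
Definition uniformly_discrete := forall Q, compact Q -> exists N : nat,
  forall x (s : seq X), uniq s -> (forall l, l \in s -> L l /\ Q (x + l)) ->
  (size s <= N)%N.

(** Pigeonhole: [Q] is covered by finitely many translates of [W], and each holds at most one point
    since [W - W] lies in a neighbourhood meeting [L] only at 0. *)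
Lemma lattice_uniformly_discrete : subgroup L -> L `<=` isolated L ->
  uniformly_discrete.
Proof.
move=> [L0 LB] Liso Q cQ.
have [_ [V nV VL]] := Liso 0 L0.
have [W nW WV] := nbhs0_sub nV.
have [t tP] := compact_translates cQ nW.
exists (size t) => x s us sP.
have /choice[f fP] : forall l, exists u, l \in s -> u \in t /\ W (x + l - u).
  move=> l; have [ls|ls] := boolP (l \in s); last by exists 0.
  by have [_ /tP[u ut Wu]] := sP l ls; exists u.
rewrite -(size_map f); apply: uniq_leq_size.
  rewrite map_inj_in_uniq// => l m ls ms fE.
  have [_ W1] := fP l ls; have [_ W2] := fP m ms.
  have [Ll _] := sP l ls; have [Lm _] := sP m ms.
  have : (V `&` L) (l - m).
    split; last exact: LB.
    have := WV _ _ W1 W2; rewrite fE opprB addrA subrK opprD addrA.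
    by rewrite [x + l]addrC addrK.
  by rewrite VL => /eqP; rewrite subr_eq0 => /eqP.
by move=> _ /mapP[l ls ->]; case: (fP l ls).
Qed.

Hypothesis uL : uniformly_discrete.

Definition points Q (x : X) : set X := [set l | L l /\ Q (x + l)].

Lemma finite_points Q x : compact Q -> finite_set (points Q x).
Proof.
move=> /uL[N NP]; apply: contrapT => /(@infinite_set_fset _ _ N.+1)[B Bp].
apply/negP; rewrite -leqNgt; apply: (NP x) => [|l lB]; first exact: fset_uniq.
exact: (Bp l lB).
Qed.

(** A sum with infinite support is 0 by convention; for [P] supported in a compact set, [combE]
    shows that this default does not occur. *)
Definition comb P (x : X) : R := \sum_(l \in L) P (x + l).

Lemma combE P Q x : compact Q -> (forall y, P y != 0 -> Q y) ->
  comb P x = \sum_(l <- fset_set (points Q x)) P (x + l).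
Proof.
move=> cQ supp; rewrite /comb -(@fsbig_widen _ _ _ _ (points Q x)).
- by rewrite fsbig_finite//; exact: finite_points.
- by move=> l [].
- move=> l [Ll nl] /=; apply/eqP; apply: contra_notT nl => /supp Ql.
  by split.
Qed.

Lemma comb_seq P x (r : seq X) : uniq r -> (forall l, l \in r -> L l) ->
  (forall l, L l -> P (x + l) != 0 -> l \in r) -> comb P x = \sum_(l <- r) P (x + l).
Proof.
move=> ur rL Pr; rewrite /comb (@fsbigE _ _ _ _ _ r)//.
  rewrite big_seq_cond [RHS]big_seq; apply: eq_bigl => l.
  by case: (boolP (l \in r)) => //= /rL /mem_set.
by move=> l Ll lr; apply/eqP; apply: contraNT lr; exact: Pr.
Qed.

Lemma combB P P' Q x : compact Q -> (forall y, P y != 0 -> Q y) ->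
  (forall y, P' y != 0 -> Q y) -> comb (fun y => P y - P' y) x = comb P x - comb P' x.
Proof.
move=> cQ PQ P'Q; rewrite !(@combE _ Q)// ?sumrB// => y.
have [->|/PQ//] := eqVneq (P y) 0; have [->|/P'Q//] := eqVneq (P' y) 0.
by rewrite subrr eqxx.
Qed.

Lemma comb_norm P Q x : compact Q -> (forall y, P y != 0 -> Q y) ->
  `|comb P x| <= comb (fun y => `|P y|) x.
Proof.
move=> cQ PQ; rewrite !(@combE _ Q)//; first exact: ler_norm_sum.
by move=> y; rewrite normr_eq0; exact: PQ.
Qed.

Lemma comb_dist Q : compact Q -> exists N : nat, forall P P' e x,
  (forall y, P y != 0 -> Q y) -> (forall y, P' y != 0 -> Q y) ->
  (forall y, `|P y - P' y| <= e) -> `|comb P x - comb P' x| <= N%:R * e.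
Proof.
move=> cQ; have [N NP] := uL cQ; exists N => P P' e x PQ P'Q PP'.
rewrite !(@combE _ Q)// -sumrB; apply: (le_trans (ler_norm_sum _ _ _)).
have e0 : 0 <= e := le_trans (normr_ge0 _) (PP' 0).
apply: (@le_trans _ _ (\sum_(l <- fset_set (points Q x)) e)); first exact: ler_sum.
rewrite big_const_seq count_predT iter_addr_0 -[e *+ _]mulr_natl ler_wpM2r// ler_nat.
apply: (NP x) => [|l]; first exact: fset_uniq.
rewrite in_fset_set; last exact: finite_points.
by rewrite inE.
Qed.

Lemma comb_periodic P p x : subgroup L -> L p -> comb P (x + p) = comb P x.
Proof.
move=> [L0 LB] Lp; rewrite /comb.
rewrite [RHS](@reindex_fsbig _ _ _ _ _ (fun l => l + p) L L).
  by apply: eq_fsbigr => l _; rewrite addrAC addrA.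
split.
- by move=> l Ll /=; rewrite -[p]opprK -[- p]sub0r; apply: (LB _ _ Ll); exact: LB.
- by move=> l m _ _ /addIr.
- by move=> l Ll; exists (l - p); [exact: LB|rewrite subrK].
Qed.

Lemma comb_ap P C K : locally_compact [set: X] -> subgroup L -> continuous P -> compact C ->
  (forall y, P y != 0 -> C y) -> compact K ->
  (forall x, exists l, L l /\ K (x - l)) -> ap (comb P).
Proof.
move=> lX sL cP cC PC cK KL.
have [V [nV cV _]] := compact_nbhs0 lX.
(* [C'] contains the supports of [P] and of its translates by all [v] in [V], so that one constant
   [N] serves for all these comparisons. *)
pose C' := [set a - b | a in C & b in V].
have cC' : compact C' by exact: compact_sub.
have CC' c v : C c -> V v -> C' (c - v) by move=> Cc Vv; exists c => //; exists v.
have V0 : V 0 by exact: nbhs_singleton.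
have [N ND] := comb_dist cC'.
have PC' y : P y != 0 -> C' y by move=> /PC Cy; rewrite -[y]subr0; exact: CC'.
have uni e : 0 < e -> nbhs 0 [set v | forall x, `|comb P (x + v) - comb P x| <= e].
  move=> e0; have d0 : 0 < e / N.+1%:R by rewrite divr_gt0.
  apply: filterS2 nV (compact_support_uniform cP cC PC d0) => v Vv Hv x.
  have -> : comb P (x + v) = comb (fun y => P (y + v)) x.
    by rewrite /comb; apply: eq_fsbigr => l _; rewrite addrAC.
  apply: (le_trans (ND _ _ (e / N.+1%:R) x _ PC' _)).
  - by move=> y /PC Cy; rewrite -[y](addrK v); exact: CC'.
  - by move=> y; exact: Hv.
  rewrite mulrCA ler_piMr ?ltW// ltr_pdivrMr// mul1r ltr_nat//.
split.
  move=> x; apply/cvgrPdist_le => e e0.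
  have := nbhs_shift0 x (uni e e0); apply: filterS => y /= /(_ x).
  by rewrite [x + _]addrC subrK distrC.
move=> e e0; have e20 : 0 < e / 2 by rewrite divr_gt0.
have [s sP] := compact_translates cK (uni _ e20).
(* By periodicity [x] may be moved into [K], where finitely many translates of the neighbourhood
   from [uni] suffice; the centre of the translate becomes the colour of [x]. *)
have /choice[f fP] : forall x, exists t, t \in s /\
    forall z, `|comb P (x + z) - comb P (t + z)| <= e / 2.
  move=> x; have [l [Ll Kl]] := KL x; have [t ts tP] := sP _ Kl.
  exists t; split => // z; rewrite -[x](subrK l) addrAC [comb P (_ + l)]comb_periodic//.
  have := tP (t + z); rewrite (_ : t + z + (x - l - t) = x - l + z)//.
  by rewrite addrC addrA subrK.
exists (seq_sub s), (fun x => SeqSub (proj1 (fP x))) => x y [xy] z.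
have [_ /(_ z)] := fP x; have [_ /(_ z)] := fP y; rewrite xy !ler_norml; lra.
Qed.

End lattice_sums.

Section indicator_integral.
Context d (T : measurableType d) (R : realType) (mu : {measure set T -> \bar R}).

Lemma integral_indicE (D : set T) (f : T -> R) :
  (\int[mu]_(x in D) (f x)%:E)%E = (\int[mu]_x (f x * \1_D x)%:E)%E.
Proof.
rewrite integral_mkcond; apply: eq_integral => x _.
by rewrite patchE indicE; case: ifP; rewrite ?mulr1 ?mulr0.
Qed.

End indicator_integral.

(** * Averages along a van Hove sequence *)

Section van_hove_mean.
Context {R : realType} {G : topologicalZmodType}.
Variables (theta : {measure set (borel G) -> \bar R}) (A : nat -> set G).
Hypotheses (hG : haar_measure theta) (lG : lca_group G)
  (vA : van_hove_sequence theta A).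

Lemma van_hove_open n : open (A n). Proof. by case: vA => /(_ n)[]. Qed.

Lemma van_hove_borel n : measurable (A n : set (borel G)).
Proof. by apply: open_borel; exact: van_hove_open. Qed.

Lemma van_hove_fin n : exists2 a : R, 0 < a & theta (A n) = a%:E.
Proof.
have [/(_ n)[oA pA A0] _] := vA; rewrite precompactE in pA.
have Af : (theta (A n) < +oo)%E.
  apply: le_lt_trans (haar_compact hG pA).
  by apply: le_measure; rewrite ?inE; [exact: open_borel|
    apply: closed_borel; exact: closed_closure|exact: subset_closure].
have fA : theta (A n) \is a fin_num by rewrite ge0_fin_numE.
exists (fine (theta (A n))); last by rewrite fineK.
by rewrite fine_gt0// A0.
Qed.

Lemma van_hove_small K e : compact K -> 0 < e ->
  \forall n \near \oo, (theta (van_hove_boundary K (A n)) <= e%:E * theta (A n))%E.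
Proof.
move=> cK e0; have [_ /(_ K cK) vK] := vA.
have : nbhs (0%:E : \bar R) [set x | (x < e%:E)%E].
  apply: open_nbhs_nbhs; split; first exact: open_ereal_lt_ereal.
  by rewrite /= lte_fin.
move=> N0; have {N0}N0 : \forall n \near \oo,
    (theta (van_hove_boundary K (A n)) / theta (A n) < e%:E)%E := vK _ N0.
apply: filterS N0 => n.
have [a a0 ->] := van_hove_fin n.
by rewrite inver gt_eqF// => /ltW; rewrite lee_pdivrMr.
Qed.

(** After the substitution of [x + g] for [x], the mass sitting at points with [x + g] in [U] and
    [x] outside is charged to [D], at most [B] per unit of volume. *)
Lemma integral_shift_le (f : G -> R) B g (U D : set G) :
  continuous f -> (forall x, 0 <= f x <= B) -> open U ->
  measurable (D : set (borel G)) -> (forall x, ~ U x -> U (x + g) -> D x) ->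
  (\int[theta]_(x in (U : set (borel G))) (f x)%:E <=
   \int[theta]_(x in (U : set (borel G))) (f (x + g))%:E + B%:E * theta D)%E.
Proof.
move=> cf fB oU mD UD; have mU := open_borel oU.
have mf : measurable_fun setT (f : borel G -> R) by exact: continuous_borel.
have cfg : continuous (fun x => f (x + g)).
  move=> x; apply: (@continuous_comp _ _ _ (fun x => x + g) f); last exact: cf.
  exact: shift_continuous.
have mfg := continuous_borel cfg.
have B0 : 0 <= B by have := fB 0; lra.
have mh : measurable_fun setT (fun x : borel G => (f x * \1_(U : set (borel G)) x)%:E).
  apply/measurable_EFinP; apply: measurable_funM => //; exact: measurable_indic.
have f0 x : 0 <= f x by have := fB x; lra.
have h0 x : (0 <= (f x * \1_(U : set (borel G)) x)%:E)%E by rewrite lee_fin mulr_ge0.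
have E1 := haar_shift_integral hG g mh h0.
rewrite [leLHS]integral_indicE -E1 [X in (_ <= X + _)%E]integral_indicE.
have -> : (B%:E * theta D)%E = (\int[theta]_x (B * \1_(D : set (borel G)) x)%:E)%E.
  rewrite -[D in LHS]setIT -integral_indic// -ge0_integralZl//.
  by apply/measurable_EFinP; exact: measurable_indic.
have m1 : measurable_fun setT (fun x : borel G => (f (x + g) * \1_(U : set (borel G)) x)%:E).
  apply/measurable_EFinP; apply: measurable_funM => //; exact: measurable_indic.
have m2 : measurable_fun setT (fun x : borel G => (B * \1_(D : set (borel G)) x)%:E).
  apply/measurable_EFinP; apply: measurable_funM => //; exact: measurable_indic.
rewrite -ge0_integralD//; last 2 first.
- by move=> x _; rewrite lee_fin mulr_ge0.
- by move=> x _; rewrite lee_fin mulr_ge0.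
apply: ge0_le_integral => //.
- exact: (measurableT_comp mh (shift_borel g)).
- exact: emeasurable_funD.
- move=> x _; rewrite -EFinD lee_fin !indicE.
  have [Uxg|Uxg] := pselect (U (x + g)); last first.
    by rewrite (memNset Uxg) mulr0 addr_ge0 ?mulr_ge0.
  rewrite (mem_set Uxg) mulr1; have [Ux|Ux] := pselect (U x).
    by rewrite (mem_set Ux) mulr1 lerDl mulr_ge0.
  rewrite (memNset Ux) mulr0 add0r (mem_set (UD _ Ux Uxg)) mulr1.
  by have := fB (x + g); lra.
Qed.

(** Replacing [f] by its translates over [A n] costs only boundary terms, and the average of the
    translates over [s] is at most [mean f + e / 2] everywhere. *)
Lemma van_hove_mean (f : G -> R) e : ap f -> (forall x, 0 <= f x) -> 0 < e ->
  \forall n \near \oo, (\int[theta]_(x in (A n : set (borel G))) (f x)%:E <=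
    (mean f + e)%:E * theta (A n))%E.
Proof.
move=> [cf bf] f0 e0; have [B fB] := bohr_bounded bf.
have e20 : 0 < e / 2 by rewrite divr_gt0.
have [s [s0 sf]] := bohr_is_mean bf e20.
(* The signs are reversed because a point [x] outside [A n] with [x + g] inside is reached from
   [A n] by adding [- g]. *)
pose K := [set` [seq - g | g <- s]].
have cK : compact K by apply: finite_compact; exact: finite_seq.
have fB' x : 0 <= f x <= B by rewrite f0 (le_trans (ler_norm _) (fB x)).
have B0 : 0 <= B by have := fB' 0; lra.
have d0 : 0 < e / 2 / (B + 1) by rewrite divr_gt0//; lra.
have := van_hove_small cK d0; apply: filterS => n Hn.
set D := van_hove_boundary K (A n) in Hn.
have mD : measurable (D : set (borel G)).
  by apply: closed_borel; apply: closedU; apply: closedI; exact: closed_closure.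
have [a a0 aE] := van_hove_fin n; rewrite aE in Hn *.
have mA := van_hove_borel n.
have cfg g : continuous (fun x => f (x + g)).
  move=> x; apply: (@continuous_comp _ _ _ (fun x => x + g) f); last exact: cf.
  exact: shift_continuous.
have mfg g : measurable_fun (A n : set (borel G)) (fun x : borel G => (f (x + g))%:E).
  by apply/measurable_EFinP; apply: measurable_funTS; exact: (continuous_borel (cfg g)).
set I := (\int[theta]_(x in _) _)%E.
have step g : g \in s -> (I <= \int[theta]_(x in (A n : set (borel G))) (f (x + g))%:E
    + B%:E * theta D)%E.
  move=> gs; apply: integral_shift_le => //; first exact: van_hove_open.
  move=> x nAx Axg; left; split; apply: subset_closure => //.
  exists (x + g) => //; exists (- g); last by rewrite addrK.
  by rewrite /K /=; exact: map_f.
have sum : (((size s)%:R)%:E * I <=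
   \sum_(g <- s) \int[theta]_(x in (A n : set (borel G))) (f (x + g))%:E
    + ((size s)%:R * B)%:E * theta D)%E.
  have : forall u, {subset u <= s} -> (((size u)%:R)%:E * I <=
     \sum_(g <- u) \int[theta]_(x in (A n : set (borel G))) (f (x + g))%:E
      + ((size u)%:R * B)%:E * theta D)%E.
    elim=> [|g u IH] us; first by rewrite big_nil /= mul0r !mul0e adde0.
    rewrite big_cons /= -natr1 mulrDl mul1r !EFinD.
    rewrite ge0_muleDl ?lee_fin//; rewrite ge0_muleDl ?lee_fin ?mulr_ge0//.
    rewrite mul1e addeC [X in (_ <= _ + X)%E]addeC addeACA; apply: leeD.
      by apply: step; apply: us; rewrite mem_head.
    by apply: IH => v vu; apply: us; rewrite inE vu orbT.
  exact.
rewrite -ge0_integral_sum// in sum; last by move=> g x _; rewrite lee_fin.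
have up : (\int[theta]_(x in (A n : set (borel G))) (\sum_(g <- s) (f (x + g))%:E) <=
    ((size s)%:R * (mean f + e / 2))%:E * a%:E)%E.
  rewrite -aE -(integral_cst theta mA); apply: ge0_le_integral => //.
  - by move=> x _; apply: sume_ge0 => g _; rewrite lee_fin.
  - exact: emeasurable_sum.
  - move=> x _; rewrite /cst sumEFin lee_fin mulrC -ler_pdivrMr ?size_gt0R//.
    by have := sf x; rewrite ler_norml /avg; lra.
have := le_trans sum (leeD up (lee_wpmul2l _ Hn)).
rewrite lee_fin mulr_ge0// => /(_ isT).
have ss := @size_gt0R R _ _ s0.
rewrite -!EFinM -EFinD -lee_pdivlMl// -EFinM => /le_trans; apply.
rewrite lee_fin mulrC ler_pdivrMr//.
have : B * (e / 2 / (B + 1)) <= e / 2.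
  by rewrite mulrCA ler_piMr ?ltW// ltr_pdivrMr; lra.
set q := e / 2 / (B + 1) => Bq.
have : 0 <= (size s)%:R * a :> R by rewrite mulr_ge0// ltW.
nra.
Qed.

End van_hove_mean.

(** * Means of lattice sums computed on a fundamental domain *)

Section fundamental_domain.
Context {R : realType} {X : topologicalZmodType}.
Variables (mu : {measure set (borel X) -> \bar R}) (L F : set X).
Hypotheses (hmu : haar_measure mu) (hX : hausdorff_space X) (lX : locally_compact [set: X]).
Hypotheses (sL : subgroup L) (uL : uniformly_discrete L) (fF : fundamental_domain L F).
Local Open Scope ereal_scope.

(** Relative compactness of [F] leaves only finitely many lattice translates that can meet [Q]. *)
Lemma fundamental_domain_cover (Q : set X) : compact Q ->
  exists s : seq X, forall x, Q x -> exists2 l, l \in s & F (x - l)%R.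
Proof.
move=> cQ; have [_ pF FL] := fF; rewrite precompactE in pF.
have cD := compact_sub cQ pF.
exists (fset_set (points L [set a - b | a in Q & b in closure F]%R 0%R)) => x Qx.
have [l [[Ll Fl] _]] := FL x; exists l => //.
rewrite in_fset_set; last exact: finite_points.
rewrite inE; split => //; rewrite add0r; exists x => //; exists (x - l)%R.
  exact: subset_closure.
by rewrite subKr.
Qed.

Lemma fundamental_domain_fin : exists2 r : R, (0 < r)%R & mu F = r%:E.
Proof.
have [mF pF FL] := fF; rewrite precompactE in pF.
have Ff : mu F < +oo.
  apply: le_lt_trans (haar_compact hmu pF).
  by apply: le_measure; rewrite ?inE//; [
    apply: closed_borel; exact: closed_closure|exact: subset_closure].
have fFn : mu F \is a fin_num by rewrite ge0_fin_numE.
exists (fine (mu F)); last by rewrite fineK.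
rewrite fine_gt0// Ff andbT lt_neqAle measure_ge0 andbT eq_sym; apply/eqP => F0.
(* If [F] were null, a compact neighbourhood of 0, covered by finitely many translates of [F], would
   be null. *)
have [V [nV cV _]] := compact_nbhs0 lX.
have := haar_open hmu hX (@open_interior _ V) (ex_intro _ 0%R nV).
rewrite ltNge; apply/negP/negPn.
have [s sP] := fundamental_domain_cover cV.
apply: (@le_trans _ _ (mu (\big[setU/set0]_(l <- s) translate l F))).
  apply: le_measure; rewrite ?inE; first by apply: open_borel; exact: open_interior.
    by apply: bigsetU_measurable => l _; exact: translate_borel.
  move=> x /interior_subset /sP[l ls Fl]; rewrite -bigcup_seq; exists l => //.
  by exists (x - l)%R => //; rewrite addrC subrK.
apply: (le_trans (measure_bigsetU_le _ _ _)) => [l|]; first exact: translate_borel.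
by rewrite big1// => l _; rewrite haar_translate.
Qed.

Lemma fundamental_domain_disjoint (r : seq X) (y : X) : uniq r ->
  (forall l, l \in r -> L l) ->
  (\sum_(l <- r) \1_(F : set (borel X)) (y - l) <= 1 :> R)%R.
Proof.
move=> ur rL; have [_ _ FL] := fF.
have [/hasP[l lr]|/hasPn nr] := boolP (has (fun l => (y - l)%R \in F) r).
  rewrite inE => Fl; rewrite (big_rem l lr)/= big_seq big1 => [|m].
    by rewrite addr0 indicE; case: (_ \in _).
  rewrite mem_rem_uniq// inE => /andP[ml mr].
  rewrite indicE memNset// => Fm; have [k [_ kE]] := FL y.
  by move/eqP: ml; apply; rewrite -(kE l (conj (rL _ lr) Fl)) -(kE m (conj (rL _ mr) Fm)).
by rewrite big_seq big1// => l /nr lF; rewrite indicE (negbTE lF).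
Qed.

(** Unfolding: the integral over [F] of the sum becomes a sum of integrals over translates of [F],
    which are disjoint; [P] is bounded by the indicator of [Q]. *)
Lemma integral_comb_le (P : X -> R) Q t : compact Q -> ap (comb L P) ->
  (forall y, 0 <= P y <= 1)%R -> (forall y, P y != 0%R -> Q y) ->
  \int[mu]_(x in (F : set (borel X))) (comb L P (x + t)%R)%:E <= mu Q.
Proof.
move=> cQ [cP _] P01 PQ; have [mF pF FL] := fF; rewrite precompactE in pF.
have mQ := compact_borel hX cQ.
have cD := compact_sub cQ pF.
set D := image2 _ _ _ in cD.
have fD := finite_points uL t cD.
pose r : seq X := fset_set (points L D t).
have rL l : l \in r -> L l by rewrite in_fset_set// inE => -[].
have ur : uniq r by exact: fset_uniq.
have combr x : F x -> comb L P (x + t)%R = (\sum_(l <- r) P (x + (t + l)))%R.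
  move=> Fx; rewrite (@comb_seq _ _ _ _ _ r)//; first by under eq_bigr do rewrite -addrA.
  move=> l Ll /PQ Ql; rewrite in_fset_set// inE; split => //.
  exists (x + t + l)%R => //; exists x; first exact: subset_closure.
  by rewrite -(addrA x) [(x + _)%R]addrC addrK.
have cPt : continuous (fun x => comb L P (x + t)%R).
  move=> x; apply: (@continuous_comp _ _ _ (fun x => x + t)%R (comb L P)); last exact: cP.
  exact: shift_continuous.
pose h l (y : X) : \bar R := (\1_(F : set (borel X)) (y - (t + l)) * \1_(Q : set (borel X)) y)%:E.
have mFl l : measurable_fun setT (fun y : borel X => \1_(F : set (borel X)) (y - (t + l))%R : R).
  have mF1 : measurable_fun setT (\1_(F : set (borel X)) : borel X -> R) by exact: measurable_indic.
  exact: (measurableT_comp mF1 (shift_borel (- (t + l))%R)).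
have mQ1 : measurable_fun setT (\1_(Q : set (borel X)) : borel X -> R) by exact: measurable_indic.
have mh l : measurable_fun setT (h l : borel X -> \bar R).
  by apply/measurable_EFinP; exact: measurable_funM.
have h0 l x : 0 <= h l x by rewrite lee_fin mulr_ge0.
have mhg l : measurable_fun setT (fun x : borel X => h l (x + (t + l))%R).
  exact: (measurableT_comp (mh l) (shift_borel (t + l)%R)).
apply: (@le_trans _ _ (\int[mu]_x \sum_(l <- r) h l (x + (t + l))%R)).
  rewrite integral_mkcond; apply: ge0_le_integral => //.
  - move=> x _; rewrite patchE; case: ifP => // Fx; rewrite lee_fin.
    rewrite combr; last by rewrite inE in Fx.
    by apply: sumr_ge0 => l _; case/andP: (P01 (x + (t + l))%R).
  - apply/(measurable_restrictT _ mF); apply/measurable_EFinP.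
    by apply: measurable_funTS; exact: (continuous_borel cPt).
  - exact: emeasurable_sum.
  - move=> x _; rewrite patchE; case: ifP => Fx; last exact: sume_ge0.
    rewrite combr ?sumEFin ?lee_fin; last by rewrite inE in Fx.
    apply: ler_sum => l _; rewrite addrK !indicE Fx mul1r.
    have [P0|/PQ Ql] := eqVneq (P (x + (t + l))%R) 0%R; first by rewrite P0.
    by rewrite (mem_set Ql); case/andP: (P01 (x + (t + l))%R).
rewrite ge0_integral_sum//.
under eq_bigr do rewrite (haar_shift_integral hmu _ (mh _) (h0 _)).
rewrite -ge0_integral_sum// -[Q in leRHS]setIT -integral_indic//.
apply: ge0_le_integral => //.
- by move=> x _; exact: sume_ge0.
- exact: emeasurable_sum.
- exact/measurable_EFinP.
- move=> y _; rewrite sumEFin lee_fin -mulr_suml ler_piMl//.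
  under eq_bigr do rewrite opprD addrA.
  exact: fundamental_domain_disjoint.
Qed.

Lemma mean_comb_le (P : X -> R) Q : compact Q -> ap (comb L P) ->
  (forall y, 0 <= P y <= 1)%R -> (forall y, P y != 0%R -> Q y) ->
  (mean (comb L P))%:E * mu F <= mu Q.
Proof.
move=> cQ aP P01 PQ; have [mF _ _] := fF; have [a a0 aE] := fundamental_domain_fin.
have fQ : mu Q \is a fin_num by rewrite ge0_fin_numE// haar_compact.
have [cP bP] := aP.
have key e : (0 < e)%R -> (mean (comb L P) * a <= fine (mu Q) + e * a)%R.
  move=> e0; have [s [s0 sP]] := bohr_is_mean bP e0.
  have ss := @size_gt0R R _ _ s0.
  have cPt t : continuous (fun x => comb L P (x + t)%R).
    move=> x; apply: (@continuous_comp _ _ _ (fun x => x + t)%R (comb L P)); last exact: cP.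
    exact: shift_continuous.
  have c0 x : (0 <= comb L P x)%R.
    by rewrite (combE uL x cQ PQ)// sumr_ge0// => l _; case/andP: (P01 (x + l)%R).
  have mt t : measurable_fun (F : set (borel X)) (fun x : borel X => (comb L P (x + t)%R)%:E).
    by apply/measurable_EFinP; apply: measurable_funTS; exact: (continuous_borel (cPt t)).
  have : ((size s)%:R * (mean (comb L P) - e))%:E * mu F <= ((size s)%:R)%:E * mu Q.
    apply: (@le_trans _ _ (\int[mu]_(x in (F : set (borel X)))
        \sum_(t <- s) (comb L P (x + t)%R)%:E)).
      (* Monotonicity of the integral is applied to nonnegative functions, so a negative constant is
         treated apart. *)
      have [m0|m0] := leP 0%R (mean (comb L P) - e)%R; last first.
        apply: (@le_trans _ _ 0); last first.
          by apply: integral_ge0 => x _; apply: sume_ge0 => t _; rewrite lee_fin.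
        by rewrite aE -EFinM lee_fin pmulr_lle0// pmulr_rle0// ltW.
      rewrite -(integral_cst mu mF); apply: ge0_le_integral => //.
      - by move=> x _; rewrite /cst lee_fin mulr_ge0.
      - exact: emeasurable_sum.
      - move=> x _; rewrite /cst sumEFin lee_fin mulrC -ler_pdivlMr//.
        by have := sP x; rewrite ler_norml /avg; lra.
    rewrite ge0_integral_sum//; last by move=> t x _; rewrite lee_fin.
    apply: (@le_trans _ _ (\sum_(t <- s) mu Q)).
      by apply: lee_sum => t _; exact: integral_comb_le.
    by rewrite -(fineK fQ) sumEFin big_const_seq count_predT iter_addr_0 -EFinM mulr_natl.
  rewrite aE -(fineK fQ) -!EFinM lee_fin -mulrA ler_pM2l//; lra.
rewrite aE -(fineK fQ) -EFinM lee_fin; apply/ler_addgt0Pr => e e0.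
have := key (e / a)%R; rewrite divfK ?gt_eqF//; apply; exact: divr_gt0.
Qed.

End fundamental_domain.

(** * Sums over the lattice of a cut and project scheme *)

Section product_group.
Context {G H : topologicalZmodType}.

Lemma prod_group_hausdorff : hausdorff_space G -> hausdorff_space H ->
  hausdorff_space (prod_group G H).
Proof.
move=> hG hH [a b] [c d] cl; congr pair.
- apply: hG => U V nU nV.
  have [||[x y] [[/= Ux _] [/= Vx _]]] := cl (U `*` setT) (V `*` setT).
  + by exists (U, setT) => //=; split => //; exact: filterT.
  + by exists (V, setT) => //=; split => //; exact: filterT.
  by exists x.
- apply: hH => U V nU nV.
  have [||[x y] [[/= _ Uy] [/= _ Vy]]] := cl (setT `*` U) (setT `*` V).
  + by exists (setT, U) => //=; split => //; exact: filterT.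
  + by exists (setT, V) => //=; split => //; exact: filterT.
  by exists y.
Qed.

Lemma prod_group_lca : lca_group G -> lca_group H -> lca_group (prod_group G H).
Proof.
move=> [hG lG] [hH lH]; have hX := prod_group_hausdorff hG hH; split => //.
move=> [a b] _; have [U nU [cU _]] := lG a I; have [V nV [cV _]] := lH b I.
have cUV : compact (U `*` V : set (prod_group G H)) by exact: compact_setX.
exists (U `*` V) => //; last by split => //; exact: compact_closed hX cUV.
move: nU nV; rewrite /within/= => nU nV; exists (U, V) => //=.
  by split; [apply: filterS nU|apply: filterS nV] => x; exact.
Qed.

End product_group.

Section cut_and_project_sums.
Context {R : realType} {G H : topologicalZmodType}.
Variable L : set (prod_group G H).
Hypotheses (lG : lca_group G) (lH : lca_group H).
Hypotheses (sL : subgroup L) (uL : uniformly_discrete L).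
Implicit Types (phi : G -> R) (u v : H -> R) (t : G).

(** The signs are chosen so that a lattice point [l] contributes [phi (t - l.1) * u l.2]; as a
    [comb] on the product group it inherits the results above. *)
Definition csum phi u t : R :=
  comb L (fun p : prod_group G H => phi (- p.1) * u p.2) ((- t, 0) : prod_group G H).

Lemma compact_setX_group (C : set G) (W : set H) : compact C -> compact W ->
  compact (C `*` W : set (prod_group G H)).
Proof. exact: compact_setX. Qed.

Lemma csum_supp phi u (C : set G) (W : set H) :
  (forall x, phi x != 0 -> C x) -> (forall h, u h != 0 -> W h) ->
  forall p : prod_group G H, phi (- p.1) * u p.2 != 0 -> ([set - c | c in C] `*` W) p.
Proof.
move=> pC uW p; rewrite mulf_eq0 negb_or => /andP[/pC Cp /uW Wp]; split => //=.
by exists (- p.1) => //; rewrite opprK.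
Qed.

Lemma csum_seq phi u t (r : seq (prod_group G H)) : uniq r -> (forall l, l \in r -> L l) ->
  (forall l, L l -> phi (t - l.1) != 0 -> u l.2 != 0 -> l \in r) ->
  csum phi u t = \sum_(l <- r) phi (t - l.1) * u l.2.
Proof.
move=> ur rL Pr; rewrite /csum (@comb_seq _ _ _ _ _ r)//.
  by apply: eq_bigr => l _ /=; rewrite opprD opprK add0r.
move=> l Ll /=; rewrite opprD opprK add0r mulf_eq0 negb_or => /andP[].
exact: Pr.
Qed.

(** Only [phi] is required to be continuous, since moving [t] does not affect the second coordinate;
    [u] will also be the indicator of a window. *)
Lemma csum_continuous phi u (C : set G) (W : set H) : continuous phi ->
  compact C -> (forall x, phi x != 0 -> C x) ->
  compact W -> (forall h, u h != 0 -> W h) -> (forall h, `|u h| <= 1) ->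
  continuous (csum phi u).
Proof.
move=> cphi cC pC cW uW u1; have [V [nV cV _]] := compact_nbhs0 (proj2 lG).
have V0 : V 0 := nbhs_singleton nV.
pose Q : set (prod_group G H) := [set a - b | a in V & b in C] `*` W.
have cQ : compact Q by apply: compact_setX_group => //; exact: compact_sub.
have [N ND] := @comb_dist R _ _ uL _ cQ.
move=> t; apply/cvgrPdist_le => e e0.
have d0 : 0 < e / N.+1%:R by rewrite divr_gt0.
have nW := compact_support_uniform cphi cC pC d0.
apply: filterS2 (nbhs_shift0 t nV) (nbhs_shift0 t nW) => y Vv Hv.
set v := y - t in Vv Hv.
have -> : y = t + v by rewrite /v addrC subrK.
pose P w (p : prod_group G H) := phi (w - p.1) * u p.2.
have PQ w : V w -> forall p, P w p != 0 -> Q p.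
  move=> Vw p; rewrite mulf_eq0 negb_or => /andP[/pC Cp /uW Wp]; split => //=.
  by exists w => //; exists (w - p.1) => //; rewrite subKr.
have -> : csum phi u (t + v) = comb L (P v) ((- t, 0) : prod_group G H).
  apply: eq_fsbigr => l _; congr (phi _ * _) => /=.
  by rewrite opprD opprK [t + v]addrC [in RHS]opprD opprK addrA.
have -> : csum phi u t = comb L (P 0) ((- t, 0) : prod_group G H).
  by apply: eq_fsbigr => l _; rewrite /P sub0r.
apply: (le_trans (ND (P 0) (P v) (e / N.+1%:R) _ (PQ _ V0) (PQ _ Vv) _)).
  move=> p; rewrite /P -mulrBl normrM -[leRHS]mulr1 ler_pM//.
  by have := Hv (- p.1); rewrite sub0r [v - _]addrC distrC.
rewrite mulrCA ler_piMr ?ltW// ltr_pdivrMr// mul1r ltr_nat//.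
Qed.

Variable F : set (prod_group G H).
Hypothesis fF : fundamental_domain L F.

Lemma comb_prod_ap phi u (C : set G) (W : set H) :
  continuous phi -> continuous u ->
  compact C -> (forall x, phi x != 0 -> C x) ->
  compact W -> (forall h, u h != 0 -> W h) ->
  ap (comb L (fun p : prod_group G H => phi (- p.1) * u p.2)).
Proof.
move=> cphi cu cC pC cW uW; have [_ pF FL] := fF; rewrite precompactE in pF.
have [hX lX] := prod_group_lca lG lH.
apply: (@comb_ap _ _ _ uL _ ([set - c | c in C] `*` W) (closure F)) => //.
- move=> p; apply: cvgM.
    apply: (@continuous_comp _ _ _ (fun p : prod_group G H => - p.1) phi); last exact: cphi.
    apply: (@continuous_comp _ _ _ (fun p : prod_group G H => p.1) -%R); first exact: cvg_fst.
    exact: opp_continuous.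
  by apply: (@continuous_comp _ _ _ (fun p : prod_group G H => p.2) u); [exact: cvg_snd|exact: cu].
- by apply: compact_setX_group => //; exact: compact_opp.
- exact: csum_supp.
- move=> x; have [l [[Ll Fl] _]] := FL x; exists l; split => //; exact: subset_closure.
Qed.

Hypothesis dL : dense [set p.2 | p in L].

(* [G x 0 + L] is dense in [G x H], so averages over the product can be
   replaced by averages over [G]. *)
Lemma csum_ap_mean phi u (C : set G) (W : set H) :
  continuous phi -> continuous u ->
  compact C -> (forall x, phi x != 0 -> C x) ->
  compact W -> (forall h, u h != 0 -> W h) ->
  ap (csum phi u) /\
  mean (csum phi u) = mean (comb L (fun p : prod_group G H => phi (- p.1) * u p.2)).
Proof.
move=> cphi cu cC pC cW uW; have aP := comb_prod_ap cphi cu cC pC cW uW.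
set P := fun p => _ in aP *; have [cP bP] := aP.
pose j (t : G) : prod_group G H := (- t, 0).
have jD x y : j (x + y) = j x + j y.
  by rewrite /j opprD -[in LHS](addr0 0) pair_add.
have cj : continuous j.
  move=> t; apply: (@cvg_pair _ _ _ _ (nbhs (- t)) (nbhs (0 : H))); last exact: cvg_cst.
  exact: opp_continuous.
have aC : ap (csum phi u).
  split; last exact: (bohr_comp jD bP).
  by move=> t; apply: (@continuous_comp _ _ _ j (comb L P)); [exact: cj|exact: cP].
split => //; apply: is_meanE; first by case: aC.
move=> e e0; have e20 : 0 < e / 2 by rewrite divr_gt0.
have [s [s0 sP]] := bohr_is_mean bP e20.
have nU := ap_uniform (0 : prod_group G H) aP e20.
have /choice[g gP] : forall x : prod_group G H, exists g : G, forall z,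
    `|comb L P (j g + z) - comb L P (x + z)| <= e / 2.
  move=> [a b]; have [[V1 V2] /= [nV1 nV2] VU] := nU.
  have nV2' : nbhs b [set h | V2 (h - b)] by exact: nbhs_shift0.
  have [h [/interior_subset Vh [l Ll lh]]] : [set h | V2 (h - b)]° `&` [set p.2 | p in L] !=set0.
    by apply: dL; [exists b|exact: open_interior].
  (* Modulo [L], the point [j (l.1 - a)] equals [(a, l.2)], and [l.2] was chosen close to [b]. *)
  exists (l.1 - a) => z.
  have -> : comb L P (j (l.1 - a) + z) = comb L P (((0, h - b) : prod_group G H) + ((a, b) + z)).
    rewrite -[LHS](comb_periodic P _ sL Ll); congr (comb L P _).
    rewrite addrAC addrA; congr (_ + z).
    rewrite [RHS]/GRing.add/= [LHS]/GRing.add/= /add_pair/= !opprB; congr pair.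
      by rewrite subrK add0r.
    by rewrite add0r subrK.
  have := VU (0, h - b); rewrite /= => /(_ _ ((a, b) + z)); rewrite add0r; apply.
  by split => //=; exact: nbhs_singleton.
exists [seq g x | x <- s]; split; first by rewrite -size_eq0 size_map size_eq0.
move=> t; have := sP (j t).
suff : `|avg [seq g x | x <- s] (csum phi u) t - avg s (comb L P) (j t)| <= e / 2.
  by rewrite !ler_norml; lra.
rewrite /avg size_map big_map -mulrBl -sumrB normrM [X in _ * X]gtr0_norm ?invr_gt0 ?size_gt0R//.
rewrite ler_pdivrMr ?size_gt0R//; apply: (le_trans (ler_norm_sum _ _ _)).
rewrite mulr_natr -[e / 2 *+ _]iter_addr_0 -(count_predT s) -big_const_seq.
apply: ler_sum => x _; have := gP x (j t).
rewrite [csum _ _ _](_ : _ = comb L P (j (t + g x)))// jD [j t + j _]addrC.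
by rewrite [j t + x]addrC.
Qed.

End cut_and_project_sums.

(** * Integrals of lattice sums against weighted point counts *)

Section integral_estimates.
Context {R : realType} {G H : topologicalZmodType}.
Variable L : set (prod_group G H).
Hypotheses (lG : lca_group G) (sL : subgroup L) (uL : uniformly_discrete L).
Variables (theta : {measure set (borel G) -> \bar R}) (A : nat -> set G).
Hypotheses (hG : haar_measure theta) (vA : van_hove_sequence theta A).

Definition cnt n (v : H -> R) : R :=
  comb L (fun p : prod_group G H => \1_(A n) p.1 * v p.2) 0.

Variables (phi : G -> R) (C : set G) (W : set H) (I : R).
Hypotheses (cphi : continuous phi) (phi0 : forall x, 0 <= phi x) (cC : compact C)
  (C0 : C 0) (phiC : forall x, phi x != 0 -> C x) (cW : compact W)
  (phiI : (\int[theta]_x (phi x)%:E)%E = I%:E).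

Let D n := [set a - c | a in closure (A n) & c in C].

Let cD n : compact (D n).
Proof.
have [/(_ n)[_ pA _] _] := vA; rewrite precompactE in pA.
exact: compact_sub.
Qed.

Let AD n x c : A n (x + c) -> C c -> D n x.
Proof.
move=> Ax Cc; exists (x + c); first exact: subset_closure.
by exists c => //; rewrite addrK.
Qed.

Definition near_points n : seq (prod_group G H) :=
  fset_set (points L (D n `*` W : set (prod_group G H)) 0).

Let fnear n : finite_set (points L (D n `*` W : set (prod_group G H)) 0).
Proof. by apply: finite_points => //; exact: compact_setX_group. Qed.

Lemma near_pointsP n l : l \in near_points n <-> [/\ L l, D n l.1 & W l.2].
Proof.
rewrite /near_points in_fset_set// inE /points /= !add0r.
by split => [[Ll [Dl Wl]]|[Ll Dl Wl]].
Qed.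

(** Since [C] contains 0, the patch [l.1 + C] of a point that does not cross lies on the same side
    of [A n] as [l.1]. The integral of [phi (t - l.1)] over [A n] is then exactly [I] or 0. *)
Definition crossing n (l : prod_group G H) : bool :=
  `[< (exists2 c, C c & A n (l.1 + c)) /\ (exists2 c, C c & ~ A n (l.1 + c)) >].

Definition nbd n : nat := count (crossing n) (near_points n).

Variables (v : H -> R).
Hypotheses (v01 : forall h, 0 <= v h <= 1) (vW : forall h, v h != 0 -> W h).

Let v0 h : 0 <= v h. Proof. by case/andP: (v01 h). Qed.

Lemma cntE n : cnt n v = \sum_(l <- near_points n) \1_(A n) l.1 * v l.2.
Proof.
rewrite /cnt (@comb_seq _ _ _ _ _ (near_points n)).
- by apply: eq_bigr => l _; rewrite !add0r.
- exact: fset_uniq.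
- by move=> l /near_pointsP[].
- move=> l Ll; rewrite add0r mulf_eq0 negb_or => /andP[Al /vW Wl].
  apply/near_pointsP; split => //; apply: (@AD _ _ 0) => //.
  by rewrite addr0; apply: contrapT => nA; move: Al; rewrite indicE memNset// eqxx.
Qed.

Let eint n (l : prod_group G H) : \bar R :=
  (\int[theta]_(t in (A n : set (borel G))) (phi (t - l.1))%:E)%E.

Let cphil (a : G) : continuous (fun t => phi (t - a)).
Proof.
move=> t; apply: (@continuous_comp _ _ _ (fun t => t - a) phi); last exact: cphi.
exact: shift_continuous.
Qed.

Let phi_borel a : measurable_fun setT (fun t : borel G => (phi (t - a))%:E).
Proof. by apply/measurable_EFinP; exact: (continuous_borel (@cphil a)). Qed.

Let int_phi a : (\int[theta]_t (phi (t - a))%:E)%E = I%:E.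
Proof.
rewrite -phiI; have m0 : measurable_fun setT (fun t : borel G => (phi t)%:E).
  by apply/measurable_EFinP; exact: (continuous_borel cphi).
by rewrite -(haar_shift_integral hG (- a) m0)// => x; rewrite lee_fin.
Qed.

Let I0 : 0 <= I.
Proof. by rewrite -lee_fin -phiI; apply: integral_ge0 => x _; rewrite lee_fin. Qed.

Let eint_ge0 n l : (0 <= eint n l)%E.
Proof. by apply: integral_ge0 => x _; rewrite lee_fin. Qed.

Let eint_le n l : (eint n l <= I%:E)%E.
Proof.
rewrite -(int_phi l.1); apply: ge0_subset_integral => //.
- exact: van_hove_borel vA n.
- by move=> x _; rewrite lee_fin.
Qed.

Let eint_out n l : ~~ crossing n l -> ~ A n l.1 -> eint n l = 0%E.
Proof.
move=> /asboolPn ncr nA; apply: integral0_eq => t At.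
congr EFin; apply/eqP; apply: contra_notT ncr => /phiC Ct; split.
  by exists (t - l.1) => //; rewrite addrC subrK.
by exists 0 => //; rewrite addr0.
Qed.

Let eint_in n l : ~~ crossing n l -> A n l.1 -> eint n l = I%:E.
Proof.
move=> /asboolPn ncr Al; rewrite -(int_phi l.1) /eint integral_mkcond.
apply: eq_integral => t _; rewrite patchE; case: ifPn => // /negP At.
congr EFin; apply/esym/eqP; apply: contra_notT ncr => /phiC Ct; split.
  by exists 0 => //; rewrite addr0.
exists (t - l.1) => //; rewrite addrC subrK => At'; apply: At; exact: mem_set.
Qed.

Lemma integral_csum n : (\int[theta]_(t in (A n : set (borel G))) (csum L phi v t)%:E =
  \sum_(l <- near_points n) (v l.2)%:E * eint n l)%E.
Proof.
have mA := van_hove_borel vA n.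
have E l : ((v l.2)%:E * eint n l =
    \int[theta]_(t in (A n : set (borel G))) ((v l.2)%:E * (phi (t - l.1))%:E))%E.
  rewrite /eint ge0_integralZl//; [|by move=> x _; rewrite lee_fin|by rewrite lee_fin].
  by apply: measurable_funTS; exact: phi_borel.
under eq_bigr do rewrite E.
rewrite -ge0_integral_sum//.
- apply: eq_integral => t; rewrite inE => At; rewrite sumEFin; congr EFin.
  rewrite (@csum_seq _ _ _ _ _ _ _ (near_points n)).
  + by apply: eq_bigr => l _; rewrite mulrC.
  + exact: fset_uniq.
  + by move=> l /near_pointsP[].
  + move=> l Ll /phiC Ct /vW Wl; apply/near_pointsP; split => //.
    by apply: (AD _ Ct); rewrite addrC subrK.
- move=> l; apply: measurable_funTS; apply: emeasurable_funM => //.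
- by move=> l t _; rewrite mule_ge0 ?lee_fin.
Qed.

Let nbdE n : (nbd n)%:R = \sum_(l <- near_points n) (crossing n l)%:R :> R.
Proof.
rewrite /nbd -sum1_count natr_sum big_mkcond; apply: eq_bigr => l _.
by case: (crossing n l).
Qed.

(** Points that do not cross contribute the same on both sides; each crossing point costs at most
    [I]. *)
Lemma integral_csum_le n :
  (\int[theta]_(t in (A n : set (borel G))) (csum L phi v t)%:E <=
   (I * (cnt n v + (nbd n)%:R))%:E)%E.
Proof.
rewrite integral_csum cntE nbdE -big_split/=.
rewrite mulr_sumr -sumEFin; apply: lee_sum => l _.
have e1 : ((v l.2)%:E * eint n l <= I%:E)%E.
  apply: le_trans (eint_le n l); rewrite -[leRHS]mul1e lee_wpmul2r ?eint_ge0//.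
  by rewrite lee_fin; case/andP: (v01 l.2).
have [cr|cr] := boolP (crossing n l).
  by apply: (le_trans e1); rewrite lee_fin ler_peMr// lerDr mulr_ge0.
rewrite addr0 indicE; have [Al|Al] := pselect (A n l.1).
  by rewrite eint_in// (mem_set Al) mul1r -EFinM mulrC.
by rewrite eint_out// mule0 memNset// mul0r mulr0.
Qed.

Lemma integral_csum_ge n :
  ((I * cnt n v)%:E <=
   \int[theta]_(t in (A n : set (borel G))) (csum L phi v t)%:E + (I * (nbd n)%:R)%:E)%E.
Proof.
rewrite integral_csum cntE nbdE.
rewrite !mulr_sumr -!sumEFin -big_split/=; apply: lee_sum => l _.
have [cr|cr] := boolP (crossing n l).
  rewrite mulr1 -[leLHS]add0e; apply: leeD; first by rewrite mule_ge0 ?lee_fin ?eint_ge0.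
  rewrite lee_fin ler_piMr// indicE; have := v01 l.2.
  by case: (_ \in _); rewrite ?mul1r ?mul0r; lra.
rewrite mulr0 adde0 indicE; have [Al|Al] := pselect (A n l.1).
  by rewrite eint_in// (mem_set Al) mul1r -EFinM mulrC.
by rewrite memNset// mul0r mulr0 mule_ge0 ?lee_fin ?eint_ge0.
Qed.

(** Each point of the translate is joined, by a difference of an element of [C] and one of [V], to a
    point of [l.1 + C] on the other side of [A n]. *)
Lemma crossing_translate n l (V : set G) : crossing n l ->
  translate l.1 V `<=` van_hove_boundary
    ([set c - x | c in C & x in V] `|` [set x - c | x in V & c in C]) (A n).
Proof.
move=> /asboolP[[c Cc Ac] [d Cd nAd]] _ [x Vx <-].
have [Ax|nAx] := pselect (A n (l.1 + x)).
  right; split; apply: subset_closure => //.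
  exists (l.1 + d) => //; exists (d - x); first by left; exists d => //; exists x.
  by rewrite -addrA subKr.
left; split; apply: subset_closure => //.
exists (l.1 + c) => //; exists (x - c); first by right; exists x => //; exists c.
by rewrite -addrA [c + _]addrC subrK.
Qed.

(** Packing: around each crossing point sits a translate of [V] inside the boundary [B], and at most
    [N] of them overlap at any point, so [nbd n * theta V <= N * theta B]. *)
Lemma nbd_small e : 0 < e ->
  \forall n \near \oo, ((nbd n)%:R%:E <= e%:E * theta (A n))%E.
Proof.
move=> e0; have [hG' lcG] := lG; have [V [nV cV clV]] := compact_nbhs0 lcG.
have mV := closed_borel clV.
have fV : theta V \is a fin_num by rewrite ge0_fin_numE// haar_compact.
have V0 : 0 < fine (theta V).
  rewrite fine_gt0// haar_compact// andbT.
  apply: (lt_le_trans (haar_open hG hG' (@open_interior _ V) (ex_intro _ 0 nV))).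
  apply: le_measure; rewrite ?inE//; last exact: interior_subset.
  by apply: open_borel; exact: open_interior.
have cQ : compact ([set - x | x in V] `*` W : set (prod_group G H)).
  by apply: compact_setX_group => //; exact: compact_opp.
have [N NP] := uL cQ.
set K := [set c - x | c in C & x in V] `|` [set x - c | x in V & c in C].
have cK : compact K by apply: compactU; exact: compact_sub.
have d0 : 0 < e * fine (theta V) / N.+1%:R by rewrite divr_gt0// mulr_gt0.
have := van_hove_small hG vA cK d0; apply: filterS => n.
set B := van_hove_boundary K (A n) => HB.
have [a a0 aE] := van_hove_fin hG vA n; rewrite aE in HB *.
have mB : measurable (B : set (borel G)).
  by apply: closed_borel; apply: closedU; apply: closedI; exact: closed_closure.
pose r := [seq l <- near_points n | crossing n l].
have mt (x : G) : measurable_fun setT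
    (fun y : borel G => (\1_(translate x V : set (borel G)) y)%:E : \bar R).
  by apply/measurable_EFinP; apply: measurable_indic; exact: translate_borel.
have key : (((size r)%:R * fine (theta V))%R%:E = \int[theta]_y
    \sum_(l <- r) (\1_(translate l.1 V : set (borel G)) y)%:E)%E.
  rewrite ge0_integral_sum//.
  rewrite (eq_bigr (fun=> (fine (theta V))%:E)) => [|l _]; last first.
    rewrite integral_indic//; last exact: translate_borel.
    by rewrite setIT haar_translate// fineK.
  by rewrite sumEFin big_const_seq count_predT iter_addr_0 mulr_natl.
have le_int : (((size r)%:R * fine (theta V))%R%:E <= N%:R%:E * theta B)%E.
  rewrite key -[B in leRHS]setIT -integral_indic// -ge0_integralZl//; last first.
    by apply/measurable_EFinP; exact: measurable_indic.
  apply: ge0_le_integral => //.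
  - by move=> y _; apply: sume_ge0 => l _; rewrite lee_fin.
  - by apply: emeasurable_sum => l; exact: mt.
  - apply: emeasurable_funM => //; apply/measurable_EFinP; exact: measurable_indic.
  - move=> y _; rewrite sumEFin -EFinM lee_fin [in leRHS]indicE.
    have [By|By] := pselect (B y); last first.
      rewrite big_seq big1 ?mulr_ge0// => l; rewrite mem_filter => /andP[cr _].
      by rewrite indicE memNset// => /(crossing_translate cr).
    rewrite (mem_set By) mulr1.
    pose r' := [seq l <- r | y \in translate l.1 V].
    apply: (@le_trans _ _ (size r')%:R).
      rewrite size_filter -sum1_count natr_sum [leRHS]big_mkcond/=.
      by apply: ler_sum => l _; rewrite indicE; case: (_ \in _).
    rewrite ler_nat; apply: (NP ((- y, 0) : prod_group G H)).
      by rewrite !filter_uniq//; exact: fset_uniq.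
    move=> l; rewrite !mem_filter => /andP[/set_mem[x Vx xy] /andP[_ /near_pointsP[Ll _ Wl]]].
    split => //; split => /=; last by rewrite add0r.
    by exists x => //; rewrite -xy opprD addrAC addNr add0r.
have := le_trans le_int (lee_wpmul2l _ HB); rewrite lee_fin ler0n => /(_ isT).
have -> : size r = nbd n by rewrite size_filter.
rewrite -!EFinM !lee_fin => HN.
have : N%:R * (e * fine (theta V) / N.+1%:R * a) <= e * fine (theta V) * a :> R.
  rewrite mulrA; apply: ler_wpM2r; first exact: ltW.
  rewrite mulrCA; apply: ler_piMr; first by apply: mulr_ge0; exact: ltW.
  by rewrite ler_pdivrMr// mul1r ler_nat.
by move=> /(le_trans HN); rewrite mulrAC ler_pM2r.
Qed.

End integral_estimates.

(** * Dirac combs of model sets *)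

Section dirac_comb_integral.
Context {R : realType} {G : topologicalZmodType}.
Variables (Lambda K : set G) (s : seq G).
Hypotheses (us : uniq s) (sP : forall x, x \in s <-> Lambda x /\ K x).
Local Open Scope ereal_scope.

Lemma dirac_comb_seq (B : set G) : B `<=` K ->
  dirac_comb R G Lambda (B : set (borel G)) = \sum_(x <- s) dirac (x : borel G) (B : set (borel G)).
Proof.
move=> BK; rewrite /dirac_comb.
rewrite (_ : \esum_(x in Lambda) _ =
  \esum_(x in Lambda `&` K) dirac (x : borel G) (B : set (borel G))); last first.
  rewrite esum_mkcondr; apply: eq_esum => x _; case: ifPn => // /negP xK.
  by rewrite /dirac indicE memNset// => /BK /mem_set.
have -> : Lambda `&` K = [set` s] by apply/seteqP; split => x /=; rewrite sP.
by rewrite (esum_fset (finite_seq s))//; exact/esym/fsbig_seq.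
Qed.

Hypothesis mK : measurable (K : set (borel G)).

Lemma ge0_integral_dirac_comb (g : G -> R) : continuous g -> (forall x, (0 <= g x)%R) ->
  (forall x, g x != 0%R -> K x) ->
  \int[dirac_comb R G Lambda]_x (g x)%:E = (\sum_(x <- s) g x)%R%:E.
Proof.
move=> cg g0 gK.
have mg : measurable_fun setT (fun x : borel G => (g x)%:E).
  by apply/measurable_EFinP; exact: continuous_borel.
have mgK : measurable_fun (K : set (borel G)) (fun x : borel G => (g x)%:E).
  exact: measurable_funTS.
transitivity (\int[dirac_comb R G Lambda]_(x in (K : set (borel G))) (g x)%:E).
  rewrite [RHS]integral_mkcond; apply: eq_integral => x _; rewrite patchE.
  by case: ifPn => // /negP xK; congr EFin; apply/eqP; apply: contra_notT xK => /gK /mem_set.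
(* On subsets of [K] the comb agrees with a finite sum of Dirac measures, for which the integral is
   explicit. *)
pose m_ n : {measure set (borel G) -> \bar R} := dirac (nth 0%R s n : borel G).
rewrite (eq_measure_integral (msum m_ (size s))); last first.
  move=> B mB BK; apply: (etrans (dirac_comb_seq BK)).
  by rewrite (big_nth 0%R) big_mkord.
rewrite ge0_integral_measure_sum//; last by move=> x _; rewrite lee_fin.
rewrite (big_nth 0%R) big_mkord -sumEFin; apply: eq_bigr => i _.
rewrite /m_ integral_dirac// diracE mem_set ?mul1e//.
have /sP[] // : nth 0%R s i \in s by exact: mem_nth.
Qed.

Lemma Rintegral_dirac_comb (g : G -> R) : continuous g -> (forall x, g x != 0%R -> K x) ->
  Rintegral (dirac_comb R G Lambda) setT (g : borel G -> R) = (\sum_(x <- s) g x)%R.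
Proof.
move=> cg gK.
pose gp x := Num.max (g x) 0%R; pose gn x := Num.max (- g x)%R 0%R.
have cgp : continuous gp.
  by move=> x; apply: (@continuous_max R G g (fun=> 0%R)); [exact: cg|exact: cvg_cst].
have cgn : continuous gn.
  move=> x; apply: (@continuous_max R G (fun x => - g x)%R (fun=> 0%R)); last exact: cvg_cst.
  by apply: cvgN; exact: cg.
have gp0 x : (0 <= gp x)%R by rewrite le_max lexx orbT.
have gn0 x : (0 <= gn x)%R by rewrite le_max lexx orbT.
have gpK x : gp x != 0%R -> K x.
  by rewrite /gp; have [->|/gK//] := eqVneq (g x) 0%R; rewrite maxxx eqxx.
have gnK x : gn x != 0%R -> K x.
  by rewrite /gn; have [->|/gK//] := eqVneq (g x) 0%R; rewrite oppr0 maxxx eqxx.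
rewrite /Rintegral integralE.
have -> : \int[dirac_comb R G Lambda]_x (fun x : borel G => (g x)%:E)^\+ x =
    \int[dirac_comb R G Lambda]_x (gp x)%:E.
  by apply: eq_integral => x _; rewrite funeposE EFin_max.
have -> : \int[dirac_comb R G Lambda]_x (fun x : borel G => (g x)%:E)^\- x =
    \int[dirac_comb R G Lambda]_x (gn x)%:E.
  by apply: eq_integral => x _; rewrite funenegE EFin_max.
rewrite !ge0_integral_dirac_comb// -EFinB/= -sumrB; apply: eq_bigr => x _.
by rewrite /gp /gn; case: (lerP (g x) 0) => g0; case: (lerP (- g x)%R 0%R) => g1; lra.
Qed.

End dirac_comb_integral.

Section model_sets.
Context {R : realType} {G H : topologicalZmodType}.
Variables (L : set (prod_group G H)) (W : set H).
Hypotheses (lG : lca_group G) (uL : uniformly_discrete L) (cW : compact W).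
Hypothesis iL : {in L &, injective (fst : prod_group G H -> G)}.

Lemma model_setP x : model_set L W x <-> exists2 l, L l /\ W l.2 & l.1 = x.
Proof.
have star l : L l -> star_map L l.1 = l.2.
  move=> Ll; have := @xgetPex _ 0 [set h | L (l.1, h)].
  rewrite -/(star_map L l.1) => /(_ (ex_intro _ l.2 _)); case: l Ll => a b /= Ll /(_ Ll) La.
  by have := @iL (a, star_map L a) (a, b) (mem_set La) (mem_set Ll) erefl => -[].
split; first by move=> [[l Ll <-]]; rewrite star// => Wl; exists l.
by move=> [l [Ll Wl] <-]; split; [exists l|rewrite star].
Qed.

Definition model_seq (K : set G) (t : G) : seq G :=
  [seq l.1 | l <- fset_set (points L (K `*` W : set (prod_group G H)) ((- t, 0) : prod_group G H))].

Let fpts (K : set G) t : compact K ->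
  finite_set (points L (K `*` W : set (prod_group G H)) ((- t, 0) : prod_group G H)).
Proof. by move=> cK; apply: finite_points => //; exact: compact_setX_group. Qed.

Lemma mem_points (K : set G) t l : compact K ->
  l \in fset_set (points L (K `*` W : set (prod_group G H)) ((- t, 0) : prod_group G H)) <->
  [/\ L l, K (l.1 - t) & W l.2].
Proof.
move=> cK; rewrite in_fset_set; last exact: fpts.
rewrite inE /points/= add0r [- t + _]addrC.
by split => [[Ll [Dl Wl]]|[Ll Dl Wl]].
Qed.

Lemma model_seqP (K : set G) t x : compact K ->
  x \in model_seq K t <-> model_set L W x /\ K (x - t).
Proof.
move=> cK; split.
  move=> /mapP[l /(mem_points _ _ cK)[Ll Kl Wl] ->]; split => //.
  by apply/model_setP; exists l.
move=> [/model_setP[l [Ll Wl] <-] Kl]; apply/mapP; exists l => //.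
exact/(mem_points _ _ cK).
Qed.

Lemma model_seq_uniq (K : set G) t : compact K -> uniq (model_seq K t).
Proof.
move=> cK; rewrite map_inj_in_uniq; first exact: fset_uniq.
move=> l m /(mem_points _ _ cK)[Ll _ _] /(mem_points _ _ cK)[Lm _ _].
by apply: iL; exact: mem_set.
Qed.

(** Points of the model set in [t + V] lift injectively to lattice points in a translate of
    [closure V] times [W], whose number is bounded independently of [t]. *)
Lemma model_set_translation_bounded : translation_bounded (dirac_comb R G (model_set L W)).
Proof.
move=> V _ oV pV; rewrite precompactE in pV.
have [N NP] := uL (compact_setX_group pV cW).
apply: (@le_lt_trans _ _ N%:R%:E); last exact: ltry.
apply: ge_ereal_sup => _ [t _ <-].
have BE : dirac_comb R G (model_set L W) (translate t V : set (borel G)) =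
    (\sum_(x <- model_seq (closure V) t) dirac (x : borel G) (translate t V : set (borel G)))%E.
  apply: (@dirac_comb_seq _ _ _ (translate t (closure V))).
  - exact: model_seq_uniq.
  - move=> x; rewrite model_seqP//; split => -[mx Kx]; split => //.
      by exists (x - t) => //; rewrite addrC subrK.
    by case: Kx => y Vy <-; rewrite addrAC subrr add0r.
  - by move=> _ [x Vx <-]; exists x => //; exact: subset_closure.
apply: (@le_trans _ _ (\sum_(x <- model_seq (closure V) t)
    dirac (x : borel G) (translate t V : set (borel G)))%E).
  by rewrite -BE.
apply: (@le_trans _ _ (\sum_(x <- model_seq (closure V) t) 1)%E).
  by apply: lee_sum => x _; rewrite diracE; case: (_ \in _).
rewrite sumEFin lee_fin big_const_seq count_predT iter_addr_0 ler_nat.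
rewrite size_map; apply: (NP ((- t, 0) : prod_group G H)); first exact: fset_uniq.
by move=> l; rewrite in_fset_set ?inE//; exact: fpts.
Qed.

Lemma Rintegral_model_set (phi : G -> R) C t : continuous phi -> compact C ->
  (forall x, phi x != 0 -> C x) ->
  Rintegral (dirac_comb R G (model_set L W)) setT (fun s : borel G => phi (t - s)) =
  csum L phi (\1_W) t.
Proof.
move=> cphi cC pC; have [hG _] := lG.
have cNC := compact_opp cC; set K := [set - c | c in C] in cNC.
have cK : compact (translate t K) by exact: compact_translate.
rewrite (@Rintegral_dirac_comb _ _ _ (translate t K) (model_seq K t)).
- rewrite (@csum_seq _ _ _ _ _ _ _
    (fset_set (points L (K `*` W : set (prod_group G H)) ((- t, 0) : prod_group G H)))).
  + rewrite big_map big_seq [RHS]big_seq; apply: eq_bigr => l /(mem_points _ _ cNC)[_ _ Wl].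
    by rewrite indicE mem_set// mulr1.
  + exact: fset_uniq.
  + by move=> l /(mem_points _ _ cNC)[].
  + move=> l Ll /pC Cl Wl; apply/(mem_points _ _ cNC); split => //.
      by exists (t - l.1) => //; rewrite opprB.
    by apply: contrapT => nW; move: Wl; rewrite indicE memNset// eqxx.
- exact: model_seq_uniq.
- move=> x; rewrite model_seqP//; split => -[mx Kx]; split => //.
    by exists (x - t) => //; rewrite addrC subrK.
  by case: Kx => y Vy <-; rewrite addrAC subrr add0r.
- exact: compact_borel.
- move=> x; apply: (@continuous_comp _ _ _ (fun s => t - s) phi); last exact: cphi.
  have -> : (fun s => t - s) = (fun s => s + t) \o -%R by apply/funext => s /=; rewrite addrC.
  by apply: continuous_comp; [exact: opp_continuous|exact: shift_continuous].
- move=> x /pC Cx; exists (x - t); last by rewrite addrC subrK.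
  by exists (t - x) => //; rewrite opprB.
Qed.

Variables (theta : {measure set (borel G) -> \bar R}) (A : nat -> set G).
Hypothesis vA : van_hove_sequence theta A.

Lemma counting_model_set n :
  counting (model_set L W `&` A n) = (cnt L A n (\1_W : H -> R))%:E.
Proof.
have [/(_ n)[oA pA _] _] := vA; rewrite precompactE in pA.
pose r := fset_set (points L (closure (A n) `*` W : set (prod_group G H))
  ((- 0, 0) : prod_group G H)).
pose s := [seq l.1 | l <- [seq l <- r | l.1 \in A n]].
have us : uniq s.
  rewrite map_inj_in_uniq; first by rewrite filter_uniq//; exact: fset_uniq.
  move=> l m; rewrite !mem_filter => /andP[_ /(mem_points _ _ pA)[Ll _ _]].
  by move=> /andP[_ /(mem_points _ _ pA)[Lm _ _]]; apply: iL; exact: mem_set.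
have sE : model_set L W `&` A n = [set` s].
  apply/seteqP; split => [x [/model_setP[l [Ll Wl] <-] Al]|x /=].
    apply/mapP; exists l => //; rewrite mem_filter mem_set//=.
    by apply/(mem_points _ _ pA); split => //; rewrite subr0; exact: subset_closure.
  move=> /mapP[l]; rewrite mem_filter => /andP[/set_mem Al /(mem_points _ _ pA)[Ll _ Wl]] ->.
  by split => //; apply/model_setP; exists l.
have fs : finite_set (model_set L W `&` A n) by rewrite sE; exact: finite_seq.
rewrite /counting asboolT//; congr EFin.
have -> : #|` fset_set (model_set L W `&` A n)| = size s.
  apply: perm_size; apply: uniq_perm; [exact: fset_uniq|exact: us|].
  by move=> x; rewrite in_fset_set// sE; apply/idP/idP => [/set_mem|/mem_set].
rewrite size_map size_filter -sum1_count natr_sum big_mkcond/=.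
rewrite /cnt (@comb_seq _ _ _ _ _ r).
- rewrite big_seq [RHS]big_seq; apply: eq_bigr => l /(mem_points _ _ pA)[_ _ Wl].
  by rewrite !add0r !indicE (mem_set Wl) mulr1; case: (_ \in _).
- exact: fset_uniq.
- by move=> l /(mem_points _ _ pA)[].
- move=> l Ll; rewrite !add0r mulf_eq0 negb_or !indicE => /andP[Al Wl].
  apply/(mem_points _ _ pA); split => //.
    rewrite subr0; apply: subset_closure; apply: contrapT => nA.
    by move: Al; rewrite memNset// eqxx.
  by apply: contrapT => nW; move: Wl; rewrite memNset// eqxx.
Qed.

End model_sets.

Section haar_bump.
Context {R : realType} {X : topologicalZmodType}.
Variable (mu : {measure set (borel X) -> \bar R}).
Hypotheses (hmu : haar_measure mu) (lX : lca_group X).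

Lemma haar_compact_fin K : compact K -> mu K = (fine (mu K))%:E.
Proof. by move=> cK; rewrite fineK// ge0_fin_numE// (haar_compact hmu). Qed.

Lemma le_haar (A B : set X) : measurable (A : set (borel X)) ->
  measurable (B : set (borel X)) -> A `<=` B -> (mu A <= mu B)%E.
Proof. by move=> mA mB AB; apply: le_measure; rewrite ?inE. Qed.

Lemma bump_haar (K : set X) e : compact K -> 0 < e -> exists (h : X -> R) (C : set X),
  [/\ continuous h, forall x, 0 <= h x <= 1 & forall x, K x -> h x = 1] /\
  [/\ compact C, forall x, h x != 0 -> C x & fine (mu C) <= fine (mu K) + e].
Proof.
move=> cK e0; have [hX _] := lX; have mK := compact_borel hX cK.
have [_ _ _ outer _] := hmu.
have fK : mu K \is a fin_num by rewrite ge0_fin_numE// (haar_compact hmu).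
have [U [oU KU] Ue] : exists2 U : set X, open U /\ K `<=` U & (mu U < mu K + e%:E)%E.
  have := outer _ mK => E.
  have [|_ [U [oU KU] <-] Ue] := @lb_ereal_inf_adherent R
    [set mu U | U in [set U : set X | open U /\ K `<=` U]] e e0.
    by rewrite -E.
  by exists U => //; rewrite E.
have [h [ch h01 h1 [C [cC CU hC]]]] := bump_function (R := R) lX cK oU KU.
exists h, C; split; split => //.
rewrite -lee_fin EFinD (fineK fK) -haar_compact_fin//.
apply: le_trans (ltW Ue); apply: le_haar => //; first exact: compact_borel.
exact: open_borel.
Qed.

Lemma integral_compact_fin (phi : X -> R) (C : set X) : continuous phi ->
  (forall x, 0 <= phi x) -> compact C -> (forall x, phi x != 0 -> C x) ->
  (\int[mu]_x (phi x)%:E)%E \is a fin_num.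
Proof.
move=> cphi phi0 cC pC; have [hX _] := lX.
have mC := compact_borel hX cC.
have mphi : measurable_fun setT (fun x : borel X => (phi x)%:E).
  by apply/measurable_EFinP; exact: continuous_borel.
have [B phiB] : exists B, forall x, phi x <= B.
  have cpC : compact [set phi x | x in C].
    by apply: continuous_compact => //; exact: continuous_subspaceT.
  have [M [_ MB]] := compact_bounded cpC.
  exists (`|M| + 1) => x; have [->|/pC Cx] := eqVneq (phi x) 0.
    by rewrite addr_ge0.
  rewrite (le_trans (ler_norm _))//; apply: (MB (`|M| + 1)); last by exists x.
  by rewrite (le_lt_trans (ler_norm _))// ltrDl.
rewrite ge0_fin_numE; last by apply: integral_ge0 => x _; rewrite lee_fin.
have B0 : 0 <= B by rewrite (le_trans (phi0 0)).
apply: (@le_lt_trans _ _ (B%:E * mu C)%E).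
  rewrite -[C in leRHS]setIT -integral_indic// -ge0_integralZl//; last first.
    by apply/measurable_EFinP; exact: measurable_indic.
  apply: ge0_le_integral => //.
  - by move=> x _; rewrite lee_fin.
  - apply: emeasurable_funM => //; apply/measurable_EFinP; exact: measurable_indic.
  - move=> x _; rewrite -EFinM lee_fin; have [->|/pC Cx] := eqVneq (phi x) 0.
      by rewrite mulr_ge0.
    by rewrite indicE mem_set// mulr1.
by rewrite haar_compact_fin// -EFinM ltry.
Qed.

End haar_bump.

(** * Maximal density and approximation of the window *)

Section weak_model_set_approximation.
Context {R : realType} {G H : topologicalZmodType}.
Variables (L : set (prod_group G H)) (W : set H) (F : set (prod_group G H)).
Variables (theta : {measure set (borel G) -> \bar R})
  (thetaH : {measure set (borel H) -> \bar R})
  (thetaGH : {measure set (borel (prod_group G H)) -> \bar R}) (A : nat -> set G).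
Hypotheses (lG : lca_group G) (lH : lca_group H) (sL : subgroup L)
  (uL : uniformly_discrete L) (cW : compact W)
  (iL : {in L &, injective (fst : prod_group G H -> G)})
  (dL : dense [set p.2 | p in L]) (fF : fundamental_domain L F).
Hypotheses (hG : haar_measure theta) (hH : haar_measure thetaH)
  (hGH : product_haar_measure theta thetaH thetaGH) (vA : van_hove_sequence theta A).
Hypothesis maxd : ((fun m => counting (model_set L W `&` A m) / theta (A m)) @ \oo
  --> (thetaGH F)^-1 * thetaH W)%E.

(** Maximal density read as a lower bound; the opposite bound, for the continuous majorant [om],
    comes from the mean of its lattice sum. *)
Lemma counting_lower e : 0 < e -> exists2 r, 0 < r & thetaGH F = r%:E /\
  \forall n \near \oo,
    ((fine (thetaH W) / r - e)%:E * theta (A n) <= (cnt L A n (\1_W : H -> R))%:E)%E.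
Proof.
move=> e0; have [hX lX] := prod_group_lca lG lH.
have [r r0 rE] := fundamental_domain_fin (proj1 hGH) hX lX uL fF.
exists r => //; split => //; move: maxd; rewrite rE inver gt_eqF//.
rewrite (haar_compact_fin hH cW) -EFinM mulrC => cv.
have N0 : nbhs ((fine (thetaH W) / r)%:E : \bar R)
    [set x | ((fine (thetaH W) / r - e)%:E < x)%E].
  apply: open_nbhs_nbhs; split; first exact: open_ereal_gt_ereal.
  by rewrite /= lte_fin ltrBlDr ltrDl.
have : \forall n \near \oo, ((fine (thetaH W) / r - e)%:E <
    counting (model_set L W `&` A n) / theta (A n))%E := cv _ N0.
apply: filterS => n; rewrite (counting_model_set uL cW iL vA).
have [a a0 ->] := van_hove_fin hG vA n.
by rewrite inver gt_eqF// => /ltW; rewrite lee_pdivlMr.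
Qed.

(** An auxiliary bump [phi], close to the indicator of a compact [K] in [G], converts the count
    weighted by [om] into an integral over [A n]; its own integral [J] cancels in the end. *)
Lemma window_approx eps : 0 < eps -> exists (om : H -> R) (W' : set H),
  [/\ continuous om, compact W', forall h, 0 <= om h - \1_W h <= 1,
    forall h, om h != 0 -> W' h & W `<=` W'] /\
  \forall n \near \oo, ((cnt L A n (fun h => om h - \1_W h))%:E <= eps%:E * theta (A n))%E.
Proof.
move=> eps0.
have [r r0 [rE _]] := counting_lower ltr01.
set w := fine (thetaH W); have w0 : 0 <= w by exact: fine_ge0.
(* For [d <= 1], [((1 + d) * (w + d) - w) / r <= d * (w + 2) / r]; three more terms [d] come from
   the van Hove average, the crossing points and the lower count. *)
pose M := (w + 2) / r + 3.
have M0 : 0 < M by rewrite ltr_wpDl// divr_ge0// ?addr_ge0// ltW.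
pose d := Num.min 1 (eps / M).
have d0 : 0 < d by rewrite lt_min ltr01 divr_gt0.
have d1 : d <= 1 by rewrite ge_min lexx.
have dM : d * M <= eps by rewrite -ler_pdivlMr// ge_min lexx orbT.
have [om [W' [[com om01 om1] [cW' omW' W'd]]]] := bump_haar hH lH cW d0.
have omW h : 0 <= om h - \1_W h <= 1.
  have := om01 h; rewrite indicE; have [Wh|Wh] := pselect (W h).
    by move=> _; rewrite mem_set// om1// subrr lexx ler01.
  by rewrite memNset// subr0.
have WW' : W `<=` W' by move=> h /om1 h1; apply: omW'; rewrite h1 oner_eq0.
exists om, W'; split => //.
have [V [nV cV clV]] := compact_nbhs0 (proj2 lG).
(* [K] is symmetric so that [phi], the reflection of [h], is 1 on [K] as well: [J] is then at least
   [k], while the measure of [C] is at most [(1 + d) * k]. *)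
pose K := V `|` [set - x | x in V].
have cK : compact K by apply: compactU => //; exact: compact_opp.
have KN x : K x -> K (- x).
  by move=> [Vx|[y Vy <-]]; [right; exists x|left; rewrite opprK].
have K0 : K 0 by left; exact: nbhs_singleton.
have mK := compact_borel (proj1 lG) cK.
set k := fine (theta K).
have k0 : 0 < k.
  rewrite fine_gt0// (haar_compact hG)// andbT.
  apply: (lt_le_trans (haar_open hG (proj1 lG) (@open_interior _ V) (ex_intro _ 0 nV))).
  apply: le_haar => //; first by apply: open_borel; exact: open_interior.
  by move=> x /interior_subset Vx; left.
have dk0 : 0 < d * k by rewrite mulr_gt0.
have [h [C [[ch h01 h1] [cC hC Cd]]]] := bump_haar hG lG cK dk0.
pose phi x := h (- x).
have cphi : continuous phi.
  move=> x; apply: (@continuous_comp _ _ _ -%R h); last exact: ch.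
  exact: opp_continuous.
have phi0 x : 0 <= phi x by case/andP: (h01 (- x)).
have cNC := compact_opp cC; set NC := [set - x | x in C] in cNC.
have phiC x : phi x != 0 -> NC x by move=> /hC Cx; exists (- x); rewrite ?opprK.
have NC0 : NC 0 by apply: phiC; rewrite /phi oppr0 h1// oner_eq0.
have fI := integral_compact_fin hG lG cphi phi0 cNC phiC.
set J := fine (\int[theta]_x (phi x)%:E)%E.
have JE : (\int[theta]_x (phi x)%:E)%E = J%:E by rewrite fineK.
have kJ : k <= J.
  rewrite -lee_fin -JE -haar_compact_fin// -[K in leLHS]setIT -integral_indic//.
  apply: ge0_le_integral => //.
  - by apply/measurable_EFinP; exact: measurable_indic.
  - by apply/measurable_EFinP; exact: continuous_borel.
  - move=> x _; rewrite lee_fin indicE; have [Kx|Kx] := pselect (K x).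
      by rewrite mem_set// /phi h1//; exact: KN.
    by rewrite memNset.
have om0 x : 0 <= om x <= 1 by exact: om01.
have [aC mC] := csum_ap_mean lG lH sL uL fF dL cphi com cNC phiC cW' omW'.
have csum0 t : 0 <= csum L phi om t.
  rewrite /csum (combE uL _ (compact_setX_group (compact_opp cNC) cW')); last first.
    exact: csum_supp.
  by apply: sumr_ge0 => l _; rewrite mulr_ge0//; case/andP: (om01 ((- t, 0 : H) + l).2).
have meanle : mean (csum L phi om) * r <= (1 + d) * k * (w + d).
  have [hX lX] := prod_group_lca lG lH.
  have cQ := compact_setX_group cC cW'.
  have aP := comb_prod_ap lG lH sL uL fF cphi com cNC phiC cW' omW'.
  have P01 (p : prod_group G H) : 0 <= phi (- p.1) * om p.2 <= 1.
    have /andP[p3 p4] := om01 p.2; have := h01 (- - p.1); rewrite -/(phi (- p.1)).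
    by move=> /andP[p1 p2]; rewrite mulr_ge0// mulr_ile1.
  have PQ (p : prod_group G H) : phi (- p.1) * om p.2 != 0 -> (C `*` W') p.
    by rewrite mulf_eq0 negb_or /phi opprK => /andP[/hC Cp /omW' Wp].
  have := mean_comb_le (proj1 hGH) hX lX uL fF cQ aP P01 PQ.
  rewrite -mC rE (proj2 hGH _ _ cC cW') (haar_compact_fin hG cC) (haar_compact_fin hH cW').
  rewrite -!EFinM lee_fin => H1; apply: (le_trans H1); apply: ler_pM.
  - by apply: fine_ge0.
  - by apply: fine_ge0.
  - by rewrite mulrDl mul1r.
  - exact: W'd.
have [r' r'0 [r'E low]] := counting_lower d0.
have {r'E}rr : r' = r by move: r'E; rewrite rE => -[].
rewrite {r' r'0}rr in low.
have N1 := van_hove_mean hG vA aC csum0 dk0.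
have N2 := nbd_small lG uL hG vA cNC cW' d0.
near=> n.
have [a a0 aE] := van_hove_fin hG vA n.
have vW' g : om g - \1_W g != 0 -> W' g.
  have [->|/omW'//] := eqVneq (om g) 0; rewrite sub0r oppr_eq0 indicE.
  have [Wg _|Wg] := pselect (W g); first exact: WW'.
  by rewrite memNset// eqxx.
have E1 : cnt L A n (fun h => om h - \1_W h) = cnt L A n om - cnt L A n (\1_W).
  have [/(_ n)[_ pA _] _] := vA; rewrite precompactE in pA.
  rewrite /cnt -(combB uL _ (compact_setX_group pA cW')).
  - by apply: eq_fsbigr => l _; rewrite mulrBr.
  - move=> p; rewrite mulf_eq0 negb_or indicE => /andP[Ap /omW' Wp]; split => //=.
    by apply: subset_closure; apply: contrapT => nA; move: Ap; rewrite memNset// eqxx.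
  - move=> p; rewrite mulf_eq0 negb_or !indicE => /andP[Ap Wp]; split => //=.
      by apply: subset_closure; apply: contrapT => nA; move: Ap; rewrite memNset// eqxx.
    by apply: WW'; apply: contrapT => nA; move: Wp; rewrite memNset// eqxx.
have H1 := integral_csum_ge uL hG vA cphi phi0 cNC NC0 phiC cW' JE om01 omW' n.
have H2 : (\int[theta]_(x in (A n : set (borel G))) (csum L phi om x)%:E <=
    (mean (csum L phi om) + d * k)%:E * theta (A n))%E by near: n.
have H3 : ((nbd L A NC W' n)%:R%:E <= d%:E * theta (A n))%E by near: n.
have H4 : ((w / r - d)%:E * theta (A n) <= (cnt L A n (\1_W : H -> R))%:E)%E by near: n.
rewrite aE -EFinM in H2 H3 H4 *; rewrite -?EFinM !lee_fin in H3 H4 *.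
have {H1 H2} := le_trans H1 (leeD2r _ H2); rewrite -EFinD lee_fin => H5.
set N := (nbd _ _ _ _ _)%:R in H3 H5.
have m1 : mean (csum L phi om) <= (1 + d) * k * (w + d) / r by rewrite ler_pdivlMr.
set m := mean _ in m1 H5.
have J0 : 0 < J by exact: lt_le_trans kJ.
(* [k * X] bounds the mean together with its error [d * k]; as [k <= J], it may be replaced by
   [J * X] and the factor [J] cancelled. *)
set X := (1 + d) * (w + d) / r + d.
have X0 : 0 <= X by rewrite /X addr_ge0 ?divr_ge0 ?mulr_ge0 ?addr_ge0// ltW.
have H6 : J * cnt L A n om <= J * (X * a + d * a).
  apply: (le_trans H5); rewrite mulrDr; apply: lerD; last by rewrite ler_pM2l.
  apply: (@le_trans _ _ (k * X * a)); last by rewrite -!mulrA ler_wpM2r// mulr_ge0// ltW.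
  rewrite ler_pM2r// /X mulrDr [k * d]mulrC lerD2r; apply: (le_trans m1).
  by rewrite le_eqVlt; apply/orP; left; apply/eqP; ring.
rewrite ler_pM2l// in H6.
rewrite E1; have : (X + d + d - w / r) * a <= eps * a.
  rewrite ler_pM2r//; apply: le_trans dM; rewrite /X /M.
  have ri : 0 < r^-1 by rewrite invr_gt0.
  have : d * d * r^-1 <= d * r^-1 by rewrite ler_pM2r// ler_piMr// ltW.
  move: (r^-1) => q; nra.
move: H4 H6.
move: (X) (w / r) (cnt _ _ _ om) (cnt _ _ _ \1_W) => c0 c1 c2 c3.
by rewrite !mulrBl !mulrDl; lra.
Unshelve. all: by end_near.
Qed.

(** The sum for [om] is approximated by a trigonometric sum, and the error made in the window is
    controlled by counting with the weight [om - \1_W], with [|phi|] in the place of [phi]. *)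
Lemma model_set_trigsum_approx (phi : G -> R) (C : set G) eps : continuous phi ->
  compact C -> (forall x, phi x != 0 -> C x) -> 0 < eps ->
  exists s, (forall p, p \in s -> character p.1.2 p.2) /\
  \forall n \near \oo, (\int[theta]_(t in (A n : set (borel G)))
    (`|csum L phi (\1_W : H -> R) t - trigsum s t|)%:E <= eps%:E * theta (A n))%E.
Proof.
(* The point 0 is added because the estimates with crossing points need it in the support set. *)
move=> cphi cC0 pC0 eps0; pose C1 := C `|` [set 0].
have cC : compact C1 by apply: compactU => //; exact: compact_set1.
have pC x : phi x != 0 -> C1 x by move=> /pC0; left.
have C10 : C1 0 by right.
pose psi x := `|phi x|.
have cpsi : continuous psi.
  by move=> x; apply: continuous_comp; [exact: cphi|exact: norm_continuous].
have psi0 x : 0 <= psi x by exact: normr_ge0.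
have psiC x : psi x != 0 -> C1 x by rewrite normr_eq0; exact: pC.
have fI := integral_compact_fin hG lG cpsi psi0 cC psiC.
set J := fine (\int[theta]_x (psi x)%:E)%E.
have JE : (\int[theta]_x (psi x)%:E)%E = J%:E by rewrite fineK.
have J0 : 0 <= J by apply: fine_ge0; apply: integral_ge0 => x _; rewrite lee_fin.
(* The weighted count and the crossing points each cost [J * d], in all at most [eps / 2]; adding 1
   to [J] covers the case [J = 0]. *)
pose d := eps / (4 * (J + 1)).
have J1 : 0 < J + 1 by rewrite ltr_wpDl.
have d0 : 0 < d by rewrite divr_gt0// mulr_gt0.
have Jd : J * (d + d) <= eps / 2.
  have -> : eps / 2 = (J + 1) * (d + d) by rewrite /d; field; rewrite gt_eqF.
  by rewrite ler_wpM2r ?lerDl// addr_ge0// ltW.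
have [om [W' [[com cW' omW omW' WW'] cntv]]] :=
  window_approx d0.
pose v h := om h - \1_W h.
have vW' g : v g != 0 -> W' g.
  have [g0|/omW'//] := eqVneq (om g) 0; rewrite /v g0 sub0r oppr_eq0 indicE.
  have [Wg _|Wg] := pselect (W g); first exact: WW'.
  by rewrite memNset// eqxx.
have WW0 g : (\1_W g : R) != 0 -> W' g.
  rewrite indicE; have [Wg _|Wg] := pselect (W g); first exact: WW'.
  by rewrite memNset// eqxx.
have [aC _] := csum_ap_mean lG lH sL uL fF dL cphi com cC pC cW' omW'.
have eps4 : 0 < eps / 4 by rewrite divr_gt0.
have [s [sc sm]] := ap_trigsum aC eps4.
exists s; split => //.
pose g t := `|csum L phi om t - trigsum s t|.
have ag : ap g by apply: ap_norm; apply: apD => //; apply: apN; exact: trigsum_ap.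
have cg : continuous g by case: ag.
have g0 t : 0 <= g t by exact: normr_ge0.
have N1 := van_hove_mean hG vA ag g0 eps4.
have N2 := nbd_small lG uL hG vA cC cW' d0.
have v1 h : `|v h| <= 1 by have /andP[? ?] := omW h; rewrite ger0_norm.
have cv : continuous (csum L psi v) := csum_continuous lG uL cpsi cC psiC cW' vW' v1.
have cQ := compact_setX_group (compact_opp cC) cW'.
have pw t : `|csum L phi (\1_W : H -> R) t - trigsum s t| <= csum L psi v t + g t.
  have E : csum L phi v t = csum L phi om t - csum L phi (\1_W : H -> R) t.
    rewrite /csum -(combB uL _ cQ (csum_supp pC omW') (csum_supp pC WW0)).
    by apply: eq_fsbigr => l _; rewrite mulrBr.
  have N : `|csum L phi v t| <= csum L psi v t.
    apply: (le_trans (comb_norm uL _ cQ (csum_supp pC vW'))).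
    rewrite le_eqVlt; apply/orP; left; apply/eqP; apply: eq_fsbigr => l _.
    by rewrite normrM [X in _ * X]ger0_norm//; case/andP: (omW ((- t, 0 : H) + l).2).
  have -> : csum L phi (\1_W : H -> R) t - trigsum s t =
      (csum L phi om t - trigsum s t) - csum L phi v t by rewrite E; ring.
  by apply: (le_trans (ler_normB _ _)); rewrite addrC lerD2r.
have cf : continuous (fun t => `|csum L phi (\1_W : H -> R) t - trigsum s t|).
  move=> t; apply: (@continuous_comp _ _ _
    (fun t => csum L phi (\1_W : H -> R) t - trigsum s t) (fun x : R => `|x|)).
    apply: cvgB; last by case: (trigsum_ap sc) => + _; exact.
    apply: (csum_continuous lG uL cphi cC pC cW' WW0) => h.
    by rewrite indicE; case: (_ \in _); rewrite ?normr1 ?normr0.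
  exact: norm_continuous.
near=> n.
have [a a0 aE] := van_hove_fin hG vA n.
have mA := van_hove_borel vA n.
have psv0 t : 0 <= csum L psi v t.
  have := comb_norm uL ((- t, 0) : prod_group G H) cQ (csum_supp psiC vW').
  move=> /(le_trans (normr_ge0 _)) H0; apply: (le_trans H0).
  rewrite le_eqVlt; apply/orP; left; apply/eqP; apply: eq_fsbigr => l _.
  by rewrite ger0_norm// mulr_ge0//; case/andP: (omW ((- t, 0 : H) + l).2).
apply: (@le_trans _ _ (\int[theta]_(t in (A n : set (borel G)))
    ((csum L psi v t)%:E + (g t)%:E))%E).
  apply: ge0_le_integral => //.
  - apply: measurable_funTS; apply/measurable_EFinP; exact: continuous_borel.
  - apply: emeasurable_funD; apply: measurable_funTS; apply/measurable_EFinP;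
      exact: continuous_borel.
  - by move=> t _; rewrite -EFinD lee_fin.
rewrite ge0_integralD//; first last.
- by apply: measurable_funTS; apply/measurable_EFinP; exact: continuous_borel.
- by move=> t _; rewrite lee_fin.
- by apply: measurable_funTS; apply/measurable_EFinP; apply: continuous_borel.
- by move=> t _; rewrite lee_fin.
have H1 := integral_csum_le uL hG vA cpsi psi0 cC C10 psiC cW' JE omW vW' n.
have H2 : (\int[theta]_(x in (A n : set (borel G))) (g x)%:E <=
    (mean g + eps / 4)%:E * theta (A n))%E by near: n.
have H3 : ((nbd L A C1 W' n)%:R%:E <= d%:E * theta (A n))%E by near: n.
have H4 : ((cnt L A n v)%:E <= d%:E * theta (A n))%E by near: n.
rewrite aE -EFinM in H2 H3 H4 *; rewrite !lee_fin in H3 H4 *.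
apply: (le_trans (leeD H1 H2)); rewrite -EFinD lee_fin.
have H5 : J * (cnt L A n v + (nbd L A C1 W' n)%:R) <= eps / 2 * a.
  apply: (@le_trans _ _ (J * (d + d) * a)); last by rewrite ler_pM2r.
  by rewrite -mulrA ler_wpM2l// mulrDl lerD.
have H6 : (mean g + eps / 4) * a <= eps / 2 * a.
  by rewrite ler_pM2r//; move: sm; rewrite -/(mean g) => sm; lra.
by apply: (le_trans (lerD H5 H6)); rewrite -mulrDl -splitr.
Unshelve. all: by end_near.
Qed.

End weak_model_set_approximation.

(** * Complex-valued functions *)

Section complex_functions.
Context {R : realType} {X : topologicalZmodType}.
Implicit Types (f chi P Q : X -> R[i]) (C S : X -> R).

Lemma normcE (z : R[i]) : `|z| = Complex (Normc.normc z) 0.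
Proof. by case: z. Qed.

Lemma normc_Re_le (z : R[i]) : `|complex.Re z| <= Normc.normc z.
Proof. by have := normc_ge_Re z; rewrite normcE lecE => /andP[]. Qed.

Lemma normc_Im_le (z : R[i]) : `|complex.Im z| <= Normc.normc z.
Proof.
case: z => a b /=; rewrite -sqrtr_sqr ler_sqrt ?addr_ge0 ?sqr_ge0//.
by rewrite lerDr sqr_ge0.
Qed.

Lemma normc_le_add (a b : R) : Normc.normc (Complex a b) <= `|a| + `|b|.
Proof.
rewrite /= -[leRHS]ger0_norm ?addr_ge0// -sqrtr_sqr ler_sqrt ?sqr_ge0//.
rewrite sqrrD !real_normK ?num_real// -addrA lerD2l lerDr mulrn_wge0//.
Qed.

Lemma ccontinuous_Re_Im f : ccontinuous f ->
  continuous (fun x => complex.Re (f x)) /\ continuous (fun x => complex.Im (f x)).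
Proof.
move=> cf; split=> x; apply/cvgrPdist_le => e e0.
- have e0' : (0 : R[i]) < Complex e 0 by rewrite ltcE /= eqxx.
  move/cvgrPdist_le : (cf x) => /(_ _ e0'); apply: filterS => y.
  rewrite normcE lecE => /andP[_ /= H]; apply: le_trans H.
  by have := normc_Re_le (f x - f y); case: (f x) (f y) => a b [c d].
- have e0' : (0 : R[i]) < Complex e 0 by rewrite ltcE /= eqxx.
  move/cvgrPdist_le : (cf x) => /(_ _ e0'); apply: filterS => y.
  rewrite normcE lecE => /andP[_ /= H]; apply: le_trans H.
  by have := normc_Im_le (f x - f y); case: (f x) (f y) => a b [c d].
Qed.

Lemma continuous_Complex C S : continuous C -> continuous S ->
  ccontinuous (fun x => Complex (C x) (S x)).
Proof.
move=> cC cS x; apply/cvgrPdist_le => -[e d]; rewrite ltcE /= => /andP[/eqP -> e0].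
have e20 : 0 < e / 2 by rewrite divr_gt0.
move/cvgrPdist_le : (cC x) => /(_ _ e20) nC; move/cvgrPdist_le : (cS x) => /(_ _ e20) nS.
apply: filterS2 nC nS => y H1 H2; rewrite normcE lecE eqxx/=.
by apply: (le_trans (normc_le_add _ _)); rewrite (splitr e) lerD.
Qed.

Lemma character_continuous_character C S : character C S ->
  continuous_character (fun x => Complex (C x) (S x)).
Proof.
move=> [[[cC _] [cS _]] n1 CD SD]; split.
- exact: continuous_Complex.
- by move=> x; rewrite normcE /= n1 sqrtr1.
- by move=> x y; rewrite CD SD; congr Complex; rewrite addrC.
Qed.

Lemma characterC C S : character C S -> character C (fun x => - S x).
Proof.
move=> [[aC aS] n1 CD SD]; split.
- by split => //; exact: apN.
- by move=> x; rewrite sqrrN n1.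
- by move=> x y; rewrite CD mulrNN.
- by move=> x y; rewrite SD mulNr mulrN opprD.
Qed.

Lemma trigonometric_polynomial_sum (s : seq (R[i] * (X -> R[i]))) :
  (forall p, p \in s -> continuous_character p.2) ->
  trigonometric_polynomial (fun t => \sum_(p <- s) p.1 * p.2 t).
Proof.
move=> sc; pose p0 : R[i] * (X -> R[i]) := (0, fun=> 0).
exists (size s), (fun i => (nth p0 s i).1), (fun i => (nth p0 s i).2); split.
  by move=> i; apply: sc; exact: mem_nth.
by apply/funext => t; rewrite (big_nth p0) big_mkord.
Qed.

(* [k (a C + b S) = k (a - i b)/2 chi + k (a + i b)/2 chi^-1] where [chi = C + i S]. *)
Definition character_terms (k : R[i]) (p : R * R * (X -> R) * (X -> R)) :
    seq (R[i] * (X -> R[i])) :=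
  [:: (k * Complex (p.1.1.1 / 2) (- (p.1.1.2 / 2)), fun x => Complex (p.1.2 x) (p.2 x));
      (k * Complex (p.1.1.1 / 2) (p.1.1.2 / 2), fun x => Complex (p.1.2 x) (- p.2 x))].

Lemma character_terms_character k (s : seq (R * R * (X -> R) * (X -> R))) :
  (forall p, p \in s -> character p.1.2 p.2) ->
  forall q, q \in flatten [seq character_terms k p | p <- s] -> continuous_character q.2.
Proof.
move=> sc q /flattenP[_ /mapP[p /sc cp ->]]; rewrite !inE => /orP[] /eqP ->.
  exact: character_continuous_character.
by apply: (@character_continuous_character _ (fun x => - p.2 x)); exact: characterC.
Qed.

Lemma sum_character_terms k (s : seq (R * R * (X -> R) * (X -> R))) t :
  \sum_(q <- flatten [seq character_terms k p | p <- s]) q.1 * q.2 t =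
  k * Complex (trigsum s t) 0.
Proof.
rewrite big_flatten big_map /trigsum.
elim: s => [|p s IH]; first by rewrite !big_nil; case: k => a b; congr Complex; ring.
rewrite !big_cons IH big_nil; case: k {IH} => a b.
move: p => [[[c d] C] S] /=.
set r := \sum_(_ <- _) _; move: (C t) (S t) r => u v r.
by congr Complex; field.
Qed.

Lemma trigsum_trigonometric_polynomial (s1 s2 : seq (R * R * (X -> R) * (X -> R))) :
  (forall p, p \in s1 -> character p.1.2 p.2) ->
  (forall p, p \in s2 -> character p.1.2 p.2) ->
  trigonometric_polynomial (fun t => Complex (trigsum s1 t) (trigsum s2 t)).
Proof.
move=> c1 c2.
have -> : (fun t => Complex (trigsum s1 t) (trigsum s2 t)) =
    (fun t => \sum_(q <- flatten [seq character_terms 1 p | p <- s1] ++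
      flatten [seq character_terms (Complex 0 1) p | p <- s2]) q.1 * q.2 t).
  apply/funext => t; rewrite big_cat/= !sum_character_terms.
  by congr Complex; ring.
apply: trigonometric_polynomial_sum => q; rewrite mem_cat => /orP[];
  exact: character_terms_character.
Qed.

End complex_functions.

Section besicovitch.
Context {R : realType} {G : topologicalZmodType}.
Variables (theta : {measure set (borel G) -> \bar R}) (A : nat -> set G).
Hypotheses (hG : haar_measure theta) (lG : lca_group G) (vA : van_hove_sequence theta A).

Lemma continuous_integrable (f : G -> R) (K : set G) : continuous f -> compact K ->
  theta.-integrable (K : set (borel G)) (fun t : borel G => (f t)%:E).
Proof.
move=> cf cK; apply: measurable_bounded_integrable.
- exact: compact_borel (proj1 lG) cK.
- exact: haar_compact hG _ cK.
- by apply: measurable_funTS; exact: continuous_borel.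
- have : compact [set f x | x in K].
    by apply: continuous_compact => //; exact: continuous_subspaceT.
  move=> /compact_bounded[M [rM MB]]; exists M; split => // x Mx y Ky /=.
  by apply: (MB x Mx); exists y.
Qed.

Lemma besicovitch_norm_le (f g : G -> R) c d : continuous f -> continuous g ->
  (\forall n \near \oo,
    (\int[theta]_(t in (A n : set (borel G))) (`|f t|)%:E <= c%:E * theta (A n))%E) ->
  (\forall n \near \oo,
    (\int[theta]_(t in (A n : set (borel G))) (`|g t|)%:E <= d%:E * theta (A n))%E) ->
  (besicovitch_norm theta A (fun t => Complex (f t) (g t)) <= (c + d)%:E)%E.
Proof.
move=> cf cg Hf Hg.
have cn (h : G -> R) : continuous h -> continuous (fun t => `|h t|).
  move=> ch t; apply: (@continuous_comp _ _ _ h (fun x : R => `|x|)); first exact: ch.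
  exact: norm_continuous.
have ca : continuous (fun t => Normc.normc (Complex (f t) (g t))).
  move=> t; apply: (@continuous_comp _ _ _ (fun t => f t ^+ 2 + g t ^+ 2) Num.sqrt).
    by apply: cvgD; apply: cvgM; (exact: cf || exact: cg).
  exact: sqrt_continuous.
rewrite /besicovitch_norm /limn_esup limf_esupE.
(* The upper limit is an infimum over the sets of the filter at infinity, and [V] is one of these
   sets. *)
pose V := [set n | (\int[theta]_(t in (A n : set (borel G))) (Normc.normc (Complex (f t) (g t)))%:E
   / theta (A n) <= (c + d)%:E)%E].
have nV : \oo V.
  apply: filterS2 Hf Hg => n; have [a a0 aE] := van_hove_fin hG vA n.
  rewrite /V/= aE inver gt_eqF// lee_pdivrMr// -!EFinM => H1 H2.
  rewrite mulrDl EFinD; apply: le_trans (leeD H1 H2).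
  have mA := van_hove_borel vA n.
  have mf (h : G -> R) : continuous h ->
      measurable_fun (A n : set (borel G)) (fun t : borel G => (h t)%:E : \bar R).
    by move=> ch; apply: measurable_funTS; apply/measurable_EFinP; exact: continuous_borel.
  rewrite -ge0_integralD//; [|exact: mf (cn _ cf)|exact: mf (cn _ cg)].
  apply: ge0_le_integral => //.
  - exact: (mf _ ca).
  - by apply: emeasurable_funD; apply: mf; exact: cn.
  - by move=> t _; rewrite -EFinD lee_fin normc_le_add.
apply: (@le_trans _ _ (ereal_sup [set (\int[theta]_(t in (A n : set (borel G)))
    (Normc.normc (Complex (f t) (g t)))%:E / theta (A n))%E | n in V])).
  by apply: ereal_inf_lbound; exists V.
by apply: ge_ereal_sup => _ [n Vn <-].
Qed.

End besicovitch.

Theorem proposition4p45 (R : realType) (G : topologicalZmodType)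
    (theta : {measure set (borel G) -> \bar R}) (A : nat -> set G)
    (Lambda : set G) :
  lca_group G -> sigma_compact G -> haar_measure theta ->
  van_hove_sequence theta A ->
  weak_model_set_of_maximal_density theta A Lambda ->
  translation_bounded (dirac_comb R G Lambda) /\
  besicovitch_ap_measure theta A (dirac_comb R G Lambda).
Proof.
move=> lG _ hG vA [H [L [W [thetaH [thetaGH [d [[[_ lH latL iL dL] cW ->]
  [hH hGH [F fF dE] maxd]]]]]]]].
have [sL [isoL _]] := latL; have uL := lattice_uniformly_discrete sL isoL.
rewrite {}dE in maxd.
split; first exact: model_set_translation_bounded.
move=> phi [/ccontinuous_Re_Im[cRe cIm]]; set C := closure _ => cC.
have reC x : complex.Re (phi x) != 0 -> C x.
  by move=> n0; apply: subset_closure => /=; apply: contra_neq n0 => ->.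
have imC x : complex.Im (phi x) != 0 -> C x.
  by move=> n0; apply: subset_closure => /=; apply: contra_neq n0 => ->.
pose f := csum L (fun x => complex.Re (phi x)) (\1_W : H -> R).
pose g := csum L (fun x => complex.Im (phi x)) (\1_W : H -> R).
have W1 h : `|\1_W h : R| <= 1.
  by rewrite indicE; case: (_ \in _); rewrite ?normr1 ?normr0.
have WW h : (\1_W h : R) != 0 -> W h.
  by rewrite indicE; have [//|Wh] := pselect (W h); rewrite memNset// eqxx.
have cf : continuous f := csum_continuous lG uL cRe cC reC cW WW W1.
have cg : continuous g := csum_continuous lG uL cIm cC imC cW WW W1.
have -> : conv_measure (dirac_comb R G (model_set L W)) phi = (fun t => Complex (f t) (g t)).
  apply/funext => t; congr Complex.
    exact: (Rintegral_model_set lG uL cW iL t cRe cC reC).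
  exact: (Rintegral_model_set lG uL cW iL t cIm cC imC).
split=> [K cK|eps eps0].
  by split; exact: (continuous_integrable hG lG).
(* Real and imaginary parts together cost [eps / 2], which leaves room for the strict inequality. *)
have eps40 : 0 < eps / 4 by rewrite divr_gt0.
have [s1 [s1c H1]] := model_set_trigsum_approx lG lH sL uL cW iL dL fF hG hH hGH vA maxd
  cRe cC reC eps40.
have [s2 [s2c H2]] := model_set_trigsum_approx lG lH sL uL cW iL dL fF hG hH hGH vA maxd
  cIm cC imC eps40.
exists (fun t => Complex (trigsum s1 t) (trigsum s2 t)).
  exact: trigsum_trigonometric_polynomial.
have [cs1 _] := trigsum_ap s1c; have [cs2 _] := trigsum_ap s2c.
apply: (@le_lt_trans _ _ (eps / 4 + eps / 4)%:E); last by rewrite lte_fin; lra.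
have cf1 : continuous (fun t => f t - trigsum s1 t).
  by move=> t; apply: cvgB; [exact: cf|exact: cs1].
have cg2 : continuous (fun t => g t - trigsum s2 t).
  by move=> t; apply: cvgB; [exact: cg|exact: cs2].
exact: (besicovitch_norm_le hG vA cf1 cg2 H1 H2).
Qed.
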